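(* Let $A=\{a_1,a_2\}$ and $B=\{b_1,b_2\}$ be two-element subsets of $\mathbb D\setminus\{0\}$. Then $$l_{\mathbb D^2}(A\times B,(0,0))=l_{\mathbb D}(A,0)=l_{\mathbb D}(B,0)$$ if and only if there is a rotation (about the origin) that maps $A$ onto $B$. In addition, if $B=e^{i\theta}A$, where $\theta\in\mathbb R$, then the extremal discs for $l_{\mathbb D^2}(A\times B,(0,0))$ are of the form $\zeta\mapsto(e^{i\varphi}\zeta,e^{i(\varphi+\theta)}\zeta)$, $\varphi\in\mathbb R$.
   Context: $\mathbb D$ is the open unit disc, and $\mathcal O(\mathbb D,D)$ is the set of holomorphic maps from $\mathbb D$ to $D$. For a domain $D\subset\mathbb C^n$, a finite nonempty set $C\subset D$ and $z\in D$, the Lempert function with poles in $C$ is $$l_D(C,z)=\inf\Big\{\prod_{c\in C}|\lambda_c|:\ \exists\psi\in\mathcal O(\mathbb D,D),\ \psi(0)=z,\ \psi(\lambda_c)=c\ \text{for each } c\in C\Big\}.$$ This function does not increase when poles are added, so $l_D(C,z)=\min_{\varnothing\ne C'\subset C}l_D(C',z)$. Since $\mathbb D^2$ is a taut domain, the infimum for $l_{\mathbb D^2}$ is attained (when one allows discs through a nonempty subset of the poles), and the corresponding discs are called extremal: an extremal disc for $l_{\mathbb D^2}(C,z)$ is a map $\psi\in\mathcal O(\mathbb D,\mathbb D^2)$ with $\psi(0)=z$ for which there are a nonempty subset $C'\subset C$ and points $\lambda_c\in\mathbb D$ ($c\in C'$) with $\psi(\lambda_c)=c$ and $\prod_{c\in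 C'}|\lambda_c|=l_{\mathbb D^2}(C,z)$.
   Formalization: The description of extremal discs with the given θ is asserted only when a₁+a₂≠0; if a₂=−a₁ it fails (A=B={a,−a}, θ=0, disc ζ↦(ζ,−ζ)), and then extremal discs are those of the stated form for some θ' with B=e^{iθ'}A. *)

(* Defs.v *)
From Stdlib Require Import Reals List.
From Coquelicot Require Import Coquelicot.
Open Scope R_scope.

(** Sets are predicates, and subsets of [C] and [C^2] live in normed modules over
    the complex field [C_AbsRing], so that [ex_derive] is complex differentiability. *)

Definition C2 : NormedModule C_AbsRing :=
  prod_NormedModule C_AbsRing C_NormedModule C_NormedModule.

Definition unit_disc : C_NormedModule -> Prop := fun z => Cmod z < 1.

Definition set_prod (A B : C_NormedModule -> Prop) : C2 -> Prop :=
  fun p => A (fst p) /\ B (snd p).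

Definition bidisc : C2 -> Prop := set_prod unit_disc unit_disc.

(** Discs are total functions on [C] of which only the restriction to the unit
    disc matters. *)
Definition analytic_disc {V : NormedModule C_AbsRing} (D : V -> Prop) (psi : C -> V)
  : Prop :=
  forall zeta : C, unit_disc zeta ->
    ex_derive (K := C_AbsRing) (V := V) psi zeta /\ D (psi zeta).

Definition hits_poles {V : NormedModule C_AbsRing} (P : V -> Prop)
    (psi : C -> V) (lambda : V -> C) : Prop :=
  forall c : V, P c -> unit_disc (lambda c) /\ psi (lambda c) = c.

(** [r] is the product of the [Cmod (lambda c)] over the finite set [P]. *)
Definition is_pole_product {V : NormedModule C_AbsRing} (P : V -> Prop)
    (lambda : V -> C) (r : R) : Prop :=
  exists l : list V,
    NoDup l /\ (forall c : V, In c l <-> P c) /\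
    r = fold_right Rmult 1 (map (fun c => Cmod (lambda c)) l).

Definition lempert {V : NormedModule C_AbsRing} (D P : V -> Prop) (z : V) : Rbar :=
  Glb_Rbar (fun r : R =>
    exists (psi : C -> V) (lambda : V -> C),
      analytic_disc D psi /\ psi (RtoC 0) = z /\
      hits_poles P psi lambda /\ is_pole_product P lambda r).

(** An extremal disc may pass through a nonempty subset [P'] of the poles only. *)
Definition extremal_disc {V : NormedModule C_AbsRing} (D P : V -> Prop) (z : V)
    (psi : C -> V) : Prop :=
  analytic_disc D psi /\ psi (RtoC 0) = z /\
  exists (P' : V -> Prop) (lambda : V -> C) (r : R),
    (exists c : V, P' c) /\ (forall c : V, P' c -> P c) /\
    hits_poles P' psi lambda /\ is_pole_product P' lambda r /\
    Finite r = lempert D P z.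

Definition pair_set (a1 a2 : C) : C_NormedModule -> Prop :=
  fun w => w = a1 \/ w = a2.

(** [expi theta] is e^{i theta}. *)
Definition expi (theta : R) : C := (cos theta, sin theta).

(** e^{i theta} A = B *)
Definition rotates_onto (theta : R) (A B : C_NormedModule -> Prop) : Prop :=
  forall w : C, B w <-> exists a : C, A a /\ w = Cmult (expi theta) a.

(** On the unit disc, psi is zeta |-> (e^{i phi} zeta, e^{i (phi + theta)} zeta). *)
Definition is_rotation_disc (phi theta : R) (psi : C -> C2) : Prop :=
  forall zeta : C, unit_disc zeta ->
    psi zeta = (Cmult (expi phi) zeta, Cmult (expi (phi + theta)) zeta).

(* Main.v *)
Require Import Defs.
From Stdlib Require Import Reals List Lra Classical ClassicalEpsilon Permutation.
From Coquelicot Require Import Coquelicot.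
Open Scope R_scope.

(** Let [b_a(z) = (a - z) / (1 - conj a z)] be the Blaschke factor of [a].  If [f] maps
    the disc into itself and [f 0 = 0], then [b_a o f] has the value [a] at 0 and a
    zero at each preimage of [a]; dividing by the Blaschke factors of these zeros
    leaves a map [G] into the closed disc, so that [|a|] is at most the product of the
    moduli of any preimages of [a] ([two_preimages_bound]).  Applied to the rows and
    columns of [A x B] this gives [l(A x B) >= |a1 a2|, |b1 b2|], and for one disc it
    gives [l(A) = |a1 a2|].

    If [B = e^(i theta) A], the disc [zeta |-> (zeta, e^(i theta) zeta)] has the value
    [|a1 a2|] but meets two of the four poles only.  Moving their preimages from [a] to
    [a / rho] with [rho < 1] gives the interpolation problem a family of solutions, among
    which a step of Schur's algorithm finds one that meets the two other poles at points
    [s], [-s] close to the circle ([interpolation_near_boundary]).  The cost tends to 0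
    as [rho] tends to 1.

    Conversely suppose that [l(A x B) = |a1 a2| = |b1 b2|], and let the points over the
    four poles be nearly optimal.  Each of the four quotients [G] then has modulus
    nearly 1 at 0, hence is nearly constant by [schwarz_pick].  In the limit [b_a o f]
    is, up to a unimodular factor, a Blaschke product of degree at most two whose zeros
    are the limits of the two points over [a], where points that reach the circle drop
    out.  This is expressed by polynomial relations between the four points
    ([extremal_configuration]), so that it suffices to pass to the limit in the points.
    If all four limits stay in the disc, the two coordinates are of degree two, and their deck involutions [sigma1],
    [sigma2] permute the four points like a Klein group; two such automorphisms of the
    disc commute at two points only if they are equal, which is absurd
    ([no_involution_square]).  Hence some point reaches the circle, the relations force
    the diagonally opposite one there as well, and the other two satisfy
    [a = u z], [b = v z] with unimodular [u], [v] for two diagonal poles [(a, b)]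
    ([extremal_configuration_diagonal]).  Thus [v / u] rotates [A] onto [B].  For an
    extremal disc the same argument applies at once, a pole that is not met being
    treated as one that is met at the boundary point 1, and equality in the Schwarz
    lemma at one remaining pole makes both coordinates rotations.

    The complex analysis starts from differentiability at single points: Goursat's
    theorem by bisection gives the mean value property, and this the maximum principle,
    for functions that may be merely continuous at finitely many points, as the
    quotients [G] are. *)

(** * Limits in the complex plane and compactness by filters *)

Definition clim {T : Type} (F : (T -> Prop) -> Prop) (f : T -> C) (l : C) : Prop :=
  forall eps : R, 0 < eps -> F (fun x => Cmod (Cminus (f x) l) < eps).

Lemma clim_filterlim {T : Type} (F : (T -> Prop) -> Prop) {FF : Filter F}
    (f : T -> C) (l : C) :
  clim F f l <-> filterlim f F (locally (T := AbsRing_UniformSpace C_AbsRing) l).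
Proof.
  rewrite (@filterlim_locally T (AbsRing_UniformSpace C_AbsRing) F FF f l).
  split; intros H.
  - intros eps. exact (H eps (cond_pos eps)).
  - intros eps he. exact (H (mkposreal eps he)).
Qed.

Lemma clim_const {T : Type} (F : (T -> Prop) -> Prop) {FF : Filter F} (c : C) :
  clim F (fun _ => c) c.
Proof. apply clim_filterlim; [exact FF|].
  apply (filterlim_const (U := AbsRing_UniformSpace C_AbsRing)).
Qed.

Lemma clim_plus {T : Type} (F : (T -> Prop) -> Prop) {FF : Filter F}
    (f g : T -> C) (l m : C) :
  clim F f l -> clim F g m -> clim F (fun x => Cplus (f x) (g x)) (Cplus l m).
Proof.
  rewrite 3!clim_filterlim by exact FF. intros hf hg.
  eapply filterlim_comp_2; [exact hf | exact hg |].
  apply (filterlim_plus (V := AbsRing_NormedModule C_AbsRing)).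
Qed.

Lemma clim_mult {T : Type} (F : (T -> Prop) -> Prop) {FF : Filter F}
    (f g : T -> C) (l m : C) :
  clim F f l -> clim F g m -> clim F (fun x => Cmult (f x) (g x)) (Cmult l m).
Proof.
  rewrite 3!clim_filterlim by exact FF. intros hf hg.
  eapply filterlim_comp_2; [exact hf | exact hg |].
  apply (filterlim_mult (K := C_AbsRing)).
Qed.

Lemma clim_opp {T : Type} (F : (T -> Prop) -> Prop) {FF : Filter F}
    (f : T -> C) (l : C) :
  clim F f l -> clim F (fun x => Copp (f x)) (Copp l).
Proof.
  intros H eps he. generalize (H eps he). apply filter_imp. intros x hx.
  replace (- f x - - l)%C with (- (f x - l))%C by ring.
  now rewrite Cmod_opp.
Qed.

Lemma clim_minus {T : Type} (F : (T -> Prop) -> Prop) {FF : Filter F}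
    (f g : T -> C) (l m : C) :
  clim F f l -> clim F g m -> clim F (fun x => Cminus (f x) (g x)) (Cminus l m).
Proof. intros hf hg. apply clim_plus; [exact FF|exact hf|]. now apply clim_opp. Qed.

Lemma clim_conj {T : Type} (F : (T -> Prop) -> Prop) {FF : Filter F}
    (f : T -> C) (l : C) :
  clim F f l -> clim F (fun x => Cconj (f x)) (Cconj l).
Proof.
  intros H eps he. generalize (H eps he). apply filter_imp. intros x hx.
  now rewrite <- Cminus_conj, Cmod_conj.
Qed.

Lemma Cmod_triangle_inv (x y : C) : Rabs (Cmod x - Cmod y) <= Cmod (x - y).
Proof.
  apply Rabs_le. split.
  - assert (H := Cmod_triangle (y - x) x).
    replace (y - x + x)%C with y in H by ring.
    replace (y - x)%C with (- (x - y))%C in H by ring. rewrite Cmod_opp in H. lra.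
  - assert (H := Cmod_triangle (x - y) y).
    replace (x - y + y)%C with x in H by ring. lra.
Qed.

Lemma clim_Cmod {T : Type} (F : (T -> Prop) -> Prop) {FF : Filter F}
    (f : T -> C) (l : C) :
  clim F f l -> filterlim (fun x => Cmod (f x)) F (locally (Cmod l)).
Proof.
  intros H. apply filterlim_locally. intros eps.
  generalize (H eps (cond_pos eps)). apply filter_imp. intros x hx.
  eapply Rle_lt_trans; [apply Cmod_triangle_inv | exact hx].
Qed.

Lemma clim_inv {T : Type} (F : (T -> Prop) -> Prop) {FF : Filter F}
    (f : T -> C) (l : C) :
  l <> 0 -> clim F f l -> clim F (fun x => Cinv (f x)) (Cinv l).
Proof.
  intros hl H eps he.
  assert (hm : 0 < Cmod l) by now apply Cmod_gt_0.
  pose (d := Rmin (Cmod l / 2) (eps * (Cmod l * Cmod l) / 2)).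
  assert (hd : 0 < d).
  { unfold d. apply Rmin_pos; [lra|].
    apply Rdiv_lt_0_compat; [|lra]. apply Rmult_lt_0_compat; [lra|nra]. }
  generalize (H d hd). apply filter_imp. intros x hx.
  assert (h1 : Cmod (f x - l) < Cmod l / 2)
    by (eapply Rlt_le_trans; [exact hx|apply Rmin_l]).
  assert (h2 : Cmod (f x - l) < eps * (Cmod l * Cmod l) / 2)
    by (eapply Rlt_le_trans; [exact hx|apply Rmin_r]).
  assert (h3 : Cmod l / 2 < Cmod (f x)).
  { assert (h := Cmod_triangle_inv (f x) l). apply Rabs_le_between in h. lra. }
  assert (hf : f x <> 0) by (apply Cmod_gt_0; lra).
  replace (/ f x - / l)%C with (- (f x - l) / (f x * l))%C
    by (field; split; assumption).
  rewrite Cmod_div by (now apply Cmult_neq_0).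
  rewrite Cmod_opp, Cmod_mult.
  apply Rlt_div_l; [nra|].
  eapply Rlt_le_trans; [exact h2|].
  assert (Cmod l / 2 * Cmod l <= Cmod (f x) * Cmod l) by nra. nra.
Qed.

Lemma clim_div {T : Type} (F : (T -> Prop) -> Prop) {FF : Filter F}
    (f g : T -> C) (l m : C) :
  m <> 0 -> clim F f l -> clim F g m ->
  clim F (fun x => Cdiv (f x) (g x)) (Cdiv l m).
Proof.
  intros hm hf hg. apply clim_mult; [exact FF|exact hf|]. now apply clim_inv.
Qed.

(** Refining the filter plays the role of extracting a subsequence, and can be
    repeated for several functions.  The limit is the supremum of the values that [u]
    reaches frequently along [F]. *)
Lemma bounded_cluster {T : Type} (F : (T -> Prop) -> Prop) {FF : ProperFilter F}
    (u : T -> R) (M : R) :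
  F (fun x => Rabs (u x) <= M) ->
  exists (G : (T -> Prop) -> Prop) (l : R),
    ProperFilter G /\ (forall P, F P -> G P) /\ filterlim u G (locally l).
Proof.
  intros hb.
  pose (E := fun x => ~ F (fun t => u t < x)).
  assert (hE : E (- M)).
  { intros h. destruct (filter_ex _ (filter_and _ _ hb h)) as [t [h1 h2]].
    apply Rabs_le_between in h1. lra. }
  assert (hub : forall x, E x -> x <= M).
  { intros x hx. apply Rnot_lt_le. intros hlt. apply hx.
    generalize hb. apply filter_imp. intros t ht.
    apply Rabs_le_between in ht. lra. }
  destruct (completeness E) as [l [hl1 hl2]].
  { exists M. intros x hx. now apply hub. }
  { now exists (- M). }
  exists (fun P => exists eps : posreal, F (fun t => Rabs (u t - l) < eps -> P t)), l.
  assert (hfreq : forall eps : posreal, ~ F (fun t => ~ Rabs (u t - l) < eps)).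
  { intros eps h.
    assert (h1 : F (fun t => u t < l + eps / 2)).
    { apply NNPP. intros hn. assert (hh := hl1 _ hn). assert (h0 := cond_pos eps). lra. }
    assert (h2 : exists x, E x /\ l - eps < x).
    { apply NNPP. intros hn. assert (h0 := cond_pos eps).
      assert (l <= l - eps); [|lra]. apply hl2. intros x hx.
      apply Rnot_lt_le. intros hlt. apply hn. now exists x. }
    destruct h2 as [x [hx hlx]]. apply hx.
    generalize (filter_and _ _ h h1). apply filter_imp. intros t [ht1 ht2].
    apply Rnot_le_lt. intros hle. apply ht1. apply Rabs_lt_between.
    assert (h0 := cond_pos eps). lra. }
  split; [|split].
  - constructor.
    + intros P [eps hP]. apply NNPP. intros hn. apply (hfreq eps).
      generalize hP. apply filter_imp. intros t ht hlt. apply hn. exists t. auto.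
    + constructor.
      * exists (mkposreal 1 Rlt_0_1). apply filter_forall. auto.
      * intros P Q [e1 h1] [e2 h2].
        exists (mkposreal _ (Rmin_pos _ _ (cond_pos e1) (cond_pos e2))).
        generalize (filter_and _ _ h1 h2). apply filter_imp. simpl.
        intros t [g1 g2] ht. split; [apply g1|apply g2];
          (eapply Rlt_le_trans; [exact ht|]); [apply Rmin_l|apply Rmin_r].
      * intros P Q hPQ [eps h]. exists eps. generalize h. apply filter_imp. auto.
  - intros P hP. exists (mkposreal 1 Rlt_0_1). generalize hP. apply filter_imp. auto.
  - intros P [eps hP]. exists eps. apply filter_forall. intros t ht.
    apply hP. exact ht.
Qed.

Lemma Cmod_le_Rabs (z : C) : Cmod z <= Rabs (fst z) + Rabs (snd z).
Proof.
  unfold Cmod. rewrite <- (sqrt_Rsqr (Rabs (fst z) + Rabs (snd z))).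
  - apply sqrt_le_1_alt. unfold Rsqr.
    assert (h1 := Rabs_pos (fst z)). assert (h2 := Rabs_pos (snd z)).
    rewrite <- (pow2_abs (fst z)), <- (pow2_abs (snd z)). nra.
  - assert (h1 := Rabs_pos (fst z)). assert (h2 := Rabs_pos (snd z)). lra.
Qed.

Lemma Rabs_fst_le_Cmod (z : C) : Rabs (fst z) <= Cmod z.
Proof. eapply Rle_trans; [apply Rmax_l|apply Rmax_Cmod]. Qed.

Lemma Rabs_snd_le_Cmod (z : C) : Rabs (snd z) <= Cmod z.
Proof. eapply Rle_trans; [apply Rmax_r|apply Rmax_Cmod]. Qed.

Lemma bounded_ccluster {T : Type} (F : (T -> Prop) -> Prop) {FF : ProperFilter F}
    (u : T -> C) (M : R) :
  F (fun x => Cmod (u x) <= M) ->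
  exists (G : (T -> Prop) -> Prop) (l : C),
    ProperFilter G /\ (forall P, F P -> G P) /\ clim G u l.
Proof.
  intros hb.
  destruct (bounded_cluster F (fun t => fst (u t)) M) as (G1 & l1 & hG1 & h1 & hl1).
  { generalize hb. apply filter_imp. intros t ht.
    eapply Rle_trans; [apply Rabs_fst_le_Cmod|exact ht]. }
  destruct (bounded_cluster G1 (fun t => snd (u t)) M) as (G2 & l2 & hG2 & h2 & hl2).
  { apply h1. generalize hb. apply filter_imp. intros t ht.
    eapply Rle_trans; [apply Rabs_snd_le_Cmod|exact ht]. }
  exists G2, (l1, l2). split; [exact hG2|]. split; [auto|].
  intros eps he. assert (he2 : 0 < eps / 2) by lra.
  assert (g1 : G2 (fun t => Rabs (fst (u t) - l1) < eps / 2)).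
  { apply h2. apply (hl1 (fun y => Rabs (y - l1) < eps / 2)).
    exists (mkposreal _ he2). intros y hy. exact hy. }
  assert (g2 : G2 (fun t => Rabs (snd (u t) - l2) < eps / 2)).
  { apply (hl2 (fun y => Rabs (y - l2) < eps / 2)).
    exists (mkposreal _ he2). intros y hy. exact hy. }
  generalize (filter_and _ _ g1 g2). apply filter_imp. intros t [ht1 ht2].
  eapply Rle_lt_trans; [apply Cmod_le_Rabs|]. simpl.
  unfold Rminus in *. lra.
Qed.

Lemma clim_Cmod_le {T : Type} (F : (T -> Prop) -> Prop) {FF : ProperFilter F}
    (f g : T -> C) (l m : C) :
  clim F f l -> clim F g m -> F (fun x => Cmod (f x) <= Cmod (g x)) ->
  Cmod l <= Cmod m.
Proof.
  intros hf hg h.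
  apply (filterlim_le (F := F) (fun x => Cmod (f x)) (fun x => Cmod (g x))
           (Finite (Cmod l)) (Finite (Cmod m)) h).
  - exact (clim_Cmod F f l hf).
  - exact (clim_Cmod F g m hg).
Qed.

(** * Goursat's theorem on rectangles *)

(** The integral of the form [P dx + Q dy] over the boundary of the rectangle with
    lower left corner [(x, y)], width [w] and height [h]; opposite sides are combined. *)
Definition circulation (P Q : R -> R -> R) (x y w h : R) : R :=
  RInt (fun t => P t y - P t (y + h)) x (x + w) +
  RInt (fun t => Q (x + w) t - Q x t) y (y + h).

Lemma continuity_2d_continuous_fst (f : R -> R -> R) (x y : R) :
  continuity_2d_pt f x y -> continuous (fun t => f t y) x.
Proof.
  intros H. apply filterlim_locally. intros eps. destruct (H eps) as [d hd].
  exists d. intros t ht. apply hd; [exact ht|].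
  rewrite Rminus_eq_0, Rabs_R0. apply cond_pos.
Qed.

Lemma continuity_2d_continuous_snd (f : R -> R -> R) (x y : R) :
  continuity_2d_pt f x y -> continuous (fun t => f x t) y.
Proof.
  intros H. apply filterlim_locally. intros eps. destruct (H eps) as [d hd].
  exists d. intros t ht. apply hd; [|exact ht].
  rewrite Rminus_eq_0, Rabs_R0. apply cond_pos.
Qed.

Lemma continuous_Rminus (f g : R -> R) (x : R) :
  continuous f x -> continuous g x -> continuous (fun t => f t - g t) x.
Proof. intros hf hg. apply (continuous_minus (V := R_NormedModule)); assumption. Qed.

Lemma ex_RInt_Rminus_continuous (f g : R -> R) (a b : R) :
  a <= b ->
  (forall t, a <= t <= b -> continuous f t) ->
  (forall t, a <= t <= b -> continuous g t) ->
  ex_RInt (fun t => f t - g t) a b.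
Proof.
  intros hab hf hg. apply (ex_RInt_continuous (V := R_CompleteNormedModule)).
  intros t. rewrite Rmin_left, Rmax_right by lra. intros ht.
  apply continuous_Rminus; auto.
Qed.

Lemma RInt_split_Rminus (f g : R -> R) (a b c : R) :
  a <= b <= c ->
  (forall t, a <= t <= c -> continuous f t) ->
  (forall t, a <= t <= c -> continuous g t) ->
  RInt (fun t => f t - g t) a c =
  RInt (fun t => f t - g t) a b + RInt (fun t => f t - g t) b c.
Proof.
  intros h hf hg. symmetry.
  apply (RInt_Chasles (V := R_CompleteNormedModule));
    apply ex_RInt_Rminus_continuous; try lra; intros t ht;
    (apply hf || apply hg); lra.
Qed.

Lemma RInt_add_Rminus (f g k : R -> R) (a b : R) :
  a <= b ->
  (forall t, a <= t <= b -> continuous f t) ->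
  (forall t, a <= t <= b -> continuous g t) ->
  (forall t, a <= t <= b -> continuous k t) ->
  RInt (fun t => f t - k t) a b =
  RInt (fun t => f t - g t) a b + RInt (fun t => g t - k t) a b.
Proof.
  intros hab hf hg hk. symmetry.
  rewrite <- (RInt_plus (V := R_CompleteNormedModule));
    try (now apply ex_RInt_Rminus_continuous).
  apply (RInt_ext (V := R_CompleteNormedModule)). intros t _.
  change (f t - g t + (g t - k t) = f t - k t). ring.
Qed.

Lemma circulation_quarter (P Q : R -> R -> R) (x y w h : R) :
  0 <= w -> 0 <= h ->
  (forall s t, x <= s <= x + 2 * w -> y <= t <= y + 2 * h ->
     continuity_2d_pt P s t /\ continuity_2d_pt Q s t) ->
  circulation P Q x y (2 * w) (2 * h) =
  circulation P Q x y w h + circulation P Q (x + w) y w h +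
  (circulation P Q x (y + h) w h + circulation P Q (x + w) (y + h) w h).
Proof.
  intros hw hh H. unfold circulation.
  replace (x + w + w) with (x + 2 * w) by ring.
  replace (y + h + h) with (y + 2 * h) by ring.
  assert (cP : forall t0, y <= t0 <= y + 2 * h ->
            forall t, x <= t <= x + 2 * w -> continuous (fun s => P s t0) t).
  { intros t0 ht0 t ht. apply continuity_2d_continuous_fst. apply H; lra. }
  assert (cQ : forall t0, x <= t0 <= x + 2 * w ->
            forall t, y <= t <= y + 2 * h -> continuous (fun s => Q t0 s) t).
  { intros t0 ht0 t ht. apply continuity_2d_continuous_snd. apply H; lra. }
  rewrite (RInt_split_Rminus (fun t => P t y) (fun t => P t (y + 2 * h)) x (x + w) (x + 2 * w));
    [|lra|apply cP; lra|apply cP; lra].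
  rewrite (RInt_split_Rminus (fun t => Q (x + 2 * w) t) (fun t => Q x t) y (y + h) (y + 2 * h));
    [|lra|apply cQ; lra|apply cQ; lra].
  rewrite (RInt_add_Rminus (fun t => P t y) (fun t => P t (y + h))
             (fun t => P t (y + 2 * h)) x (x + w));
    [|lra| | | ]; try (intros t ht; apply cP; lra).
  rewrite (RInt_add_Rminus (fun t => P t y) (fun t => P t (y + h))
             (fun t => P t (y + 2 * h)) (x + w) (x + 2 * w));
    [|lra| | | ]; try (intros t ht; apply cP; lra).
  rewrite (RInt_add_Rminus (fun t => Q (x + 2 * w) t) (fun t => Q (x + w) t)
             (fun t => Q x t) y (y + h));
    [|lra| | | ]; try (intros t ht; apply cQ; lra).
  rewrite (RInt_add_Rminus (fun t => Q (x + 2 * w) t) (fun t => Q (x + w) t)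
             (fun t => Q x t) (y + h) (y + 2 * h));
    [|lra| | | ]; try (intros t ht; apply cQ; lra).
  ring.
Qed.

Lemma nested_intervals_point (x y : nat -> R) :
  (forall n, x n <= x (S n)) -> (forall n, y (S n) <= y n) ->
  (forall n, x n <= y n) ->
  exists l, forall n, x n <= l <= y n.
Proof.
  intros hx hy hxy.
  assert (mx : forall n k, x n <= x (n + k)%nat).
  { intros n k. induction k as [|k IH].
    - rewrite Nat.add_0_r. lra.
    - rewrite Nat.add_succ_r. eapply Rle_trans; [exact IH|apply hx]. }
  assert (my : forall n k, y (n + k)%nat <= y n).
  { intros n k. induction k as [|k IH].
    - rewrite Nat.add_0_r. lra.
    - rewrite Nat.add_succ_r. eapply Rle_trans; [apply hy|exact IH]. }
  assert (mxy : forall n m, x n <= y m).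
  { intros n m. eapply Rle_trans; [apply (mx n m)|].
    eapply Rle_trans; [apply hxy|]. rewrite Nat.add_comm. apply my. }
  destruct (completeness (fun r => exists n, r = x n)) as [l [h1 h2]].
  { exists (y 0%nat). intros r [n ->]. apply mxy. }
  { exists (x 0%nat). now exists 0%nat. }
  exists l. intros n. split.
  - apply h1. now exists n.
  - apply h2. intros r [m ->]. apply mxy.
Qed.

(** On a small rectangle around a point where [P] and [Q] are differentiable, the
    affine parts contribute [(Q_x - P_y)] times the area, so that for a closed form
    only the second order error is left. *)
Lemma circulation_small (P Q : R -> R -> R) (x0 y0 px k qy : R) (eps : posreal) :
  differentiable_pt_lim P x0 y0 px k -> differentiable_pt_lim Q x0 y0 k qy ->
  exists d : posreal, forall x y w h,
    0 <= w -> 0 <= h -> w + h < d ->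
    x <= x0 <= x + w -> y <= y0 <= y + h ->
    (forall s t, x <= s <= x + w -> y <= t <= y + h ->
       continuity_2d_pt P s t /\ continuity_2d_pt Q s t) ->
    Rabs (circulation P Q x y w h) <= 2 * eps * (w + h) ^ 2.
Proof.
  intros hP hQ. destruct (hP eps) as [d1 h1]. destruct (hQ eps) as [d2 h2].
  exists (mkposreal _ (Rmin_pos _ _ (cond_pos d1) (cond_pos d2))). simpl.
  intros x y w h hw hh hd hx hy hc.
  assert (hd1 : w + h < d1) by (eapply Rlt_le_trans; [exact hd|apply Rmin_l]).
  assert (hd2 : w + h < d2) by (eapply Rlt_le_trans; [exact hd|apply Rmin_r]).
  assert (he := cond_pos eps).
  assert (box : forall s t, x <= s <= x + w -> y <= t <= y + h ->
            Rabs (s - x0) <= w + h /\ Rabs (t - y0) <= w + h).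
  { intros s t hs ht. split; apply Rabs_le; lra. }
  assert (eP : forall s t, x <= s <= x + w -> y <= t <= y + h ->
            Rabs (P s t - P x0 y0 - (px * (s - x0) + k * (t - y0))) <= eps * (w + h)).
  { intros s t hs ht. destruct (box s t hs ht) as [b1 b2].
    eapply Rle_trans; [apply h1; lra|].
    apply Rmult_le_compat_l; [lra|]. apply Rmax_lub; assumption. }
  assert (eQ : forall s t, x <= s <= x + w -> y <= t <= y + h ->
            Rabs (Q s t - Q x0 y0 - (k * (s - x0) + qy * (t - y0))) <= eps * (w + h)).
  { intros s t hs ht. destruct (box s t hs ht) as [b1 b2].
    eapply Rle_trans; [apply h2; lra|].
    apply Rmult_le_compat_l; [lra|]. apply Rmax_lub; assumption. }
  assert (iP : ex_RInt (fun t => P t y - P t (y + h)) x (x + w)).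
  { apply ex_RInt_Rminus_continuous; [lra| |]; intros t ht;
      apply (continuity_2d_continuous_fst P); apply hc; lra. }
  assert (iQ : ex_RInt (fun t => Q (x + w) t - Q x t) y (y + h)).
  { apply ex_RInt_Rminus_continuous; [lra| |]; intros t ht;
      apply (continuity_2d_continuous_snd Q); apply hc; lra. }
  assert (JP : Rabs (RInt (fun t => P t y - P t (y + h)) x (x + w) + w * (k * h))
               <= w * (2 * eps * (w + h))).
  { assert (ic : ex_RInt (fun _ : R => k * h) x (x + w))
      by apply ex_RInt_const.
    assert (e : RInt (fun t => P t y - P t (y + h)) x (x + w) + w * (k * h) =
                RInt (fun t => (P t y - P t (y + h)) + k * h) x (x + w)).
    { symmetry.
      refine (eq_trans (RInt_plus (V := R_CompleteNormedModule) _ _ _ _ iP ic) _).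
      rewrite (RInt_const (V := R_CompleteNormedModule)).
      change (RInt (fun t => P t y - P t (y + h)) x (x + w) + (x + w - x) * (k * h) =
              RInt (fun t => P t y - P t (y + h)) x (x + w) + w * (k * h)).
      ring. }
    rewrite e.
    replace (w * (2 * eps * (w + h))) with ((x + w - x) * (2 * eps * (w + h))) by ring.
    apply abs_RInt_le_const; [lra| |].
    - apply (ex_RInt_plus (V := R_NormedModule)); assumption.
    - intros t ht.
      assert (e1 := eP t y ht ltac:(lra)). assert (e2 := eP t (y + h) ht ltac:(lra)).
      apply Rabs_le_between in e1. apply Rabs_le_between in e2.
      apply Rabs_le. lra. }
  assert (JQ : Rabs (RInt (fun t => Q (x + w) t - Q x t) y (y + h) - h * (k * w))
               <= h * (2 * eps * (w + h))).
  { assert (ic : ex_RInt (fun _ : R => k * w) y (y + h))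
      by apply ex_RInt_const.
    assert (e : RInt (fun t => Q (x + w) t - Q x t) y (y + h) - h * (k * w) =
                RInt (fun t => (Q (x + w) t - Q x t) - k * w) y (y + h)).
    { symmetry.
      refine (eq_trans (RInt_minus (V := R_CompleteNormedModule) _ _ _ _ iQ ic) _).
      rewrite (RInt_const (V := R_CompleteNormedModule)).
      change (RInt (fun t => Q (x + w) t - Q x t) y (y + h) - (y + h - y) * (k * w) =
              RInt (fun t => Q (x + w) t - Q x t) y (y + h) - h * (k * w)).
      ring. }
    rewrite e.
    replace (h * (2 * eps * (w + h))) with ((y + h - y) * (2 * eps * (w + h))) by ring.
    apply abs_RInt_le_const; [lra| |].
    - apply (ex_RInt_minus (V := R_NormedModule)); assumption.
    - intros t ht.
      assert (e1 := eQ (x + w) t ltac:(lra) ht). assert (e2 := eQ x t ltac:(lra) ht).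
      apply Rabs_le_between in e1. apply Rabs_le_between in e2.
      apply Rabs_le. lra. }
  unfold circulation. apply Rabs_le_between in JP. apply Rabs_le_between in JQ.
  apply Rabs_le. split; nra.
Qed.

Definition closed_form_at (P Q : R -> R -> R) (s t : R) : Prop :=
  exists px k qy, differentiable_pt_lim P s t px k /\ differentiable_pt_lim Q s t k qy.

Lemma closed_form_at_continuity (P Q : R -> R -> R) (s t : R) :
  closed_form_at P Q s t -> continuity_2d_pt P s t /\ continuity_2d_pt Q s t.
Proof.
  intros (px & k & qy & h1 & h2).
  split; apply differentiable_continuity_pt; eexists; eexists; eassumption.
Qed.

(** A corner of one of the four quarters, of size [w] x [h]; by the triangle inequality
    the last one is large if the other three are not. *)
Definition goursat_step (P Q : R -> R -> R) (w h : R) (c : R * R) : R * R :=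
  let (x, y) := c in
  let big u v := Rle_dec (Rabs (circulation P Q x y (2 * w) (2 * h)))
                         (4 * Rabs (circulation P Q u v w h)) in
  if big x y then (x, y)
  else if big (x + w) y then (x + w, y)
  else if big x (y + h) then (x, y + h)
  else (x + w, y + h).

Lemma goursat_step_corner (P Q : R -> R -> R) (w h : R) (c : R * R) :
  0 <= w -> 0 <= h ->
  fst c <= fst (goursat_step P Q w h c) <= fst c + w /\
  snd c <= snd (goursat_step P Q w h c) <= snd c + h.
Proof.
  intros hw hh. destruct c as [x y]. unfold goursat_step.
  repeat destruct (Rle_dec _ _); simpl; lra.
Qed.

Lemma goursat_step_large (P Q : R -> R -> R) (w h : R) (c : R * R) :
  0 <= w -> 0 <= h ->
  (forall s t, fst c <= s <= fst c + 2 * w -> snd c <= t <= snd c + 2 * h ->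
     continuity_2d_pt P s t /\ continuity_2d_pt Q s t) ->
  Rabs (circulation P Q (fst c) (snd c) (2 * w) (2 * h)) <=
  4 * Rabs (circulation P Q (fst (goursat_step P Q w h c))
              (snd (goursat_step P Q w h c)) w h).
Proof.
  intros hw hh H. destruct c as [x y]. simpl in H.
  assert (e := circulation_quarter P Q x y w h hw hh H).
  unfold goursat_step. repeat destruct (Rle_dec _ _); simpl; try assumption.
  assert (t1 : forall a b c d : R, Rabs (a + b + (c + d)) <= Rabs a + Rabs b + (Rabs c + Rabs d)).
  { intros. eapply Rle_trans; [apply Rabs_triang|].
    apply Rplus_le_compat; apply Rabs_triang. }
  assert (t2 := t1 (circulation P Q x y w h) (circulation P Q (x + w) y w h)
     (circulation P Q x (y + h) w h) (circulation P Q (x + w) (y + h) w h)).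
  rewrite <- e in t2. lra.
Qed.

(** The circulations of nested rectangles decrease at most like their areas, and at the
    common point they are of smaller order by [circulation_small]. *)
Theorem goursat (P Q : R -> R -> R) (x y w h : R) :
  0 <= w -> 0 <= h ->
  (forall s t, x <= s <= x + w -> y <= t <= y + h -> closed_form_at P Q s t) ->
  circulation P Q x y w h = 0.
Proof.
  intros hw hh H.
  pose (c := fix c (n : nat) : R * R :=
     match n with
     | 0%nat => (x, y)
     | S m => goursat_step P Q (w / 2 ^ S m) (h / 2 ^ S m) (c m)
     end).
  assert (h2 : forall n, 0 < 2 ^ n) by (intros; apply pow_lt; lra).
  assert (hwn : forall n, 0 <= w / 2 ^ n)
    by (intros; apply Rmult_le_pos; [lra|left; apply Rinv_0_lt_compat; apply h2]).
  assert (hhn : forall n, 0 <= h / 2 ^ n)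
    by (intros; apply Rmult_le_pos; [lra|left; apply Rinv_0_lt_compat; apply h2]).
  assert (dw : forall n, 2 * (w / 2 ^ S n) = w / 2 ^ n)
    by (intros; simpl; field; apply Rgt_not_eq, h2).
  assert (dh : forall n, 2 * (h / 2 ^ S n) = h / 2 ^ n)
    by (intros; simpl; field; apply Rgt_not_eq, h2).
  assert (hin : forall n, x <= fst (c n) /\ fst (c n) + w / 2 ^ n <= x + w /\
                          y <= snd (c n) /\ snd (c n) + h / 2 ^ n <= y + h).
  { induction n as [|n IH].
    - simpl. unfold Rdiv. rewrite Rinv_1. lra.
    - destruct (goursat_step_corner P Q (w / 2 ^ S n) (h / 2 ^ S n) (c n)
                  (hwn _) (hhn _)) as [k1 k2].
      change (c (S n)) with (goursat_step P Q (w / 2 ^ S n) (h / 2 ^ S n) (c n)).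
      specialize (dw n). specialize (dh n). lra. }
  assert (hcont : forall n s t, fst (c n) <= s <= fst (c n) + w / 2 ^ n ->
             snd (c n) <= t <= snd (c n) + h / 2 ^ n ->
             continuity_2d_pt P s t /\ continuity_2d_pt Q s t).
  { intros n s t hs ht. apply closed_form_at_continuity.
    destruct (hin n) as (i1 & i2 & i3 & i4). apply H; lra. }
  assert (hbig : forall n, Rabs (circulation P Q x y w h) <=
      4 ^ n * Rabs (circulation P Q (fst (c n)) (snd (c n)) (w / 2 ^ n) (h / 2 ^ n))).
  { induction n as [|n IH].
    - simpl. unfold Rdiv. rewrite Rinv_1, 2!Rmult_1_r, Rmult_1_l. lra.
    - eapply Rle_trans; [exact IH|].
      replace (4 ^ S n) with (4 ^ n * 4) by (simpl; ring).
      rewrite Rmult_assoc. apply Rmult_le_compat_l; [apply pow_le; lra|].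
      rewrite <- dw, <- dh. apply goursat_step_large; auto.
      rewrite dw, dh. apply hcont. }
  destruct (nested_intervals_point (fun n => fst (c n)) (fun n => fst (c n) + w / 2 ^ n))
    as [x0 hx0].
  { intros n. apply (goursat_step_corner P Q (w / 2 ^ S n) (h / 2 ^ S n) (c n)); auto. }
  { intros n. destruct (goursat_step_corner P Q (w / 2 ^ S n) (h / 2 ^ S n) (c n)
                  (hwn _) (hhn _)) as [k1 k2].
    change (c (S n)) with (goursat_step P Q (w / 2 ^ S n) (h / 2 ^ S n) (c n)).
    specialize (dw n). lra. }
  { intros n. specialize (hwn n). lra. }
  destruct (nested_intervals_point (fun n => snd (c n)) (fun n => snd (c n) + h / 2 ^ n))
    as [y0 hy0].
  { intros n. apply (goursat_step_corner P Q (w / 2 ^ S n) (h / 2 ^ S n) (c n)); auto. }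
  { intros n. destruct (goursat_step_corner P Q (w / 2 ^ S n) (h / 2 ^ S n) (c n)
                  (hwn _) (hhn _)) as [k1 k2].
    change (c (S n)) with (goursat_step P Q (w / 2 ^ S n) (h / 2 ^ S n) (c n)).
    specialize (dh n). lra. }
  { intros n. specialize (hhn n). lra. }
  destruct (H x0 y0) as (px & k & qy & hP & hQ).
  { specialize (hx0 0%nat). simpl in hx0. unfold Rdiv in hx0. rewrite Rinv_1 in hx0. lra. }
  { specialize (hy0 0%nat). simpl in hy0. unfold Rdiv in hy0. rewrite Rinv_1 in hy0. lra. }
  assert (hle : forall eps : posreal,
             Rabs (circulation P Q x y w h) <= 2 * (w + h) ^ 2 * eps).
  { intros eps. destruct (circulation_small P Q x0 y0 px k qy eps hP hQ) as [d hd].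
    destruct (Pow_x_infinity 2) with (b := (w + h) / d + 1) as [n hn].
    { rewrite Rabs_pos_eq; lra. }
    specialize (hn n (Nat.le_refl n)). rewrite Rabs_pos_eq in hn by (left; apply h2).
    eapply Rle_trans; [apply (hbig n)|].
    eapply Rle_trans.
    - apply Rmult_le_compat_l; [apply pow_le; lra|]. apply hd; auto.
      + replace (w / 2 ^ n + h / 2 ^ n) with ((w + h) / 2 ^ n)
          by (field; apply Rgt_not_eq, h2).
        apply Rlt_div_l; [apply h2|].
        assert (hdp := cond_pos d).
        assert (hs : (w + h) / d < 2 ^ n) by lra.
        apply Rlt_div_l in hs; lra.
      + apply hcont.
    - right. replace 4 with (2 * 2) by ring. rewrite Rpow_mult_distr.
      field. apply Rgt_not_eq, h2. }
  apply NNPP. intros hne.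
  assert (hpos : 0 < Rabs (circulation P Q x y w h)) by now apply Rabs_pos_lt.
  assert (hS : 0 < 2 * (w + h) ^ 2 + 1) by (assert (hsq := pow2_ge_0 (w + h)); lra).
  assert (he : 0 < Rabs (circulation P Q x y w h) / (2 * (w + h) ^ 2 + 1))
    by (apply Rdiv_lt_0_compat; lra).
  specialize (hle (mkposreal _ he)). simpl in hle.
  set (J := Rabs (circulation P Q x y w h)) in *.
  assert (J * (2 * (w + h) ^ 2 + 1) <= 2 * (w + h) ^ 2 * J); [|nra].
  apply Rmult_le_compat_r with (r := 2 * (w + h) ^ 2 + 1) in hle; [|lra].
  eapply Rle_trans; [exact hle|]. right. simpl. field. simpl in hS. lra.
Qed.

(** * Complex differentiability and the maximum principle *)

Definition near (z : C) : (C -> Prop) -> Prop :=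
  locally (T := AbsRing_UniformSpace C_AbsRing) z.

#[export] Instance near_filter (z : C) : ProperFilter (near z).
Proof. apply (locally_filter (T := AbsRing_UniformSpace C_AbsRing)). Qed.

Lemma nearP (z : C) (P : C -> Prop) :
  near z P <-> exists d, 0 < d /\ forall w, Cmod (w - z) < d -> P w.
Proof.
  split.
  - intros [d hd]. exists d. split; [apply cond_pos|]. intros w hw. now apply hd.
  - intros (d & hd & H). exists (mkposreal d hd). intros w hw. now apply H.
Qed.

Definition ccont (f : C -> C) (z : C) : Prop := clim (near z) f (f z).

Lemma ccontP (f : C -> C) (z : C) :
  ccont f z <-> forall eps, 0 < eps ->
    exists d, 0 < d /\ forall w, Cmod (w - z) < d -> Cmod (f w - f z) < eps.
Proof.
  split; intros H eps he; specialize (H eps he); now apply nearP.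
Qed.

Lemma ccont_const (c z : C) : ccont (fun _ => c) z.
Proof. apply (clim_const (near z)). Qed.

Lemma ccont_id (z : C) : ccont (fun w => w) z.
Proof. apply ccontP. intros eps he. exists eps. auto. Qed.

Lemma ccont_plus (f g : C -> C) (z : C) :
  ccont f z -> ccont g z -> ccont (fun w => f w + g w)%C z.
Proof. apply (clim_plus (near z)). Qed.

Lemma ccont_minus (f g : C -> C) (z : C) :
  ccont f z -> ccont g z -> ccont (fun w => f w - g w)%C z.
Proof. apply (clim_minus (near z)). Qed.

Lemma ccont_mult (f g : C -> C) (z : C) :
  ccont f z -> ccont g z -> ccont (fun w => f w * g w)%C z.
Proof. apply (clim_mult (near z)). Qed.

Lemma ccont_div (f g : C -> C) (z : C) :
  g z <> 0 -> ccont f z -> ccont g z -> ccont (fun w => f w / g w)%C z.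
Proof. apply (clim_div (near z)). Qed.

Lemma ccont_conj (f : C -> C) (z : C) : ccont f z -> ccont (fun w => Cconj (f w)) z.
Proof. apply (clim_conj (near z)). Qed.

Lemma ccont_ext_loc (f g : C -> C) (z : C) :
  near z (fun w => f w = g w) -> ccont f z -> ccont g z.
Proof.
  intros he hf eps h0. generalize (filter_and _ _ he (hf eps h0)).
  assert (hz : f z = g z) by exact (locally_singleton _ _ he).
  apply filter_imp. intros w [h1 h2]. now rewrite <- hz, <- h1.
Qed.

Lemma ccont_near_lt (f : C -> C) (z : C) (M : R) :
  ccont f z -> Cmod (f z) < M -> near z (fun w => Cmod (f w) < M).
Proof.
  intros hf hM. generalize (hf (M - Cmod (f z)) ltac:(lra)).
  apply filter_imp. intros w hw.
  assert (h := Cmod_triangle_inv (f w) (f z)). apply Rabs_le_between in h. lra.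
Qed.

Lemma ccont_near_neq (f : C -> C) (z c : C) :
  ccont f z -> f z <> c -> near z (fun w => f w <> c).
Proof.
  intros hf hc.
  assert (hp : 0 < Cmod (f z - c)) by now apply Cmod_gt_0, Cminus_eq_contra.
  generalize (hf _ hp). apply filter_imp. intros w hw e. rewrite e in hw.
  replace (c - f z)%C with (- (f z - c))%C in hw by ring.
  rewrite Cmod_opp in hw. lra.
Qed.

(** Caratheodory's form: [phi] is the difference quotient completed by the derivative
    at [z].  It provides the quotient of a function by a zero as a function. *)
Definition cdiff (f : C -> C) (z : C) : Prop :=
  exists phi, ccont phi z /\ forall w, f w = (f z + phi w * (w - z))%C.

Lemma cdiff_ccont (f : C -> C) (z : C) : cdiff f z -> ccont f z.
Proof.
  intros (phi & hphi & H).
  apply (ccont_ext_loc (fun w => f z + phi w * (w - z))%C).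
  { apply filter_forall. intros w. now rewrite <- H. }
  apply ccont_plus; [apply ccont_const|].
  apply ccont_mult; [exact hphi|]. apply ccont_minus; [apply ccont_id|apply ccont_const].
Qed.

Lemma cdiff_const (c z : C) : cdiff (fun _ => c) z.
Proof. exists (fun _ => RtoC 0). split; [apply ccont_const|]. intros; ring. Qed.

Lemma cdiff_id (z : C) : cdiff (fun w => w) z.
Proof. exists (fun _ => RtoC 1). split; [apply ccont_const|]. intros; ring. Qed.

Lemma cdiff_plus (f g : C -> C) (z : C) :
  cdiff f z -> cdiff g z -> cdiff (fun w => f w + g w)%C z.
Proof.
  intros (p & hp & Hp) (q & hq & Hq). exists (fun w => p w + q w)%C.
  split; [now apply ccont_plus|]. intros w. rewrite Hp, Hq. ring.
Qed.

Lemma cdiff_mult (f g : C -> C) (z : C) :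
  cdiff f z -> cdiff g z -> cdiff (fun w => f w * g w)%C z.
Proof.
  intros hf hg. assert (cf := cdiff_ccont f z hf).
  destruct hf as (p & hp & Hp). destruct hg as (q & hq & Hq).
  exists (fun w => p w * g z + f w * q w)%C. split.
  - apply ccont_plus; apply ccont_mult; auto. apply ccont_const.
  - intros w. rewrite (Hq w). rewrite (Hp w) at 1. rewrite (Hp w). ring.
Qed.

Lemma cdiff_comp (f g : C -> C) (z : C) :
  cdiff g z -> cdiff f (g z) -> cdiff (fun w => f (g w)) z.
Proof.
  intros hg (p & hp & Hp). assert (cg := cdiff_ccont g z hg).
  destruct hg as (q & hq & Hq).
  exists (fun w => p (g w) * q w)%C. split.
  - apply ccont_mult; [|exact hq].
    apply ccontP. intros eps he. destruct (proj1 (ccontP _ _) hp eps he) as (d & hd & h1).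
    destruct (proj1 (ccontP _ _) cg d hd) as (d' & hd' & h2).
    exists d'. split; [exact hd'|]. intros w hw. apply h1, h2, hw.
  - intros w. rewrite (Hp (g w)) at 1. rewrite (Hq w) at 2. ring.
Qed.

Lemma ccont_comp (f g : C -> C) (z : C) :
  ccont g z -> ccont f (g z) -> ccont (fun w => f (g w)) z.
Proof.
  intros cg hp. apply ccontP. intros eps he.
  destruct (proj1 (ccontP _ _) hp eps he) as (d & hd & h1).
  destruct (proj1 (ccontP _ _) cg d hd) as (d' & hd' & h2).
  exists d'. split; [exact hd'|]. intros w hw. apply h1, h2, hw.
Qed.

Lemma cdiff_of_near (f phi : C -> C) (z : C) :
  ccont phi z -> near z (fun w => f w = (f z + phi w * (w - z))%C) -> cdiff f z.
Proof.
  intros hphi he.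
  exists (fun w => if Ceq_dec w z then phi z else (f w - f z) / (w - z))%C. split.
  - apply (ccont_ext_loc phi); [|exact hphi].
    generalize he. apply filter_imp. intros w hw.
    destruct (Ceq_dec w z) as [->|hne]; [reflexivity|].
    rewrite hw. field. now apply Cminus_eq_contra.
  - intros w. destruct (Ceq_dec w z) as [->|hne]; [ring|].
    field. now apply Cminus_eq_contra.
Qed.

Lemma cdiff_ext_loc (f g : C -> C) (z : C) :
  near z (fun w => f w = g w) -> cdiff f z -> cdiff g z.
Proof.
  intros he (p & hp & Hp).
  assert (hz : f z = g z) by exact (locally_singleton _ _ he).
  apply (cdiff_of_near g p); [exact hp|].
  generalize he. apply filter_imp. intros w hw. now rewrite <- hw, <- hz.
Qed.

Lemma cdiff_inv (z : C) : z <> 0 -> cdiff (fun w => / w)%C z.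
Proof.
  intros hz. apply (cdiff_of_near _ (fun w => - (1) / (z * w))%C).
  - apply ccont_div; [now apply Cmult_neq_0|apply ccont_const|].
    apply ccont_mult; [apply ccont_const|apply ccont_id].
  - generalize (ccont_near_neq (fun w => w) z 0 (ccont_id z) hz).
    apply filter_imp. intros w hw. field. now split.
Qed.

Lemma cdiff_div (f g : C -> C) (z : C) :
  g z <> 0 -> cdiff f z -> cdiff g z -> cdiff (fun w => f w / g w)%C z.
Proof.
  intros hz hf hg. apply cdiff_mult; [exact hf|].
  apply (cdiff_comp (fun w => / w)%C); [exact hg|]. now apply cdiff_inv.
Qed.

Lemma cdiff_opp (f : C -> C) (z : C) : cdiff f z -> cdiff (fun w => - f w)%C z.
Proof.
  intros (p & hp & Hp). exists (fun w => RtoC 0 - p w)%C. split.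
  - apply ccont_minus; [apply ccont_const|exact hp].
  - intros w. rewrite Hp. ring.
Qed.

Lemma cdiff_minus (f g : C -> C) (z : C) :
  cdiff f z -> cdiff g z -> cdiff (fun w => f w - g w)%C z.
Proof. intros hf hg. apply cdiff_plus; [exact hf|]. now apply cdiff_opp. Qed.

Lemma cdiff_linear_error (f : C -> C) (z : C) :
  cdiff f z -> exists l : C, forall eps, 0 < eps ->
    near z (fun w => Cmod (f w - f z - l * (w - z)) <= eps * Cmod (w - z)).
Proof.
  intros (p & hp & Hp). exists (p z). intros eps he.
  generalize (hp eps he). apply filter_imp. intros w hw.
  rewrite (Hp w). replace (f z + p w * (w - z) - f z - p z * (w - z))%C
    with ((p w - p z) * (w - z))%C by ring.
  rewrite Cmod_mult. apply Rmult_le_compat_r; [apply Cmod_ge_0|lra].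
Qed.

(** The Cauchy-Riemann equations: [fst l] and [snd l] occur in both gradients. *)
Lemma cdiff_differentiable (f : C -> C) (z : C) :
  cdiff f z -> exists l : C,
    differentiable_pt_lim (fun x y => fst (f (x, y))) (fst z) (snd z) (fst l) (- snd l) /\
    differentiable_pt_lim (fun x y => snd (f (x, y))) (fst z) (snd z) (snd l) (fst l).
Proof.
  intros hf. destruct (cdiff_linear_error f z hf) as [l hl]. exists l.
  assert (key : forall eps : posreal, locally_2d (fun x y =>
     Cmod (f (x, y) - f z - l * ((x, y) - z)) <=
     eps * Rmax (Rabs (x - fst z)) (Rabs (y - snd z))) (fst z) (snd z)).
  { intros eps. assert (he := cond_pos eps).
    destruct (proj1 (nearP _ _) (hl (eps / 2) ltac:(lra))) as (d & hd & H).
    assert (hd2 : 0 < d / 2) by lra.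
    exists (mkposreal _ hd2). simpl. intros x y hx hy.
    assert (hle : Cmod ((x, y) - z) <= Rabs (x - fst z) + Rabs (y - snd z))
      by apply (Cmod_le_Rabs ((x, y) - z)%C).
    eapply Rle_trans; [apply H; lra|].
    assert (h1 := Rmax_l (Rabs (x - fst z)) (Rabs (y - snd z))).
    assert (h2 := Rmax_r (Rabs (x - fst z)) (Rabs (y - snd z))).
    nra. }
  destruct z as [zx zy]. destruct l as [lx ly]. simpl in *.
  split; intros eps; destruct (key eps) as [d hd]; exists d; intros x y hx hy;
    (eapply Rle_trans; [|apply (hd x y hx hy)]).
  - eapply Rle_trans; [|apply Rabs_fst_le_Cmod]. right. f_equal.
    destruct (f (x, y)), (f (zx, zy)). simpl. ring.
  - eapply Rle_trans; [|apply Rabs_snd_le_Cmod]. right. f_equal.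
    destruct (f (x, y)), (f (zx, zy)). simpl. ring.
Qed.

Definition polar (z : C) (r t : R) : C := (fst z + r * cos t, snd z + r * sin t).

Lemma Cmod_polar (z : C) (r t : R) : 0 <= r -> Cmod (polar z r t - z) = r.
Proof.
  intros hr. unfold Cmod, polar. simpl.
  replace ((fst z + r * cos t + - fst z) * ((fst z + r * cos t + - fst z) * 1) +
     (snd z + r * sin t + - snd z) * ((snd z + r * sin t + - snd z) * 1))
    with (r ^ 2 * (Rsqr (sin t) + Rsqr (cos t))) by (unfold Rsqr; ring).
  rewrite sin2_cos2, Rmult_1_r. now apply sqrt_pow2.
Qed.

Lemma differentiable_pt_lim_Rmult (f g : R -> R -> R) (x y fx fy gx gy : R) :
  differentiable_pt_lim f x y fx fy -> differentiable_pt_lim g x y gx gy ->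
  differentiable_pt_lim (fun u v => f u v * g u v) x y
    (fx * g x y + f x y * gx) (fy * g x y + f x y * gy).
Proof.
  intros hf hg.
  replace (fx * g x y + f x y * gx) with (g x y * fx + f x y * gx) by ring.
  replace (fy * g x y + f x y * gy) with (g x y * fy + f x y * gy) by ring.
  apply (differentiable_pt_lim_comp Rmult); [|exact hf|exact hg].
  intros eps. exists eps. intros u v hu hv.
  set (a := f x y) in *. set (b := g x y) in *.
  replace (u * v - a * b - (b * (u - a) + a * (v - b))) with ((u - a) * (v - b)) by ring.
  rewrite Rabs_mult.
  apply Rmult_le_compat; try apply Rabs_pos; [lra|apply Rmax_r].
Qed.

Lemma differentiable_pt_lim_snd (f : R -> R) (x y l : R) :
  derivable_pt_lim f y l -> differentiable_pt_lim (fun _ v => f v) x y 0 l.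
Proof.
  intros H eps. destruct (H eps (cond_pos eps)) as [d hd]. exists d. intros u v hu hv.
  destruct (Req_dec v y) as [->|hne].
  - replace (f y - f y - (0 * (u - x) + l * (y - y))) with 0 by ring.
    rewrite Rabs_R0. apply Rmult_le_pos; [left; apply cond_pos|].
    eapply Rle_trans; [apply Rabs_pos|apply Rmax_l].
  - assert (hvy : v - y <> 0) by lra.
    specialize (hd (v - y) hvy hv). replace (y + (v - y)) with v in hd by ring.
    replace (f v - f y - (0 * (u - x) + l * (v - y)))
      with (((f v - f y) / (v - y) - l) * (v - y)) by (field; exact hvy).
    rewrite Rabs_mult. apply Rmult_le_compat; try apply Rabs_pos; [lra|apply Rmax_r].
Qed.

Lemma differentiable_pt_lim_polar (c : R) (e : R -> R) (r t l : R) :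
  derivable_pt_lim e t l ->
  differentiable_pt_lim (fun r t => c + r * e t) r t (e t) (r * l).
Proof.
  intros he.
  assert (h1 : differentiable_pt_lim (fun u _ => u) r t 1 0)
    by apply (differentiable_pt_lim_proj1_0 (fun u => u)), derivable_pt_lim_id.
  assert (h2 := differentiable_pt_lim_Rmult _ _ _ _ _ _ _ _ h1
                  (differentiable_pt_lim_snd e r t l he)).
  replace (e t) with (1 * e t + r * 0) by ring.
  replace (r * l) with (0 * e t + r * l) by ring.
  intros eps. destruct (h2 eps) as [d hd]. exists d. intros u v hu hv.
  replace (c + u * e v - (c + r * e t)) with (u * e v - r * e t) by ring.
  now apply hd.
Qed.

(** In polar coordinates around [z] the real part of the closed form
    [f dw / (i (w - z))] is [u dt + (v / r) dr] with [f = u + i v]. *)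
Lemma polar_closed_form (f : C -> C) (z : C) (r t : R) :
  0 < r -> cdiff f (polar z r t) ->
  closed_form_at (fun r t => / r * snd (f (polar z r t)))
                 (fun r t => fst (f (polar z r t))) r t.
Proof.
  intros hr hf. destruct (cdiff_differentiable f _ hf) as (l & hu & hv).
  assert (hX := differentiable_pt_lim_polar (fst z) cos r t _ (derivable_pt_lim_cos t)).
  assert (hY := differentiable_pt_lim_polar (snd z) sin r t _ (derivable_pt_lim_sin t)).
  assert (hu' := differentiable_pt_lim_comp _ _ _ _ _ _ _ _ _ _ _ hu hX hY).
  assert (hv' := differentiable_pt_lim_comp _ _ _ _ _ _ _ _ _ _ _ hv hX hY).
  assert (hi : differentiable_pt_lim (fun u _ => / u) r t (- / (r ^ 2)) 0).
  { apply (differentiable_pt_lim_proj1_0 Rinv). apply is_derive_Reals.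
    evar_last; [apply is_derive_inv; [apply is_derive_id|lra]|].
    unfold one. simpl. field. lra. }
  assert (hP := differentiable_pt_lim_Rmult _ _ _ _ _ _ _ _ hi hv').
  exists (- / r ^ 2 * snd (f (polar z r t)) + / r * (snd l * cos t + fst l * sin t)),
    (fst l * cos t + - snd l * sin t),
    (fst l * (r * - sin t) + - snd l * (r * cos t)).
  split; [|exact hu'].
  replace (fst l * cos t + - snd l * sin t) with
    (0 * snd (f (polar z r t)) + / r * (snd l * (r * - sin t) + fst l * (r * cos t)))
    by (field; lra).
  exact hP.
Qed.

(** The mean value property: by Goursat, applied to an annulus cut along a radius, the
    integral of [Re h] over a circle around [z0] does not depend on the radius, and
    small radii give the value at [z0] by continuity. *)
Lemma circle_mean_not_below (h : C -> C) (z0 : C) (r d : R) :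
  0 < r -> 0 < d -> ccont h z0 ->
  (forall z, z <> z0 -> Cmod (z - z0) <= r -> cdiff h z) ->
  (forall z, Cmod (z - z0) = r -> fst (h z) <= fst (h z0) - d) -> False.
Proof.
  intros hr hd hc hdiff hcirc.
  destruct (proj1 (ccontP _ _) hc (d / 2) ltac:(lra)) as (e & he & hclose).
  pose (r0 := Rmin r (e / 2)).
  assert (hr0 : 0 < r0) by (apply Rmin_pos; lra).
  assert (hr0r : r0 <= r) by apply Rmin_l.
  assert (hr0e : r0 < e) by (assert (hm := Rmin_r r (e / 2)); unfold r0; lra).
  assert (hpi := PI_RGT_0).
  assert (hform : forall s t, r0 <= s <= r -> closed_form_at
            (fun r t => / r * snd (h (polar z0 r t))) (fun r t => fst (h (polar z0 r t))) s t).
  { intros s t hs. apply polar_closed_form; [lra|].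
    assert (hm := Cmod_polar z0 s t ltac:(lra)).
    apply hdiff; [|lra]. intros e0. rewrite e0 in hm.
    replace (z0 - z0)%C with (RtoC 0) in hm by ring. rewrite Cmod_0 in hm. lra. }
  assert (hG := goursat _ _ r0 0 (r - r0) (2 * PI) ltac:(lra) ltac:(lra)
                  ltac:(intros s t hs _; apply hform; lra)).
  unfold circulation in hG.
  replace (r0 + (r - r0)) with r in hG by ring. rewrite Rplus_0_l in hG.
  rewrite (RInt_ext (V := R_CompleteNormedModule) _ (fun _ => 0)) in hG.
  2:{ intros t _. unfold polar. rewrite cos_2PI, sin_2PI, cos_0, sin_0. apply Rminus_eq_0. }
  rewrite (RInt_const (V := R_CompleteNormedModule)) in hG.
  unfold scal in hG. simpl in hG. unfold mult in hG. simpl in hG.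
  assert (hlt : RInt (fun t => fst (h (polar z0 r t)) - fst (h (polar z0 r0 t))) 0 (2 * PI)
                <= RInt (fun _ => - (d / 2)) 0 (2 * PI)).
  { apply RInt_le; [lra| |apply ex_RInt_const|].
    - apply (ex_RInt_Rminus_continuous); [lra| |]; intros t _;
        apply (continuity_2d_continuous_snd (fun r t => fst (h (polar z0 r t))));
        refine (proj2 (closed_form_at_continuity _ _ _ _ (hform _ _ _))); lra.
    - intros t _.
      assert (h1 := hcirc (polar z0 r t) (Cmod_polar z0 r t ltac:(lra))).
      assert (h2 := hclose (polar z0 r0 t)).
      rewrite Cmod_polar in h2 by lra. specialize (h2 hr0e).
      assert (h3 := Rabs_fst_le_Cmod (h (polar z0 r0 t) - h z0)%C).
      change (fst (h (polar z0 r0 t) - h z0)%C) with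
        (fst (h (polar z0 r0 t)) + - fst (h z0)) in h3.
      apply Rabs_le_between in h3. lra. }
  rewrite (RInt_const (V := R_CompleteNormedModule)) in hlt.
  unfold scal in hlt. simpl in hlt. unfold mult in hlt. simpl in hlt.
  nra.
Qed.

(** The superlevel sets of [g] on the closed disc form a filter, whose cluster points
    are maxima. *)
Lemma disc_max_attained (g : C -> R) (rho : R) :
  0 <= rho ->
  (forall z, Cmod z <= rho -> filterlim g (near z) (locally (g z))) ->
  exists zm, Cmod zm <= rho /\ forall z, Cmod z <= rho -> g z <= g zm.
Proof.
  intros hrho hg.
  pose (F := fun P : C -> Prop => exists z1, Cmod z1 <= rho /\
               forall z, Cmod z <= rho -> g z1 <= g z -> P z).
  assert (hF : ProperFilter F).
  { constructor.
    - intros P (z1 & h1 & h2). exists z1. apply h2; lra.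
    - constructor.
      + exists 0. rewrite Cmod_0. auto.
      + intros P Q (z1 & h1 & h2) (z2 & h3 & h4).
        destruct (Rle_dec (g z1) (g z2)).
        * exists z2. split; [exact h3|]. intros z hz hle. split; [apply h2|apply h4]; lra.
        * exists z1. split; [exact h1|]. intros z hz hle. split; [apply h2|apply h4]; lra.
      + intros P Q hPQ (z1 & h1 & h2). exists z1. split; [exact h1|]. auto. }
  assert (hin : F (fun z => Cmod z <= rho)).
  { exists 0. rewrite Cmod_0. auto. }
  destruct (bounded_ccluster F (fun z => z) rho hin) as (G & zm & hG & hFG & hlim).
  assert (hzm : Cmod zm <= rho).
  { rewrite <- (Rabs_pos_eq rho), <- Cmod_R by exact hrho.
    apply (clim_Cmod_le G (fun z => z) (fun _ => RtoC rho));
      [exact hlim|apply clim_const; exact _|].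
    apply hFG. rewrite Cmod_R, Rabs_pos_eq by exact hrho. exact hin. }
  exists zm. split; [exact hzm|]. intros z1 h1.
  apply (filterlim_le (F := G) (fun _ => g z1) g (Finite (g z1)) (Finite (g zm))).
  - apply hFG. exists z1. auto.
  - apply filterlim_const.
  - intros P hP. specialize (hg zm hzm P hP). unfold filtermap in *.
    destruct (proj1 (nearP _ _) hg) as (d & hd & H).
    generalize (hlim d hd). apply filter_imp. exact H.
Qed.

Lemma near_avoids_list (E : list C) (z : C) :
  near z (fun w => w <> z -> ~ In w E).
Proof.
  induction E as [|a E IH].
  - apply filter_forall. auto.
  - destruct (Ceq_dec z a) as [<-|hne].
    + generalize IH. apply filter_imp. intros w hw hwz [hin|hin]; [now subst|].
      now apply hw.
    + generalize (filter_and _ _ IH (ccont_near_neq (fun w => w) z a (ccont_id z) hne)).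
      apply filter_imp. intros w [h1 h2] hwz [hin|hin]; [now subst|]. now apply h1.
Qed.

Lemma Cmod_sqr (z : C) : Cmod z ^ 2 = fst z ^ 2 + snd z ^ 2.
Proof. rewrite Cmod2_alt. reflexivity. Qed.

(** A maximum of the strictly subharmonic function [|f|^2 + eps |z|^2] cannot be
    interior; [2 Re (conj (f z0) f)] is a harmonic minorant of [|f|^2 + |f z0|^2]
    that is exact at [z0]. *)
Lemma perturbed_max_not_interior (f : C -> C) (E : list C) (rho eps : R) (z0 : C) :
  0 < eps -> Cmod z0 < rho ->
  (forall z, Cmod z <= rho -> ccont f z) ->
  (forall z, Cmod z < rho -> ~ In z E -> cdiff f z) ->
  (forall z, Cmod z <= rho ->
     Cmod (f z) ^ 2 + eps * Cmod z ^ 2 <= Cmod (f z0) ^ 2 + eps * Cmod z0 ^ 2) ->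
  False.
Proof.
  intros heps hz0 hc hd hmax.
  destruct (proj1 (nearP _ _) (near_avoids_list E z0)) as (d & hdp & hav).
  pose (r := Rmin (d / 2) ((rho - Cmod z0) / 2)).
  assert (hr : 0 < r) by (apply Rmin_pos; lra).
  assert (hr1 : r < d) by (assert (h := Rmin_l (d / 2) ((rho - Cmod z0) / 2)); unfold r; lra).
  assert (hr2 : r < rho - Cmod z0)
    by (assert (h := Rmin_r (d / 2) ((rho - Cmod z0) / 2)); unfold r; lra).
  assert (hin : forall z, Cmod (z - z0) <= r -> Cmod z < rho).
  { intros z hz. assert (h := Cmod_triangle (z - z0) z0).
    replace (z - z0 + z0)%C with z in h by ring. lra. }
  pose (h := fun z => (2 * Cconj (f z0) * f z + 2 * eps * Cconj z0 * (z - z0))%C).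
  apply (circle_mean_not_below h z0 r (eps * r ^ 2)).
  - exact hr.
  - apply Rmult_lt_0_compat; [exact heps|]. now apply pow_lt.
  - unfold h. apply ccont_plus.
    + apply ccont_mult; [apply ccont_const|]. apply hc. lra.
    + apply ccont_mult; [apply ccont_const|].
      apply ccont_minus; [apply ccont_id|apply ccont_const].
  - intros z hne hz. unfold h. apply cdiff_plus.
    + apply cdiff_mult; [apply cdiff_const|]. apply hd; [now apply hin|].
      apply hav; [lra|exact hne].
    + apply cdiff_mult; [apply cdiff_const|].
      apply cdiff_minus; [apply cdiff_id|apply cdiff_const].
  - intros z hz. assert (hm := hmax z ltac:(left; apply hin; lra)).
    assert (hz2 : Cmod (z - z0) ^ 2 = r ^ 2) by now rewrite hz.
    rewrite Cmod_sqr in hz2. rewrite 4!Cmod_sqr in hm.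
    unfold h. destruct (f z) as [u v], (f z0) as [u0 v0], z as [x y], z0 as [x0 y0].
    simpl in *.
    assert (hsq : 0 <= (u - u0) ^ 2 + (v - v0) ^ 2)
      by (apply Rplus_le_le_0_compat; apply pow2_ge_0).
    assert (he : eps * (r * (r * 1)) =
      eps * ((x + - x0) * ((x + - x0) * 1) + (y + - y0) * ((y + - y0) * 1)))
      by (now rewrite hz2).
    rewrite he. simpl in *. lra.
Qed.

(** The perturbation [eps |z|^2] forces the maximum onto the circle and disappears as
    [eps] tends to 0. *)
Theorem maximum_principle (f : C -> C) (E : list C) (rho M : R) :
  0 <= rho ->
  (forall z, Cmod z <= rho -> ccont f z) ->
  (forall z, Cmod z < rho -> ~ In z E -> cdiff f z) ->
  (forall z, Cmod z = rho -> Cmod (f z) <= M) ->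
  forall z, Cmod z <= rho -> Cmod (f z) <= M.
Proof.
  intros hrho hc hd hM.
  assert (hM0 : 0 <= M).
  { eapply Rle_trans; [apply Cmod_ge_0|]. apply (hM (RtoC rho)).
    rewrite Cmod_R. now apply Rabs_pos_eq. }
  assert (key : forall eps, 0 < eps -> forall z, Cmod z <= rho ->
            Cmod (f z) ^ 2 <= M ^ 2 + eps * rho ^ 2).
  { intros eps he.
    destruct (disc_max_attained (fun z => Cmod (f z) ^ 2 + eps * Cmod z ^ 2) rho hrho)
      as (zm & hzm & hmax).
    { intros z hz.
      assert (lf := clim_Cmod (near z) f (f z) (hc z hz)).
      assert (lz := clim_Cmod (near z) (fun w => w) z (ccont_id z)).
      assert (sq : forall u : C -> R, forall l, filterlim u (near z) (locally l) ->
                filterlim (fun w => u w ^ 2) (near z) (locally (l ^ 2))).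
      { intros u l hu.
        apply (filterlim_comp _ _ _ u (fun x => x ^ 2) (near z) (locally l)); [exact hu|].
        apply (ex_derive_continuous (fun x => x ^ 2) l). auto_derive. exact I. }
      apply (filterlim_comp_2 (F := near z) (G := locally (Cmod (f z) ^ 2))
        (H := locally (eps * Cmod z ^ 2)) (fun z => Cmod (f z) ^ 2)
        (fun z => eps * Cmod z ^ 2) Rplus); [exact (sq _ _ lf)| |].
      - apply (filterlim_comp _ _ _ (fun w => Cmod w ^ 2) (fun x => eps * x) (near z)
                 (locally (Cmod z ^ 2))); [exact (sq _ _ lz)|].
        apply (ex_derive_continuous (fun x => eps * x) (Cmod z ^ 2)). auto_derive. exact I.
      - apply (filterlim_plus (V := R_NormedModule)). }
    intros z hz. specialize (hmax z hz) as hz'.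
    destruct hzm as [hlt|heq].
    - exfalso. exact (perturbed_max_not_interior f E rho eps zm he hlt hc hd hmax).
    - rewrite heq in hz'. specialize (hM zm heq).
      assert (Cmod (f zm) ^ 2 <= M ^ 2) by (apply pow_incr; split; [apply Cmod_ge_0|exact hM]).
      assert (0 <= eps * Cmod z ^ 2)
        by (apply Rmult_le_pos; [lra|apply pow2_ge_0]).
      lra. }
  intros z hz. apply Rnot_lt_le. intros hlt.
  assert (hsq : M ^ 2 < Cmod (f z) ^ 2) by nra.
  assert (hR : 0 < rho ^ 2 + 1) by (assert (h := pow2_ge_0 rho); lra).
  assert (he : 0 < (Cmod (f z) ^ 2 - M ^ 2) / (rho ^ 2 + 1)) by (apply Rdiv_lt_0_compat; lra).
  specialize (key _ he z hz).
  set (D := Cmod (f z) ^ 2 - M ^ 2) in *.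
  assert (hk : D <= D / (rho ^ 2 + 1) * rho ^ 2) by (unfold D in *; lra).
  assert (e : D / (rho ^ 2 + 1) * rho ^ 2 = D - D / (rho ^ 2 + 1)) by (field; lra).
  lra.
Qed.

(** * Blaschke factors and the Schwarz-Pick lemma *)

Definition blaschke (p z : C) : C := ((p - z) / (1 - Cconj p * z))%C.

Lemma blaschke_den_neq_0 (p z : C) :
  Cmod p * Cmod z < 1 -> (1 - Cconj p * z)%C <> 0.
Proof.
  intros h e. assert (e1 : (Cconj p * z)%C = 1).
  { replace (Cconj p * z)%C with (1 - (1 - Cconj p * z))%C by ring. rewrite e. ring. }
  assert (e2 : Cmod p * Cmod z = 1).
  { rewrite <- (Cmod_conj p), <- Cmod_mult, e1. apply Cmod_1. }
  lra.
Qed.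

Lemma Cmod_mult_lt_1 (p z : C) : Cmod p <= 1 -> Cmod z < 1 -> Cmod p * Cmod z < 1.
Proof. assert (h1 := Cmod_ge_0 p). assert (h2 := Cmod_ge_0 z). nra. Qed.

(** The identity behind all estimates of Blaschke factors. *)
Lemma blaschke_identity (p z : C) :
  Cmod (1 - Cconj p * z) ^ 2 = Cmod (p - z) ^ 2 + (1 - Cmod p ^ 2) * (1 - Cmod z ^ 2).
Proof. rewrite 4!Cmod_sqr. destruct p, z. simpl. ring. Qed.

Lemma blaschke_mult_den (p z : C) :
  Cmod p * Cmod z < 1 -> (blaschke p z * (1 - Cconj p * z))%C = (p - z)%C.
Proof. intros h. unfold blaschke. field. now apply blaschke_den_neq_0. Qed.

Lemma blaschke_Cmod_mult (p z : C) :
  Cmod p * Cmod z < 1 -> Cmod (blaschke p z) * Cmod (1 - Cconj p * z) = Cmod (p - z).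
Proof. intros h. now rewrite <- Cmod_mult, blaschke_mult_den. Qed.

Lemma blaschke_one_minus_sqr (p z : C) :
  Cmod p * Cmod z < 1 ->
  (1 - Cmod (blaschke p z) ^ 2) * Cmod (1 - Cconj p * z) ^ 2 =
  (1 - Cmod p ^ 2) * (1 - Cmod z ^ 2).
Proof.
  intros h. rewrite Rmult_minus_distr_r, <- Rpow_mult_distr, blaschke_Cmod_mult by exact h.
  rewrite blaschke_identity. ring.
Qed.

Lemma blaschke_den_pos (p z : C) :
  Cmod p * Cmod z < 1 -> 0 < Cmod (1 - Cconj p * z).
Proof. intros h. now apply Cmod_gt_0, blaschke_den_neq_0. Qed.

Lemma blaschke_le_1 (p z : C) :
  Cmod p * Cmod z < 1 -> Cmod p <= 1 -> Cmod z <= 1 -> Cmod (blaschke p z) <= 1.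
Proof.
  intros h hp hz. assert (e := blaschke_one_minus_sqr p z h).
  assert (hd := blaschke_den_pos p z h).
  assert (h1 := Cmod_ge_0 p). assert (h2 := Cmod_ge_0 z).
  assert (h3 := Cmod_ge_0 (blaschke p z)).
  apply Rnot_lt_le. intros hlt.
  assert (0 <= (1 - Cmod p ^ 2) * (1 - Cmod z ^ 2)) by (apply Rmult_le_pos; nra).
  assert (0 < Cmod (1 - Cconj p * z) ^ 2) by now apply pow_lt.
  assert (1 - Cmod (blaschke p z) ^ 2 < 0) by nra. nra.
Qed.

Lemma blaschke_lt_1 (p z : C) :
  Cmod p < 1 -> Cmod z < 1 -> Cmod (blaschke p z) < 1.
Proof.
  intros hp hz. assert (h := Cmod_mult_lt_1 p z ltac:(lra) hz).
  assert (e := blaschke_one_minus_sqr p z h).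
  assert (hd := blaschke_den_pos p z h).
  assert (h1 := Cmod_ge_0 p). assert (h2 := Cmod_ge_0 z).
  assert (h3 := Cmod_ge_0 (blaschke p z)).
  apply Rnot_le_lt. intros hlt.
  assert (0 < (1 - Cmod p ^ 2) * (1 - Cmod z ^ 2)) by (apply Rmult_lt_0_compat; nra).
  assert (0 < Cmod (1 - Cconj p * z) ^ 2) by now apply pow_lt.
  assert (1 - Cmod (blaschke p z) ^ 2 <= 0) by nra. nra.
Qed.

Lemma blaschke_0_r (p : C) : blaschke p 0 = p.
Proof.
  unfold blaschke. replace (1 - Cconj p * 0)%C with (RtoC 1) by ring.
  field. Qed.

Lemma blaschke_0_l (z : C) : blaschke 0 z = (- z)%C.
Proof.
  unfold blaschke. replace (Cconj 0) with (RtoC 0) by (unfold Cconj, RtoC; simpl; f_equal; ring).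
  replace (1 - 0 * z)%C with (RtoC 1) by ring. field.
Qed.

Lemma blaschke_self (p : C) : blaschke p p = 0.
Proof. unfold blaschke. replace (p - p)%C with (RtoC 0) by ring. unfold Cdiv. ring. Qed.

Lemma blaschke_eq_0 (p z : C) : Cmod p * Cmod z < 1 -> blaschke p z = 0 -> p = z.
Proof.
  intros h e. assert (e1 := blaschke_mult_den p z h). rewrite e in e1.
  apply Ceq_minus. rewrite <- e1. ring.
Qed.

(** A zero on the circle makes the factor constant; with the zero 1 the factor is
    neutral, so that a missing zero can be treated as one that has moved to 1. *)
Lemma blaschke_boundary (p z : C) : Cmod p = 1 -> Cmod z < 1 -> blaschke p z = p.
Proof.
  intros hp hz.
  assert (e : (p * Cconj p)%C = 1).
  { rewrite <- Cmod2_conj, hp, pow1. reflexivity. }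
  assert (hd := blaschke_den_neq_0 p z ltac:(rewrite hp; lra)).
  assert (e1 : (p - z)%C = (p * (1 - Cconj p * z))%C).
  { transitivity (p - (p * Cconj p) * z)%C; [rewrite e|]; ring. }
  unfold blaschke. rewrite e1. field. exact hd.
Qed.

Lemma blaschke_involutive (p z : C) :
  Cmod p < 1 -> Cmod z <= 1 -> blaschke p (blaschke p z) = z.
Proof.
  intros hp hz.
  assert (h := Cmod_mult_lt_1 z p hz hp). rewrite Rmult_comm in h.
  assert (h1 := blaschke_den_neq_0 p z h).
  assert (h2 := blaschke_den_neq_0 p p (Cmod_mult_lt_1 p p (Rlt_le _ _ hp) hp)).
  assert (h3 : (1 - Cconj p * blaschke p z)%C <> 0).
  { replace (1 - Cconj p * blaschke p z)%C
      with ((1 - Cconj p * p) / (1 - Cconj p * z))%C by (unfold blaschke; field; exact h1).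
    intros e. apply h2. replace (1 - Cconj p * p)%C with
      ((1 - Cconj p * p) / (1 - Cconj p * z) * (1 - Cconj p * z))%C by (field; exact h1).
    rewrite e. ring. }
  unfold blaschke at 1.
  replace (p - blaschke p z)%C with (z * (1 - Cconj p * blaschke p z))%C.
  - field. exact h3.
  - unfold blaschke. field. exact h1.
Qed.

Lemma blaschke_cdiff (p z : C) : Cmod p * Cmod z < 1 -> cdiff (blaschke p) z.
Proof.
  intros h. unfold blaschke. apply cdiff_div.
  - now apply blaschke_den_neq_0.
  - apply cdiff_minus; [apply cdiff_const|apply cdiff_id].
  - apply cdiff_minus; [apply cdiff_const|].
    apply cdiff_mult; [apply cdiff_const|apply cdiff_id].
Qed.

(** The list [E] collects points at which only continuity is known; dividing by a
    Blaschke factor produces such a point at its zero. *)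
Definition disc_selfmap (E : list C) (f : C -> C) : Prop :=
  forall z, Cmod z < 1 -> ccont f z /\ Cmod (f z) <= 1 /\ (~ In z E -> cdiff f z).

Lemma disc_selfmap_incl (E E' : list C) (f : C -> C) :
  incl E E' -> disc_selfmap E f -> disc_selfmap E' f.
Proof.
  intros hE hf z hz. destruct (hf z hz) as (h1 & h2 & h3).
  split; [exact h1|]. split; [exact h2|]. auto.
Qed.

Lemma blaschke_lower_bound (p z : C) :
  Cmod p < Cmod z -> Cmod z < 1 ->
  (Cmod z - Cmod p) * Cmod (1 - Cconj p * z) <= (1 - Cmod z * Cmod p) * Cmod (p - z).
Proof.
  intros h1 h2. assert (hp := Cmod_ge_0 p).
  assert (hpz : Cmod z - Cmod p <= Cmod (p - z)).
  { assert (h := Cmod_triangle_inv p z). apply Rabs_le_between in h. lra. }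
  apply Rsqr_incr_0_var.
  2:{ apply Rmult_le_pos; [nra|apply Cmod_ge_0]. }
  rewrite 2!Rsqr_mult. rewrite 4!Rsqr_pow2, blaschke_identity.
  assert (hs : (Cmod z - Cmod p) ^ 2 <= Cmod (p - z) ^ 2) by (apply pow_incr; lra).
  assert (hc : 0 <= (1 - Cmod p ^ 2) * (1 - Cmod z ^ 2)) by (apply Rmult_le_pos; nra).
  assert (e : (1 - Cmod z * Cmod p) ^ 2 =
     (Cmod z - Cmod p) ^ 2 + (1 - Cmod p ^ 2) * (1 - Cmod z ^ 2)) by ring.
  rewrite e. nra.
Qed.

(** The quotient is bounded by 1 because the Blaschke factor has modulus close to 1 on
    large circles. *)
Theorem disc_selfmap_factor (E : list C) (f : C -> C) (p : C) :
  disc_selfmap E f -> Cmod p < 1 -> ~ In p E -> f p = 0 ->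
  exists G, disc_selfmap (p :: E) G /\ forall z, Cmod z < 1 -> f z = (blaschke p z * G z)%C.
Proof.
  intros hf hp hpE hfp.
  destruct (hf p hp) as (_ & _ & hd). destruct (hd hpE) as (phi & cphi & hphi).
  rewrite hfp in hphi. clear hd.
  pose (G := fun w => (phi w * (Cconj p * w - 1))%C).
  assert (hfG : forall z, Cmod z < 1 -> f z = (blaschke p z * G z)%C).
  { intros z hz. rewrite hphi. unfold G, blaschke. field.
    apply blaschke_den_neq_0. apply Cmod_mult_lt_1; lra. }
  assert (hphi' : forall z, z <> p -> near z (fun w => (f w / (w - p))%C = phi w)).
  { intros z hz. generalize (ccont_near_neq (fun w => w) z p (ccont_id z) hz).
    apply filter_imp. intros w hw. rewrite hphi. field. now apply Cminus_eq_contra. }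
  assert (cpol : forall z, cdiff (fun w => Cconj p * w - 1)%C z).
  { intros z. apply cdiff_minus; [|apply cdiff_const].
    apply cdiff_mult; [apply cdiff_const|apply cdiff_id]. }
  assert (dlin : forall z, cdiff (fun w => w - p)%C z).
  { intros z. apply cdiff_minus; [apply cdiff_id|apply cdiff_const]. }
  assert (cG : forall z, Cmod z < 1 -> ccont G z).
  { intros z hz. unfold G. apply ccont_mult; [|apply cdiff_ccont, cpol].
    destruct (Ceq_dec z p) as [->|hne]; [exact cphi|].
    apply (ccont_ext_loc _ _ _ (hphi' z hne)). apply ccont_div.
    - now apply Cminus_eq_contra.
    - now apply hf.
    - apply cdiff_ccont, dlin. }
  assert (dG : forall z, Cmod z < 1 -> ~ In z (p :: E) -> cdiff G z).
  { intros z hz hin. assert (hne : z <> p) by (intros ->; apply hin; now left).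
    unfold G. apply cdiff_mult; [|apply cpol].
    apply (cdiff_ext_loc _ _ _ (hphi' z hne)). apply cdiff_div.
    - now apply Cminus_eq_contra.
    - apply hf; [exact hz|]. intros h. apply hin. now right.
    - apply dlin. }
  exists G. split; [|exact hfG].
  intros z hz. split; [now apply cG|]. split; [|now apply dG].
  apply Rnot_lt_le. intros hlt.
  (* On a circle of radius [rho] the factor is at least (rho-|p|)/(1-rho|p|), which
     tends to 1; the radius is chosen to contradict [1 < |G z|]. *)
  assert (hbd : forall rho, Cmod z <= rho -> Cmod p < rho -> rho < 1 ->
             Cmod (G z) <= (1 - rho * Cmod p) / (rho - Cmod p)).
  { intros rho h1 h2 h3.
    apply (maximum_principle G (p :: E) rho).
    - assert (h := Cmod_ge_0 z). lra.
    - intros w hw. apply cG. lra.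
    - intros w hw. apply dG. lra.
    - intros w hw. assert (hw1 : Cmod w < 1) by lra.
      assert (hpw := Cmod_mult_lt_1 p w (Rlt_le _ _ hp) hw1).
      assert (hlb := blaschke_lower_bound p w ltac:(lra) hw1). rewrite hw in hlb.
      assert (hden := blaschke_den_pos p w hpw).
      assert (hmul := blaschke_Cmod_mult p w hpw).
      destruct (hf w hw1) as (_ & hle & _). rewrite hfG, Cmod_mult in hle by exact hw1.
      apply Rle_div_r; [lra|].
      assert (hbpos : rho - Cmod p <= (1 - rho * Cmod p) * Cmod (blaschke p w)).
      { apply Rmult_le_reg_r with (Cmod (1 - Cconj p * w)); [exact hden|].
        rewrite Rmult_assoc, hmul. exact hlb. }
      assert (hg := Cmod_ge_0 (G w)).
      assert (h4 : 0 < 1 - rho * Cmod p) by (assert (h := Cmod_ge_0 p); nra).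
      apply Rle_trans with (Cmod (G w) * ((1 - rho * Cmod p) * Cmod (blaschke p w))); [|nra].
      apply Rmult_le_compat_l; assumption.
    - exact h1. }
  set (g := Cmod (G z)) in *. set (q := Cmod p) in *.
  assert (hq : 0 <= q) by apply Cmod_ge_0.
  assert (hzz := Cmod_ge_0 z).
  pose (r0 := Rmax (Cmod z) (Rmax q ((1 + g * q) / (g + q)))).
  assert (hr0 : r0 < 1).
  { unfold r0. apply Rmax_lub_lt; [exact hz|]. apply Rmax_lub_lt; [exact hp|].
    apply Rlt_div_l; [lra|]. nra. }
  assert (hr1 : Cmod z <= r0) by apply Rmax_l.
  assert (hr2 : q <= r0) by (eapply Rle_trans; [apply Rmax_l|apply Rmax_r]).
  assert (hr3 : (1 + g * q) / (g + q) <= r0)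
    by (eapply Rle_trans; [|apply Rmax_r]; apply Rmax_r).
  specialize (hbd ((r0 + 1) / 2) ltac:(lra) ltac:(lra) ltac:(lra)).
  set (rho := (r0 + 1) / 2) in *.
  assert (hrho : (1 + g * q) / (g + q) < rho) by (unfold rho; lra).
  assert (hq' : q < rho) by (unfold rho; lra).
  clearbody rho.
  apply Rlt_div_l in hrho; [|lra].
  apply Rle_div_r in hbd; [|lra]. nra.
Qed.

Lemma disc_selfmap_bound_zero (E : list C) (f : C -> C) (p z : C) :
  disc_selfmap E f -> Cmod p < 1 -> ~ In p E -> f p = 0 -> Cmod z < 1 ->
  Cmod (f z) <= Cmod (blaschke p z).
Proof.
  intros hf hp hpE hfp hz.
  destruct (disc_selfmap_factor E f p hf hp hpE hfp) as (G & hG & e).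
  rewrite e, Cmod_mult by exact hz. destruct (hG z hz) as (_ & h & _).
  assert (h0 := Cmod_ge_0 (blaschke p z)). nra.
Qed.

Lemma disc_selfmap_blaschke (E : list C) (f : C -> C) (c : C) :
  Cmod c < 1 -> disc_selfmap E f -> disc_selfmap E (fun z => blaschke c (f z)).
Proof.
  intros hc hf z hz. destruct (hf z hz) as (h1 & h2 & h3).
  assert (hlt : Cmod c * Cmod (f z) < 1)
    by (rewrite Rmult_comm; now apply Cmod_mult_lt_1).
  split; [|split].
  - apply (ccont_comp (blaschke c)); [exact h1|]. now apply cdiff_ccont, blaschke_cdiff.
  - apply blaschke_le_1; [exact hlt|lra|exact h2].
  - intros hin. apply (cdiff_comp (blaschke c)); [now apply h3|]. now apply blaschke_cdiff.
Qed.

Lemma disc_selfmap_scale (E : list C) (f : C -> C) (t : C) :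
  Cmod t <= 1 -> disc_selfmap E f -> disc_selfmap E (fun z => t * f z)%C.
Proof.
  intros ht hf z hz. destruct (hf z hz) as (h1 & h2 & h3). split; [|split].
  - apply ccont_mult; [apply ccont_const|exact h1].
  - rewrite Cmod_mult. assert (h := Cmod_ge_0 t). assert (h' := Cmod_ge_0 (f z)). nra.
  - intros hin. apply cdiff_mult; [apply cdiff_const|now apply h3].
Qed.

(** The Schwarz-Pick inequality, arranged to show that [G] is nearly constant when
    [|G w|] is close to 1.  It is proved for [t G] with [t < 1], where the value at [w]
    lies in the open disc and can be moved to 0 by a Blaschke factor. *)
Theorem schwarz_pick (E : list C) (G : C -> C) (w z : C) :
  disc_selfmap E G -> Cmod w < 1 -> ~ In w E -> Cmod z < 1 ->
  Cmod (G z - G w) ^ 2 * (1 - Cmod (blaschke w z) ^ 2) <= 1 - Cmod (G w) ^ 2.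
Proof.
  intros hG hw hwE hz.
  set (A := Cmod (G z - G w) ^ 2 * (1 - Cmod (blaschke w z) ^ 2)).
  assert (hb := blaschke_lt_1 w z hw hz). assert (hb0 := Cmod_ge_0 (blaschke w z)).
  destruct (hG w hw) as (_ & hGw & _). destruct (hG z hz) as (_ & hGz & _).
  assert (hGw0 := Cmod_ge_0 (G w)). assert (hGz0 := Cmod_ge_0 (G z)).
  assert (hA : forall t, 0 < t < 1 -> t ^ 2 * (A + Cmod (G w) ^ 2) <= 1).
  { intros t ht.
    assert (hmt : Cmod t = t) by (rewrite Cmod_R; apply Rabs_pos_eq; lra).
    pose (c := (t * G w)%C).
    assert (hc : Cmod c = t * Cmod (G w)) by (unfold c; now rewrite Cmod_mult, hmt).
    assert (hc1 : Cmod c < 1) by nra.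
    assert (hK := disc_selfmap_blaschke E _ c hc1
                    (disc_selfmap_scale E G t ltac:(lra) hG)).
    assert (h := disc_selfmap_bound_zero E _ w z hK hw hwE (blaschke_self c) hz).
    simpl in h.
    assert (hv : Cmod (t * G z) = t * Cmod (G z)) by now rewrite Cmod_mult, hmt.
    assert (hv1 : Cmod (t * G z) <= 1) by nra.
    assert (hcv : Cmod c * Cmod (t * G z) < 1) by (rewrite Rmult_comm; now apply Cmod_mult_lt_1).
    assert (hden := blaschke_den_pos c (t * G z) hcv).
    assert (hmul := blaschke_Cmod_mult c (t * G z) hcv).
    assert (hid := blaschke_identity c (t * G z)).
    assert (hX : Cmod (c - t * G z) ^ 2 <=
        Cmod (blaschke w z) ^ 2 * Cmod (1 - Cconj c * (t * G z)) ^ 2).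
    { rewrite <- Rpow_mult_distr. apply pow_incr. split; [apply Cmod_ge_0|].
      rewrite <- hmul. apply Rmult_le_compat_r; lra. }
    rewrite hid in hX.
    assert (hce : Cmod (c - t * G z) ^ 2 = t ^ 2 * Cmod (G z - G w) ^ 2).
    { replace (c - t * G z)%C with (- (t * (G z - G w)))%C by (unfold c; ring).
      rewrite Cmod_opp, Cmod_mult, hmt. apply Rpow_mult_distr. }
    rewrite hce, hv, hc in hX. unfold A.
    set (X := Cmod (G z - G w) ^ 2) in *. set (b := Cmod (blaschke w z)) in *.
    set (gw := Cmod (G w)) in *. set (gz := Cmod (G z)) in *.
    rewrite hc in hc1. rewrite hv in hv1.
    assert (hP : 0 <= t * gw) by (apply Rmult_le_pos; lra).
    assert (hQ : 0 <= t * gz) by (apply Rmult_le_pos; lra).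
    assert (hP2 : 0 <= 1 - (t * gw) ^ 2 <= 1) by nra.
    assert (hQ2 : 0 <= 1 - (t * gz) ^ 2 <= 1) by nra.
    assert (hb2 : 0 <= b ^ 2 <= 1) by nra.
    assert (hbQ : b ^ 2 * (1 - (t * gz) ^ 2) <= 1) by nra.
    assert (hfin : (1 - (t * gw) ^ 2) * (b ^ 2 * (1 - (t * gz) ^ 2)) <= 1 - (t * gw) ^ 2)
      by nra.
    replace (t ^ 2 * (X * (1 - b ^ 2) + gw ^ 2))
      with (t ^ 2 * X - b ^ 2 * (t ^ 2 * X) + (t * gw) ^ 2) by ring.
    lra. }
  apply Rnot_lt_le. intros hlt.
  set (S := A + Cmod (G w) ^ 2) in *. assert (hS : 1 < S) by (unfold S; lra).
  (* t = 1/2 + 1/(2 S) gives t^2 S > 1 *)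
  assert (hi : 0 < / S < 1).
  { split; [apply Rinv_0_lt_compat; lra|]. rewrite <- Rinv_1. apply Rinv_lt_contravar; lra. }
  specialize (hA (/ 2 + / S / 2) ltac:(lra)).
  assert (hSi : S * / S = 1) by (apply Rinv_r; lra).
  set (i := / S) in *.
  replace ((/ 2 + i / 2) ^ 2 * S) with ((S + 2 * (S * i) + (S * i) * i) / 4) in hA by field.
  rewrite hSi in hA.
  assert (hpos : 0 < (S - 1) * (1 - i)) by (apply Rmult_lt_0_compat; lra).
  replace ((S - 1) * (1 - i)) with (S - 1 - S * i + i) in hpos by ring. lra.
Qed.

(** * Two preimages of one point *)

Definition disc_map (f : C -> C) : Prop :=
  forall z, Cmod z < 1 -> cdiff f z /\ Cmod (f z) < 1.

(** The boundary point 1 stands for a missing preimage: its Blaschke factor is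
    constantly 1 on the disc. *)
Definition preimage_or_1 (f : C -> C) (a p : C) : Prop :=
  (Cmod p < 1 /\ f p = a) \/ p = 1.

Lemma disc_map_selfmap (f : C -> C) : disc_map f -> disc_selfmap nil f.
Proof.
  intros hf z hz. destruct (hf z hz) as [h1 h2].
  split; [now apply cdiff_ccont|]. split; [lra|auto].
Qed.

Lemma factor_step (E : list C) (m : C -> C) (p : C) :
  disc_selfmap E m -> (Cmod p < 1 /\ ~ In p E /\ m p = 0) \/ p = 1 ->
  exists G, disc_selfmap (p :: E) G /\
    forall z, Cmod z < 1 -> m z = (blaschke p z * G z)%C.
Proof.
  intros hm [(h1 & h2 & h3)| ->].
  - now apply disc_selfmap_factor.
  - exists m. split.
    + apply (disc_selfmap_incl E); [|exact hm]. intros x hx. now right.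
    + intros z hz. rewrite blaschke_boundary; [ring| |exact hz].
      apply Cmod_1.
Qed.

Lemma two_preimages_factor (f : C -> C) (a p q : C) :
  disc_map f -> Cmod a < 1 -> preimage_or_1 f a p -> preimage_or_1 f a q ->
  p <> q \/ p = 1 ->
  exists G, disc_selfmap (q :: p :: nil) G /\
    forall z, Cmod z < 1 -> blaschke a (f z) = (blaschke p z * blaschke q z * G z)%C.
Proof.
  intros hf ha hp hq hpq.
  assert (hm := disc_selfmap_blaschke nil f a ha (disc_map_selfmap f hf)).
  destruct (factor_step nil (fun z => blaschke a (f z)) p hm) as (G1 & hG1 & e1).
  { destruct hp as [[h1 h2]|h]; [left|now right].
    split; [exact h1|]. split; [auto|]. rewrite h2. apply blaschke_self. }
  destruct (factor_step (p :: nil) G1 q hG1) as (G2 & hG2 & e2).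
  { destruct hq as [[h1 h2]|h]; [left|now right].
    assert (hne : p <> q).
    { destruct hpq as [h|h]; [exact h|]. intros e. rewrite <- e, h in h1.
      rewrite Cmod_1 in h1. lra. }
    split; [exact h1|]. split; [intros [h|[]]; now apply hne|].
    assert (e := e1 q h1). rewrite h2, blaschke_self in e.
    assert (hb : blaschke p q <> 0).
    { intros hb. apply hne. apply blaschke_eq_0; [|exact hb].
      apply Cmod_mult_lt_1; [|exact h1].
      destruct hp as [[h _]| ->]; [lra|]. rewrite Cmod_1. lra. }
    destruct (Ceq_dec (G1 q) 0) as [h|h]; [exact h|].
    exfalso. apply (Cmult_neq_0 _ _ hb h). now symmetry. }
  exists G2. split; [exact hG2|]. intros z hz. rewrite e1, e2 by exact hz. ring.
Qed.

Lemma preimage_or_1_le_1 (f : C -> C) (a p : C) : preimage_or_1 f a p -> Cmod p <= 1.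
Proof. intros [[h _]| ->]; [lra|]. rewrite Cmod_1. lra. Qed.

Lemma preimage_or_1_neq_0 (f : C -> C) (a p : C) :
  f 0 = 0 -> a <> 0 -> preimage_or_1 f a p -> p <> 0.
Proof.
  intros h0 ha [[_ h]| ->] e.
  - apply ha. now rewrite <- h, e.
  - now apply C1_nz.
Qed.

(** With [b_a o f = b_p b_q G], evaluation at 0 gives [a = p q G(0)], whence the first
    claim.  The second is the Schwarz-Pick inequality for [G] between 0 and [z]: when
    [|p q|] is close to [|a|], [b_a o f] is close to the multiple [a b_p b_q / (p q)] of
    a Blaschke product. *)
Lemma two_preimages_bound (f : C -> C) (a p q : C) :
  disc_map f -> f 0 = 0 -> a <> 0 -> Cmod a < 1 ->
  preimage_or_1 f a p -> preimage_or_1 f a q -> p <> q \/ p = 1 ->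
  Cmod a <= Cmod (p * q) /\
  forall z, Cmod z < 1 ->
    Cmod (blaschke a (f z) * (p * q) - a * (blaschke p z * blaschke q z)) ^ 2 *
      (1 - Cmod z ^ 2) <= Cmod (p * q) ^ 2 - Cmod a ^ 2.
Proof.
  intros hf h0 ha0 ha hp hq hpq.
  destruct (two_preimages_factor f a p q hf ha hp hq hpq) as (G & hG & e).
  assert (h01 : Cmod 0 < 1) by (rewrite Cmod_0; lra).
  assert (e0 := e 0 h01). rewrite h0, 3!blaschke_0_r in e0.
  destruct (hG 0 h01) as (_ & hG0 & _).
  assert (hpq0 := Cmod_ge_0 (p * q)). assert (hGp := Cmod_ge_0 (G 0)).
  split.
  { rewrite e0, Cmod_mult. nra. }
  intros z hz.
  assert (hsp := schwarz_pick _ G 0 z hG h01).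
  assert (hin : ~ In (RtoC 0) (q :: p :: nil)).
  { intros [h|[h|[]]]; [revert hq|revert hp]; intros h';
      apply (preimage_or_1_neq_0 f a _ h0 ha0 h'); exact h. }
  specialize (hsp hin hz). rewrite blaschke_0_l, Cmod_opp in hsp.
  rewrite e by exact hz. rewrite e0 at 1.
  replace (blaschke p z * blaschke q z * G z * (p * q) -
     p * q * G 0 * (blaschke p z * blaschke q z))%C with
    ((p * q) * (blaschke p z * blaschke q z) * (G z - G 0))%C by ring.
  rewrite e0, (Cmod_mult _ (G z - G 0)), (Cmod_mult (p * q) (blaschke p z * blaschke q z)),
    (Cmod_mult (p * q) (G 0)).
  set (B := Cmod (blaschke p z * blaschke q z)).
  assert (hB : 0 <= B <= 1).
  { split; [apply Cmod_ge_0|]. unfold B. rewrite Cmod_mult.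
    assert (hbp : Cmod (blaschke p z) <= 1).
    { assert (hp1 := preimage_or_1_le_1 f a p hp).
      apply blaschke_le_1; [now apply Cmod_mult_lt_1|exact hp1|lra]. }
    assert (hbq : Cmod (blaschke q z) <= 1).
    { assert (hq1 := preimage_or_1_le_1 f a q hq).
      apply blaschke_le_1; [now apply Cmod_mult_lt_1|exact hq1|lra]. }
    assert (g1 := Cmod_ge_0 (blaschke p z)). assert (g2 := Cmod_ge_0 (blaschke q z)). nra. }
  set (k := Cmod (p * q)) in *. set (g := Cmod (G z - G 0)) in *.
  assert (hzz : 0 <= 1 - Cmod z ^ 2) by (assert (h := Cmod_ge_0 z); nra).
  assert (hg : 0 <= g) by apply Cmod_ge_0.
  assert (hB2 : 0 <= B ^ 2 <= 1) by nra.
  assert (hg2 : 0 <= g ^ 2 * (1 - Cmod z ^ 2)) by (apply Rmult_le_pos; [apply pow2_ge_0|exact hzz]).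
  assert (hk2 := pow2_ge_0 k).
  replace ((k * B * g) ^ 2 * (1 - Cmod z ^ 2))
    with (k ^ 2 * (B ^ 2 * (g ^ 2 * (1 - Cmod z ^ 2)))) by ring.
  replace (k ^ 2 - (k * Cmod (G 0)) ^ 2) with (k ^ 2 * (1 - Cmod (G 0) ^ 2)) by ring.
  apply Rmult_le_compat_l; [exact hk2|]. nra.
Qed.

(** The estimate of [two_preimages_bound] at a point [z] with value [a'], with
    denominators cleared: this form is closed under limits in which [p], [q] or [z]
    reach the unit circle. *)
Definition polynomial_bound (a a' p q z : C) : Prop :=
  Cmod (blaschke a a' * (p * q) * ((1 - Cconj p * z) * (1 - Cconj q * z))
        - a * ((p - z) * (q - z))) ^ 2 * (1 - Cmod z ^ 2) <=
  (Cmod (p * q) ^ 2 - Cmod a ^ 2) * Cmod ((1 - Cconj p * z) * (1 - Cconj q * z)) ^ 2.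

Lemma two_preimages_polynomial_bound (f : C -> C) (a a' p q z : C) :
  disc_map f -> f 0 = 0 -> a <> 0 -> Cmod a < 1 ->
  preimage_or_1 f a p -> preimage_or_1 f a q -> p <> q \/ p = 1 ->
  preimage_or_1 f a' z -> polynomial_bound a a' p q z.
Proof.
  intros hf h0 ha0 ha hp hq hpq hz.
  destruct (two_preimages_bound f a p q hf h0 ha0 ha hp hq hpq) as [hle hb].
  unfold polynomial_bound. destruct hz as [[hz hfz]| ->].
  - specialize (hb z hz). rewrite hfz in hb.
    assert (hpz := Cmod_mult_lt_1 p z (preimage_or_1_le_1 f a p hp) hz).
    assert (hqz := Cmod_mult_lt_1 q z (preimage_or_1_le_1 f a q hq) hz).
    rewrite <- (blaschke_mult_den p z hpz), <- (blaschke_mult_den q z hqz).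
    replace (blaschke a a' * (p * q) * ((1 - Cconj p * z) * (1 - Cconj q * z)) -
      a * (blaschke p z * (1 - Cconj p * z) * (blaschke q z * (1 - Cconj q * z))))%C with
      ((blaschke a a' * (p * q) - a * (blaschke p z * blaschke q z)) *
        ((1 - Cconj p * z) * (1 - Cconj q * z)))%C by ring.
    rewrite (Cmod_mult _ ((1 - Cconj p * z) * (1 - Cconj q * z))), Rpow_mult_distr.
    set (N := Cmod ((1 - Cconj p * z) * (1 - Cconj q * z)) ^ 2).
    assert (hN : 0 <= N) by apply pow2_ge_0. nra.
  - rewrite Cmod_1, pow1, Rminus_eq_0, Rmult_0_r.
    assert (h := Cmod_ge_0 a).
    apply Rmult_le_pos; [nra|apply pow2_ge_0].
Qed.

(** The quotient of [f] by the identity has modulus 1 at [p], and is constant by the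
    Schwarz-Pick inequality with base point [p]. *)
Lemma schwarz_equality (f : C -> C) (p : C) :
  disc_map f -> f 0 = 0 -> Cmod p < 1 -> p <> 0 -> Cmod (f p) = Cmod p ->
  forall z, Cmod z < 1 -> f z = (f p / p * z)%C.
Proof.
  intros hf h0 hp hp0 he z hz.
  assert (h01 : Cmod 0 < 1) by (rewrite Cmod_0; lra).
  destruct (disc_selfmap_factor nil f 0 (disc_map_selfmap f hf) h01 (fun h => h) h0)
    as (G & hG & e).
  assert (ep := e p hp). assert (ez := e z hz). rewrite blaschke_0_l in ep, ez.
  assert (hGp : Cmod (G p) = 1).
  { rewrite ep, Cmod_mult, Cmod_opp in he.
    assert (hpp : 0 < Cmod p) by now apply Cmod_gt_0.
    apply Rmult_eq_reg_l with (Cmod p); lra. }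
  assert (hsp := schwarz_pick _ G p z hG hp).
  assert (hin : ~ In p (RtoC 0 :: nil)) by (intros [h|[]]; now apply hp0).
  specialize (hsp hin hz). rewrite hGp in hsp.
  assert (hb := blaschke_lt_1 p z hp hz). assert (hb0 := Cmod_ge_0 (blaschke p z)).
  assert (hGz : (G z - G p)%C = 0).
  { apply Cmod_eq_0. assert (hg := Cmod_ge_0 (G z - G p)).
    apply Rle_antisym; [|exact hg]. apply Rnot_lt_le. intros hlt.
    assert (0 < Cmod (G z - G p) ^ 2 * (1 - Cmod (blaschke p z) ^ 2)).
    { apply Rmult_lt_0_compat; [now apply pow_lt|nra]. }
    lra. }
  apply Ceq_minus in hGz. rewrite ez, ep, hGz. field. exact hp0.
Qed.

(** * Extremal configurations of four preimages *)

(** The case of equality [|p q| = |a|] of [polynomial_bound]. *)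
Definition blaschke_relation (a a' p q z : C) : Prop :=
  Cmod z < 1 ->
  (blaschke a a' * (p * q) * ((1 - Cconj p * z) * (1 - Cconj q * z)))%C =
  (a * ((p - z) * (q - z)))%C.

Definition extremal_rows (a a' p q r s : C) : Prop :=
  Cmod (p * q) = Cmod a /\ Cmod (r * s) = Cmod a' /\
  blaschke_relation a a' p q r /\ blaschke_relation a a' p q s /\
  blaschke_relation a' a r s p /\ blaschke_relation a' a r s q.

(** Rows [(p, q)], [(r, s)] are sent to [a1], [a2] by the first coordinate, columns
    [(p, r)], [(q, s)] to [b1], [b2] by the second. *)
Definition extremal_configuration (a1 a2 b1 b2 p q r s : C) : Prop :=
  (Cmod p <= 1 /\ Cmod q <= 1 /\ Cmod r <= 1 /\ Cmod s <= 1) /\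
  extremal_rows a1 a2 p q r s /\ extremal_rows b1 b2 p r q s.

Lemma blaschke_relation_sym (a a' p q z : C) :
  blaschke_relation a a' p q z -> blaschke_relation a a' q p z.
Proof.
  intros h hz. specialize (h hz).
  replace (q * p)%C with (p * q)%C by ring.
  replace ((1 - Cconj q * z) * (1 - Cconj p * z))%C with
    ((1 - Cconj p * z) * (1 - Cconj q * z))%C by ring.
  rewrite h. ring.
Qed.

Lemma extremal_rows_swap_rows (a a' p q r s : C) :
  extremal_rows a a' p q r s -> extremal_rows a' a r s p q.
Proof. unfold extremal_rows. tauto. Qed.

Lemma extremal_rows_swap_columns (a a' p q r s : C) :
  extremal_rows a a' p q r s -> extremal_rows a a' q p s r.
Proof.
  intros (h1 & h2 & h3 & h4 & h5 & h6).
  rewrite (Cmult_comm p q) in h1. rewrite (Cmult_comm r s) in h2.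
  repeat split; auto; now apply blaschke_relation_sym.
Qed.

Lemma extremal_configuration_swap_rows (a1 a2 b1 b2 p q r s : C) :
  extremal_configuration a1 a2 b1 b2 p q r s ->
  extremal_configuration a2 a1 b1 b2 r s p q.
Proof.
  intros (hb & hr & hc). split; [tauto|]. split.
  - now apply extremal_rows_swap_rows.
  - now apply extremal_rows_swap_columns.
Qed.

Lemma extremal_configuration_swap_columns (a1 a2 b1 b2 p q r s : C) :
  extremal_configuration a1 a2 b1 b2 p q r s ->
  extremal_configuration a1 a2 b2 b1 q p s r.
Proof.
  intros (hb & hr & hc). split; [tauto|]. split.
  - now apply extremal_rows_swap_columns.
  - now apply extremal_rows_swap_rows.
Qed.

Lemma blaschke_relation_quotient (a a' p q z : C) :
  blaschke_relation a a' p q z -> Cmod p <= 1 -> Cmod q <= 1 -> Cmod z < 1 ->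
  (blaschke a a' * (p * q))%C = (a * (blaschke p z * blaschke q z))%C.
Proof.
  intros h hp hq hz. specialize (h hz).
  assert (hpz := Cmod_mult_lt_1 p z hp hz). assert (hqz := Cmod_mult_lt_1 q z hq hz).
  rewrite <- (blaschke_mult_den p z hpz), <- (blaschke_mult_den q z hqz) in h.
  assert (d1 := blaschke_den_neq_0 p z hpz). assert (d2 := blaschke_den_neq_0 q z hqz).
  replace (blaschke a a' * (p * q))%C with
    (blaschke a a' * (p * q) * ((1 - Cconj p * z) * (1 - Cconj q * z)) /
     ((1 - Cconj p * z) * (1 - Cconj q * z)))%C by (field; split; assumption).
  rewrite h. field. split; assumption.
Qed.

Lemma blaschke_neq_0 (a a' : C) :
  Cmod a < 1 -> Cmod a' < 1 -> a <> a' -> blaschke a a' <> 0.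
Proof.
  intros ha ha' hne e. apply hne. apply blaschke_eq_0; [|exact e].
  apply Cmod_mult_lt_1; lra.
Qed.

Lemma blaschke_relation_distinct (a a' p q z : C) :
  blaschke_relation a a' p q z -> Cmod p <= 1 -> Cmod q <= 1 -> Cmod z < 1 ->
  Cmod a < 1 -> Cmod a' < 1 -> a <> a' -> p <> 0 -> q <> 0 -> p <> z /\ q <> z.
Proof.
  intros h hp hq hz ha ha' hne hp0 hq0. specialize (h hz).
  assert (hl : (blaschke a a' * (p * q) *
                 ((1 - Cconj p * z) * (1 - Cconj q * z)))%C <> 0).
  { apply Cmult_neq_0; apply Cmult_neq_0.
    - now apply blaschke_neq_0.
    - now apply Cmult_neq_0.
    - now apply blaschke_den_neq_0, Cmod_mult_lt_1.
    - now apply blaschke_den_neq_0, Cmod_mult_lt_1. }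
  split; intros e; apply hl; rewrite h, e; ring.
Qed.

Lemma Cmod_eq_1_conj (u : C) : Cmod u = 1 -> (u * Cconj u)%C = 1.
Proof. intros h. rewrite <- Cmod2_conj, h, pow1. reflexivity. Qed.

Lemma blaschke_rotation (u q z : C) :
  Cmod u = 1 -> blaschke (u * q) (u * z) = (u * blaschke q z)%C.
Proof.
  intros hu. assert (e := Cmod_eq_1_conj u hu). unfold blaschke.
  rewrite Cmult_conj.
  replace (Cconj u * Cconj q * (u * z))%C with ((u * Cconj u) * (Cconj q * z))%C by ring.
  rewrite e, Cmult_1_l. unfold Cdiv. ring.
Qed.

Lemma blaschke_injective (p z w : C) :
  Cmod p < 1 -> Cmod z <= 1 -> Cmod w <= 1 -> blaschke p z = blaschke p w -> z = w.
Proof.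
  intros hp hz hw e.
  now rewrite <- (blaschke_involutive p z hp hz), e, blaschke_involutive.
Qed.

(** When [p] is on the circle the Blaschke product of degree two degenerates to a
    single factor, hence the limit map to a rotation. *)
Lemma boundary_row_rotation (a a' p q z : C) :
  blaschke_relation a a' p q z -> Cmod p = 1 -> Cmod (p * q) = Cmod a ->
  Cmod a < 1 -> a <> 0 -> Cmod a' < 1 -> Cmod z < 1 ->
  exists u, Cmod u = 1 /\ a = (u * q)%C /\ a' = (u * z)%C.
Proof.
  intros h hp hpq ha ha0 ha' hz.
  rewrite Cmod_mult, hp, Rmult_1_l in hpq.
  assert (hapos : 0 < Cmod a) by now apply Cmod_gt_0.
  assert (hq0 : q <> 0) by (apply Cmod_gt_0; lra).
  assert (hp0 : p <> 0) by (apply Cmod_gt_0; lra).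
  assert (e := blaschke_relation_quotient a a' p q z h ltac:(lra) ltac:(lra) hz).
  rewrite (blaschke_boundary p z hp hz) in e.
  exists (a / q)%C.
  assert (hu : Cmod (a / q) = 1) by (rewrite Cmod_div by exact hq0; rewrite hpq; field; lra).
  assert (hau : a = (a / q * q)%C) by (field; exact hq0).
  split; [exact hu|]. split; [exact hau|].
  apply (blaschke_injective a); [exact ha|lra| |].
  - rewrite Cmod_mult, hu. lra.
  - transitivity (a / q * blaschke q z)%C;
      [|rewrite <- blaschke_rotation by exact hu; now rewrite <- hau].
    replace (blaschke a a') with ((blaschke a a' * (p * q)) / (p * q))%C
      by (field; split; assumption).
    rewrite e. field. split; assumption.
Qed.

Definition rotation_aligned (a1 a2 b1 b2 z w : C) : Prop :=
  exists u v, Cmod u = 1 /\ Cmod v = 1 /\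
    a1 = (u * z)%C /\ b1 = (v * z)%C /\ a2 = (u * w)%C /\ b2 = (v * w)%C.

Lemma Cmod_mult_neq_0 (p q a : C) :
  Cmod (p * q) = Cmod a -> a <> 0 -> p <> 0 /\ q <> 0.
Proof.
  intros h ha. assert (hpos : 0 < Cmod a) by now apply Cmod_gt_0.
  split; intros ->; rewrite ?Cmult_0_l, ?Cmult_0_r, Cmod_0 in h; lra.
Qed.

(** With [p] on the circle the points [r] and [s] would be sent to the same value by the
    Blaschke factor of [q] if [s] were in the disc, but the columns keep them apart. *)
Lemma extremal_configuration_boundary (a1 a2 b1 b2 p q r s : C) :
  Cmod a1 < 1 -> Cmod a2 < 1 -> Cmod b1 < 1 -> Cmod b2 < 1 ->
  a1 <> 0 -> b1 <> 0 -> b1 <> b2 ->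
  extremal_configuration a1 a2 b1 b2 p q r s -> Cmod p = 1 ->
  Cmod s = 1 /\ Cmod q < 1 /\ Cmod r < 1 /\ rotation_aligned a1 a2 b2 b1 q r.
Proof.
  intros ha1 ha2 hb1 hb2 na1 nb1 hb (hbd & hr & hc) hp.
  destruct hr as (e1 & e2 & r1 & r2 & r3 & r4).
  destruct hc as (f1 & f2 & c1 & c2 & c3 & c4).
  destruct (Cmod_mult_neq_0 p q a1 e1 na1) as [np nq].
  destruct (Cmod_mult_neq_0 p r b1 f1 nb1) as [_ nr].
  assert (hq : Cmod q < 1) by (rewrite Cmod_mult in e1; rewrite hp in e1; lra).
  assert (hr : Cmod r < 1) by (rewrite Cmod_mult in f1; rewrite hp in f1; lra).
  assert (hs : Cmod s = 1).
  { destruct (Rle_lt_or_eq_dec (Cmod s) 1) as [hs|hs]; [tauto| |exact hs]. exfalso.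
    assert (g1 := blaschke_relation_quotient _ _ _ _ _ r1 ltac:(lra) ltac:(lra) hr).
    assert (g2 := blaschke_relation_quotient _ _ _ _ _ r2 ltac:(lra) ltac:(lra) hs).
    rewrite g1 in g2. rewrite 2!(blaschke_boundary p) in g2 by assumption.
    destruct (blaschke_relation_distinct _ _ _ _ _ c2 ltac:(lra) ltac:(lra) hs hb1 hb2 hb np nr)
      as [_ hrs].
    apply hrs. apply (blaschke_injective q); [exact hq|lra|lra|].
    replace (blaschke q r) with (a1 * (p * blaschke q r) / (a1 * p))%C
      by (field; split; assumption).
    rewrite g2. field. split; assumption. }
  split; [exact hs|]. split; [exact hq|]. split; [exact hr|].
  destruct (boundary_row_rotation _ _ _ _ _ r1 hp e1 ha1 na1 ha2 hr) as (u & hu & hu1 & hu2).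
  destruct (boundary_row_rotation _ _ _ _ _ c1 hp f1 hb1 nb1 hb2 hq) as (v & hv & hv1 & hv2).
  exists u, v. repeat split; assumption.
Qed.

(** If two pairs [{p, q}], [{r, s}] are fibres of one Blaschke product of degree two
    then each is swapped by the same involution z |-> (alpha - z)/(1 - conj alpha z),
    whose graph is the relation p + q = alpha + conj alpha p q: the sum and the product
    of each pair are given by the coefficients of the quadratic equation of its fibre. *)
Lemma common_involution (p q r s w : C) :
  Cmod p < 1 -> Cmod q < 1 -> Cmod w < 1 -> r <> s ->
  ((p - r) * (q - r))%C = (w * ((1 - Cconj p * r) * (1 - Cconj q * r)))%C ->
  ((p - s) * (q - s))%C = (w * ((1 - Cconj p * s) * (1 - Cconj q * s)))%C ->
  exists alpha, (p + q)%C = (alpha + Cconj alpha * (p * q))%C /\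
                (r + s)%C = (alpha + Cconj alpha * (r * s))%C.
Proof.
  intros hp hq hw hrs er es.
  set (S := (p + q)%C). set (P := (p * q)%C).
  assert (hP : Cmod P < 1) by (unfold P; rewrite Cmod_mult; apply Cmod_mult_lt_1; lra).
  assert (dP : (1 - Cconj P * P)%C <> 0) by (apply blaschke_den_neq_0, Cmod_mult_lt_1; lra).
  assert (dw : (1 - Cconj P * w)%C <> 0) by (apply blaschke_den_neq_0, Cmod_mult_lt_1; lra).
  assert (eS : Cconj S = (Cconj p + Cconj q)%C) by apply Cplus_conj.
  assert (eP : Cconj P = (Cconj p * Cconj q)%C) by apply Cmult_conj.
  assert (hsum : ((r + s) * (1 - Cconj P * w))%C = (S - w * Cconj S)%C).
  { assert (hd : ((r - s) * ((r + s) * (1 - Cconj P * w) - (S - w * Cconj S)))%C = 0).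
    { transitivity (((p - r) * (q - r) - w * ((1 - Cconj p * r) * (1 - Cconj q * r))) -
        ((p - s) * (q - s) - w * ((1 - Cconj p * s) * (1 - Cconj q * s))))%C.
      - rewrite eS, eP. unfold S. ring.
      - rewrite er, es. ring. }
    apply Ceq_minus. apply NNPP. intros hn.
    apply (Cmult_neq_0 _ _ (Cminus_eq_contra _ _ hrs) hn hd). }
  assert (hprod : ((r * s) * (1 - Cconj P * w))%C = (P - w)%C).
  { transitivity (r * ((r + s) * (1 - Cconj P * w)) - r * r * (1 - Cconj P * w))%C; [ring|].
    rewrite hsum, eS, eP.
    transitivity (P - w - ((p - r) * (q - r) - w * ((1 - Cconj p * r) * (1 - Cconj q * r))))%C.
    - unfold S, P. ring.
    - rewrite er. ring. }
  pose (alpha := ((S - Cconj S * P) / (1 - Cconj P * P))%C).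
  assert (eal : Cconj alpha = ((Cconj S - S * Cconj P) / (1 - Cconj P * P))%C).
  { unfold alpha. rewrite Cdiv_conj by exact dP.
    rewrite 2!Cminus_conj, 2!Cmult_conj, 2!Cconj_conj.
    replace (Cconj 1) with (RtoC 1) by (unfold Cconj, RtoC; simpl; f_equal; ring).
    f_equal. ring. }
  exists alpha. split.
  - rewrite eal. unfold alpha. field. exact dP.
  - replace (r + s)%C with ((r + s) * (1 - Cconj P * w) / (1 - Cconj P * w))%C
      by (field; exact dw).
    replace (r * s)%C with ((r * s) * (1 - Cconj P * w) / (1 - Cconj P * w))%C
      by (field; exact dw).
    rewrite hsum, hprod, eal. unfold alpha. field. split; assumption.
Qed.

Lemma involution_center_in_disc (p q alpha : C) :
  Cmod p < 1 -> Cmod q < 1 -> (p + q)%C = (alpha + Cconj alpha * (p * q))%C ->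
  Cmod alpha < 1.
Proof.
  intros hp hq h. apply Rnot_le_lt. intros hle.
  assert (e : Cmod (alpha - q) = Cmod p * Cmod (1 - Cconj alpha * q)).
  { rewrite <- Cmod_mult. f_equal.
    transitivity (p - ((p + q) - alpha))%C; [ring|]. rewrite h. ring. }
  assert (hid := blaschke_identity alpha q).
  assert (h1 := Cmod_ge_0 (alpha - q)). assert (h2 := Cmod_ge_0 (1 - Cconj alpha * q)).
  assert (h3 := Cmod_ge_0 p). assert (h4 := Cmod_ge_0 q).
  assert (h5 : (1 - Cmod alpha ^ 2) * (1 - Cmod q ^ 2) <= 0).
  { assert (k1 : 1 - Cmod alpha ^ 2 <= 0) by nra.
    assert (k2 : 0 <= 1 - Cmod q ^ 2) by nra. nra. }
  assert (h6 : Cmod (1 - Cconj alpha * q) <= Cmod (alpha - q)).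
  { apply Rnot_lt_le. intros hlt. nra. }
  assert (h7 : Cmod (alpha - q) = 0) by nra.
  assert (h8 : (alpha - q)%C = 0) by now apply Cmod_eq_0.
  apply Ceq_minus in h8. rewrite h8 in hle. lra.
Qed.

(** Let [sigma_a] be the involution exchanging 0 and [a].  Both orders of composition of
    [sigma_alpha] and [sigma_beta] send [p] to [s], one by way of [q], the other by way
    of [r].  Equating the two expressions for [s] and clearing denominators gives a
    quadratic equation for [p], up to the factor [c + conj c]. *)
Lemma commuting_involutions_equation (p q r s alpha beta : C) :
  Cmod alpha < 1 -> Cmod beta < 1 ->
  (p + q)%C = (alpha + Cconj alpha * (p * q))%C ->
  (r + s)%C = (alpha + Cconj alpha * (r * s))%C ->
  (p + r)%C = (beta + Cconj beta * (p * r))%C ->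
  (q + s)%C = (beta + Cconj beta * (q * s))%C ->
  let u := (alpha - beta)%C in let c := (1 - alpha * Cconj beta)%C in
  (u + (c - Cconj c) * p - Cconj u * (p * p))%C = 0.
Proof.
  intros hal hbe h1 h2 h3 h4 u c.
  assert (ec : Cconj c = (1 - Cconj alpha * beta)%C).
  { unfold c. rewrite Cminus_conj, Cmult_conj, Cconj_conj.
    replace (Cconj 1) with (RtoC 1) by (unfold Cconj, RtoC; simpl; f_equal; ring).
    reflexivity. }
  assert (eu : Cconj u = (Cconj alpha - Cconj beta)%C) by apply Cminus_conj.
  assert (eq1 : (q * (1 - Cconj alpha * p))%C = (alpha - p)%C).
  { transitivity ((p + q) - p - Cconj alpha * (p * q))%C; [ring|]. rewrite h1. ring. }
  assert (er1 : (r * (1 - Cconj beta * p))%C = (beta - p)%C).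
  { transitivity ((p + r) - p - Cconj beta * (p * r))%C; [ring|]. rewrite h3. ring. }
  assert (es1 : (s * (c - Cconj u * p))%C = (- u + Cconj c * p)%C).
  { transitivity (s * ((1 - Cconj alpha * p) - Cconj beta * (q * (1 - Cconj alpha * p))))%C.
    - rewrite eq1, eu. unfold c. ring.
    - transitivity ((1 - Cconj alpha * p) * ((q + s) - q - Cconj beta * (q * s)))%C; [ring|].
      rewrite h4.
      transitivity (beta * (1 - Cconj alpha * p) - q * (1 - Cconj alpha * p))%C; [ring|].
      rewrite eq1, ec. unfold u. ring. }
  assert (es2 : (s * (Cconj c + Cconj u * p))%C = (u + c * p)%C).
  { transitivity (s * ((1 - Cconj beta * p) - Cconj alpha * (r * (1 - Cconj beta * p))))%C.
    - rewrite er1, eu, ec. ring.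
    - transitivity ((1 - Cconj beta * p) * ((r + s) - r - Cconj alpha * (r * s)))%C; [ring|].
      rewrite h2. transitivity (alpha * (1 - Cconj beta * p) - r * (1 - Cconj beta * p))%C; [ring|].
      rewrite er1. unfold u, c. ring. }
  assert (hprod : ((c + Cconj c) * (u + (c - Cconj c) * p - Cconj u * (p * p)))%C = 0).
  { transitivity ((u + c * p) * (c - Cconj u * p) -
                  (- u + Cconj c * p) * (Cconj c + Cconj u * p))%C; [ring|].
    rewrite <- es1, <- es2. ring. }
  apply NNPP. intros hn. apply (fun hc => Cmult_neq_0 _ _ hc hn hprod).
  (* c is at distance less than 1 from 1, so that its real part is positive *)
  intros hc.
  assert (hre : fst c + fst c = 0).
  { change (fst (c + Cconj c)%C = fst (RtoC 0)). now rewrite hc. }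
  assert (hlt : Cmod (alpha * Cconj beta) < 1).
  { rewrite Cmod_mult, Cmod_conj. apply Cmod_mult_lt_1; lra. }
  assert (hf := Rabs_fst_le_Cmod (alpha * Cconj beta)%C).
  assert (hcf : fst c = 1 - fst (alpha * Cconj beta)%C) by reflexivity.
  apply Rabs_le_between in hf. lra.
Qed.

(** The quadratic equation of [commuting_involutions_equation] holds at [p] and [q].
    The product of its roots is unimodular, so that it vanishes identically and the
    involutions coincide. *)
Lemma no_involution_square (p q r s alpha beta : C) :
  Cmod p < 1 -> Cmod q < 1 -> Cmod r < 1 -> Cmod s < 1 ->
  (p + q)%C = (alpha + Cconj alpha * (p * q))%C ->
  (r + s)%C = (alpha + Cconj alpha * (r * s))%C ->
  (p + r)%C = (beta + Cconj beta * (p * r))%C ->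
  (q + s)%C = (beta + Cconj beta * (q * s))%C ->
  p <> q -> q <> r -> False.
Proof.
  intros hp hq hr hs h1 h2 h3 h4 hpq hqr.
  assert (hal := involution_center_in_disc p q alpha hp hq h1).
  assert (hbe := involution_center_in_disc p r beta hp hr h3).
  assert (ep := commuting_involutions_equation p q r s alpha beta hal hbe h1 h2 h3 h4).
  assert (eq := commuting_involutions_equation q p s r alpha beta hal hbe).
  rewrite (Cplus_comm q p), (Cplus_comm s r), (Cmult_comm q p), (Cmult_comm s r) in eq.
  specialize (eq h1 h2 h4 h3).
  cbv zeta in ep, eq.
  set (u := (alpha - beta)%C) in *. set (c := (1 - alpha * Cconj beta)%C) in *.
  assert (hsum : (c - Cconj c)%C = (Cconj u * (p + q))%C).
  { apply Ceq_minus. apply NNPP. intros hn.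
    apply (Cmult_neq_0 _ _ (Cminus_eq_contra _ _ hpq) hn).
    transitivity ((u + (c - Cconj c) * p - Cconj u * (p * p)) -
                  (u + (c - Cconj c) * q - Cconj u * (q * q)))%C; [ring|].
    rewrite ep, eq. ring. }
  assert (hu : u = (- (Cconj u * (p * q)))%C).
  { rewrite hsum in ep.
    transitivity ((u + Cconj u * (p + q) * p - Cconj u * (p * p)) - Cconj u * (p * q))%C; [ring|].
    rewrite ep. ring. }
  assert (hu0 : Cmod u = 0).
  { assert (e : Cmod u = Cmod u * (Cmod p * Cmod q)).
    { rewrite hu at 1. now rewrite Cmod_opp, 2!Cmod_mult, Cmod_conj. }
    assert (hlt := Cmod_mult_lt_1 p q ltac:(lra) hq). assert (h0 := Cmod_ge_0 u). nra. }
  apply Cmod_eq_0 in hu0. apply Ceq_minus in hu0.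
  assert (dp : (1 - Cconj alpha * p)%C <> 0) by (apply blaschke_den_neq_0, Cmod_mult_lt_1; lra).
  apply hqr.
  assert (e1 : (q * (1 - Cconj alpha * p))%C = (alpha - p)%C).
  { transitivity ((p + q) - p - Cconj alpha * (p * q))%C; [ring|]. rewrite h1. ring. }
  assert (e2 : (r * (1 - Cconj alpha * p))%C = (alpha - p)%C).
  { transitivity ((p + r) - p - Cconj alpha * (p * r))%C; [ring|]. rewrite h3, hu0. ring. }
  replace q with (q * (1 - Cconj alpha * p) / (1 - Cconj alpha * p))%C by (field; exact dp).
  rewrite e1, <- e2. field. exact dp.
Qed.

Lemma rows_common_involution (a a' p q r s : C) :
  Cmod a < 1 -> Cmod a' < 1 -> a <> 0 ->
  extremal_rows a a' p q r s -> r <> s ->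
  Cmod p < 1 -> Cmod q < 1 -> Cmod r < 1 -> Cmod s < 1 ->
  exists alpha, (p + q)%C = (alpha + Cconj alpha * (p * q))%C /\
                (r + s)%C = (alpha + Cconj alpha * (r * s))%C.
Proof.
  intros ha ha' na (e1 & _ & r1 & r2 & _) hrs hp hq hr hs.
  apply (common_involution p q r s (blaschke a a' * (p * q) / a)%C); auto.
  - rewrite Cmod_div, Cmod_mult, e1 by exact na.
    assert (hpos : 0 < Cmod a) by now apply Cmod_gt_0.
    replace (Cmod (blaschke a a') * Cmod a / Cmod a) with (Cmod (blaschke a a'))
      by (field; lra).
    now apply blaschke_lt_1.
  - specialize (r1 hr). replace ((p - r) * (q - r))%C with (a * ((p - r) * (q - r)) / a)%C
      by (field; exact na). rewrite <- r1. field. exact na.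
  - specialize (r2 hs). replace ((p - s) * (q - s))%C with (a * ((p - s) * (q - s)) / a)%C
      by (field; exact na). rewrite <- r2. field. exact na.
Qed.

(** If all points are in the disc, rows and columns give two involutions, which
    [no_involution_square] excludes; a point on the circle is moved to the position of
    [p] by the symmetries of the configuration. *)
Theorem extremal_configuration_diagonal (a1 a2 b1 b2 p q r s : C) :
  Cmod a1 < 1 -> Cmod a2 < 1 -> Cmod b1 < 1 -> Cmod b2 < 1 ->
  a1 <> 0 -> a2 <> 0 -> b1 <> 0 -> b2 <> 0 -> a1 <> a2 -> b1 <> b2 ->
  extremal_configuration a1 a2 b1 b2 p q r s ->
  (Cmod q < 1 /\ Cmod r < 1 /\ rotation_aligned a1 a2 b2 b1 q r) \/
  (Cmod p < 1 /\ Cmod s < 1 /\ rotation_aligned a1 a2 b1 b2 p s).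
Proof.
  intros ha1 ha2 hb1 hb2 na1 na2 nb1 nb2 ha hb H.
  destruct H as (hbd & hr & hc).
  assert (H : extremal_configuration a1 a2 b1 b2 p q r s) by (split; auto).
  destruct (Rle_lt_or_eq_dec (Cmod p) 1) as [hp|hp]; [tauto| |].
  2:{ left. apply (extremal_configuration_boundary a1 a2 b1 b2 p q r s); auto. }
  destruct (Rle_lt_or_eq_dec (Cmod q) 1) as [hq|hq]; [tauto| |].
  2:{ right. apply extremal_configuration_swap_columns in H.
      apply (extremal_configuration_boundary a1 a2 b2 b1 q p s r); auto. }
  destruct (Rle_lt_or_eq_dec (Cmod r) 1) as [hrr|hrr]; [tauto| |].
  2:{ right. apply extremal_configuration_swap_rows in H.
      destruct (extremal_configuration_boundary a2 a1 b1 b2 r s p q)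
        as (_ & h1 & h2 & u & v & h3 & h4 & h5 & h6 & h7 & h8); auto.
      split; [exact h2|]. split; [exact h1|]. exists u, v. tauto. }
  destruct (Rle_lt_or_eq_dec (Cmod s) 1) as [hs|hs]; [tauto| |].
  2:{ left. apply extremal_configuration_swap_rows, extremal_configuration_swap_columns in H.
      destruct (extremal_configuration_boundary a2 a1 b2 b1 s r q p)
        as (_ & h1 & h2 & u & v & h3 & h4 & h5 & h6 & h7 & h8); auto.
      split; [exact h2|]. split; [exact h1|]. exists u, v. tauto. }
  exfalso.
  destruct (Cmod_mult_neq_0 p q a1 (proj1 hr) na1) as [np nq].
  destruct (Cmod_mult_neq_0 r s a2 (proj1 (proj2 hr)) na2) as [nr ns].
  assert (hr' := hr). assert (hc' := hc).
  destruct hr' as (_ & _ & r1 & r2 & r3 & r4). destruct hc' as (_ & _ & c1 & c2 & c3 & c4).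
  destruct (blaschke_relation_distinct b1 b2 p r s c2) as [dps drs]; auto; try lra.
  destruct (blaschke_relation_distinct b1 b2 p r q c1) as [dpq drq]; auto; try lra.
  destruct (blaschke_relation_distinct a1 a2 p q s r2) as [_ dqs]; auto; try lra.
  destruct (rows_common_involution a1 a2 p q r s) as (alpha & al1 & al2); auto.
  destruct (rows_common_involution b1 b2 p r q s) as (beta & be1 & be2); auto.
  apply (no_involution_square p q r s alpha beta); auto.
Qed.

(** * Prescribing two more values near the boundary *)

Lemma ccont_blaschke (f g : C -> C) (z : C) :
  (1 - Cconj (f z) * g z)%C <> 0 -> ccont f z -> ccont g z ->
  ccont (fun w => blaschke (f w) (g w)) z.
Proof.
  intros hd hf hg. unfold blaschke. apply ccont_div; [exact hd| |].
  - now apply ccont_minus.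
  - apply ccont_minus; [apply ccont_const|]. apply ccont_mult; [now apply ccont_conj|exact hg].
Qed.

Lemma blaschke_circle (p z : C) : Cmod p < 1 -> Cmod z = 1 -> Cmod (blaschke p z) = 1.
Proof.
  intros hp hz.
  assert (h : Cmod p * Cmod z < 1) by (rewrite hz; lra).
  assert (e := blaschke_one_minus_sqr p z h). rewrite hz in e.
  assert (hd := blaschke_den_pos p z h). assert (h0 := Cmod_ge_0 (blaschke p z)).
  assert (hd2 : 0 < Cmod (1 - Cconj p * z) ^ 2) by now apply pow_lt.
  assert (e1 : 1 - Cmod (blaschke p z) ^ 2 = 0).
  { apply Rmult_eq_reg_r with (Cmod (1 - Cconj p * z) ^ 2); lra. }
  nra.
Qed.

Lemma cdiff_blaschke_comp (c : C) (g : C -> C) (z : C) :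
  Cmod c < 1 -> Cmod (g z) <= 1 -> cdiff g z -> cdiff (fun w => blaschke c (g w)) z.
Proof.
  intros hc hz hg. apply (cdiff_comp (blaschke c)); [exact hg|].
  apply blaschke_cdiff. rewrite Rmult_comm. now apply Cmod_mult_lt_1.
Qed.

(** One step of Schur's algorithm: the Blaschke factor of [c] reduces the problem to the
    values 0 at [s] and [blaschke c d] at [t], which a multiple of the Blaschke factor of
    [s] takes. *)
Lemma two_point_interpolation (s t c d : C) :
  Cmod s < 1 -> Cmod t < 1 -> s <> t -> Cmod c < 1 -> Cmod d < 1 ->
  Cmod (blaschke c d) <= Cmod (blaschke s t) ->
  exists g, disc_map g /\ g s = c /\ g t = d.
Proof.
  intros hs ht hst hc hd h.
  assert (hb : blaschke s t <> 0).
  { intros e. apply hst. apply blaschke_eq_0; [|exact e]. apply Cmod_mult_lt_1; lra. }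
  pose (k := (blaschke c d / blaschke s t)%C).
  assert (hk : Cmod k <= 1).
  { unfold k. rewrite Cmod_div by exact hb. apply Rle_div_l; [now apply Cmod_gt_0|lra]. }
  assert (hin : forall z, Cmod z < 1 -> Cmod (blaschke s z * k) < 1).
  { intros z hz. rewrite Cmod_mult, Rmult_comm.
    apply Cmod_mult_lt_1; [exact hk|]. now apply blaschke_lt_1. }
  exists (fun z => blaschke c (blaschke s z * k)). split; [|split].
  - intros z hz. assert (hz' := hin z hz). split; [|now apply blaschke_lt_1].
    apply cdiff_blaschke_comp; [exact hc|lra|].
    apply cdiff_mult; [|apply cdiff_const].
    apply blaschke_cdiff. apply Cmod_mult_lt_1; lra.
  - rewrite blaschke_self, Cmult_0_l. apply blaschke_0_r.
  - replace (blaschke s t * k)%C with (blaschke c d) by (unfold k; field; exact hb).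
    apply blaschke_involutive; lra.
Qed.

(** The map [z |-> z] times a map that equals [rho] at [a1 / rho] and [a2 / rho] takes
    these points to [a1] and [a2]; the remaining freedom is a self-map of the disc
    that serves to prescribe the values at [s] and [-s].  As [s] tends to 1 the
    Blaschke factors become unimodular and the distance of [s] and [-s] tends to 1,
    so that any two values [c] and [d] in the disc can be prescribed. *)
Lemma interpolation_near_boundary (a1 a2 c d : C) (rho : R) :
  0 < rho -> rho < 1 -> Cmod a1 < rho -> Cmod a2 < rho -> Cmod c < 1 -> Cmod d < 1 ->
  near 1 (fun s => Cmod s < 1 ->
    exists f, disc_map f /\ f 0 = 0 /\ f (a1 / rho)%C = a1 /\ f (a2 / rho)%C = a2 /\
              f s = c /\ f (- s)%C = d).
Proof.
  intros hr0 hr1 ha1 ha2 hc hd.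
  assert (hrho : Cmod rho = rho) by (rewrite Cmod_R; apply Rabs_pos_eq; lra).
  assert (hrho1 : Cmod rho < 1) by lra.
  assert (nr : RtoC rho <> 0) by (apply Cmod_gt_0; lra).
  pose (l1 := (a1 / rho)%C). pose (l2 := (a2 / rho)%C).
  assert (hl1 : Cmod l1 < 1).
  { unfold l1. rewrite Cmod_div, hrho by exact nr. apply Rlt_div_l; lra. }
  assert (hl2 : Cmod l2 < 1).
  { unfold l2. rewrite Cmod_div, hrho by exact nr. apply Rlt_div_l; lra. }
  pose (B := fun z => (blaschke l1 z * blaschke l2 z)%C).
  pose (e := fun v s => (blaschke rho (v / s) / B s)%C).
  assert (m1 : Cmod (- (1)) = 1) by apply Cmod_m1.
  assert (hBc : forall z, Cmod z = 1 -> Cmod (B z) = 1).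
  { intros z hz. unfold B. rewrite Cmod_mult, 2!blaschke_circle by assumption. ring. }
  assert (nB : forall z, Cmod z = 1 -> B z <> 0).
  { intros z hz. apply Cmod_gt_0. rewrite hBc by exact hz. lra. }
  assert (cB : forall z, Cmod z = 1 -> ccont B z).
  { intros z hz. unfold B.
    apply ccont_mult; apply cdiff_ccont, blaschke_cdiff; rewrite hz; lra. }
  assert (quot : forall v z, Cmod z = 1 -> Cmod (v / z)%C = Cmod v).
  { intros v z hz. rewrite Cmod_div, hz; [field|]. apply Cmod_gt_0. lra. }
  assert (he : forall v z, Cmod v < 1 -> Cmod z = 1 -> Cmod (e v z) < 1).
  { intros v z hv hz. unfold e. rewrite Cmod_div, hBc, Rdiv_1_r by auto.
    apply blaschke_lt_1; [exact hrho1|]. now rewrite quot. }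
  assert (ce : forall v z, Cmod v < 1 -> Cmod z = 1 -> ccont (e v) z).
  { intros v z hv hz. unfold e. apply ccont_div; [now apply nB| |now apply cB].
    apply (ccont_blaschke (fun _ => RtoC rho) (fun s => v / s)%C).
    - apply blaschke_den_neq_0. rewrite quot by exact hz. apply Cmod_mult_lt_1; lra.
    - apply ccont_const.
    - apply ccont_div; [apply Cmod_gt_0; lra|apply ccont_const|apply ccont_id]. }
  assert (copp : forall z, ccont (fun s => - s)%C z)
    by (intros z; apply cdiff_ccont, cdiff_opp, cdiff_id).
  assert (c1 : ccont (e c) 1) by (apply ce; [exact hc|apply Cmod_1]).
  assert (c2 : ccont (fun s => e d (- s)%C) 1).
  { apply (ccont_comp (e d)); [apply copp|]. now apply ce. }
  assert (b11 : blaschke 1 (- (1))%C = 1).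
  { unfold blaschke. replace (Cconj 1) with (RtoC 1)
      by (unfold Cconj, RtoC; simpl; f_equal; ring).
    field. }
  assert (d11 : (1 - Cconj 1 * - (1))%C <> 0).
  { replace (Cconj 1) with (RtoC 1) by (unfold Cconj, RtoC; simpl; f_equal; ring).
    replace (1 - 1 * - (1))%C with (RtoC 2).
    - intros h. apply RtoC_inj in h. lra.
    - rewrite <- RtoC_opp, <- RtoC_mult, <- RtoC_minus. f_equal. ring. }
  assert (cb : ccont (fun s => blaschke s (- s)%C) 1).
  { apply (ccont_blaschke (fun s => s) (fun s => - s)%C); [exact d11|apply ccont_id|apply copp]. }
  assert (hec := he c 1 hc Cmod_1). assert (hed := he d (- (1))%C hd m1).
  assert (ch : ccont (fun s => (blaschke (e c s) (e d (- s)) / blaschke s (- s))%C) 1).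
  { apply ccont_div; [rewrite b11; apply C1_nz| |exact cb].
    apply (ccont_blaschke (e c) (fun s => e d (- s)%C)); [|exact c1|exact c2].
    apply blaschke_den_neq_0. apply Cmod_mult_lt_1; lra. }
  assert (hh : Cmod (blaschke (e c 1) (e d (- (1))%C) / blaschke 1 (- (1))%C)%C < 1).
  { rewrite b11. rewrite Cmod_div, Cmod_1, Rdiv_1_r by apply C1_nz. now apply blaschke_lt_1. }
  assert (nearc : forall v, Cmod v < 1 -> near 1 (fun s => Cmod (v / s)%C < 1)).
  { intros v hv. apply (ccont_near_lt (fun s => v / s)%C).
    - apply ccont_div; [apply C1_nz|apply ccont_const|apply ccont_id].
    - now rewrite quot by apply Cmod_1. }
  assert (E1 := ccont_near_lt _ _ _ c1 hec).
  assert (E2 := ccont_near_lt _ _ _ c2 hed).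
  assert (E3 := ccont_near_lt _ _ _ ch hh).
  assert (E4 := nearc c hc). assert (E5 := nearc d hd).
  assert (E6 := ccont_near_neq B 1 0 (cB 1 Cmod_1) (nB 1 Cmod_1)).
  assert (E7 := ccont_near_neq (fun s => B (- s)%C) 1 0
     (ccont_comp B _ 1 (copp 1) (cB _ m1)) (nB _ m1)).
  assert (E8 := ccont_near_neq (fun s => s) 1 0 (ccont_id 1) C1_nz).
  assert (E9 := ccont_near_neq _ 1 0 cb (eq_ind_r (fun x => x <> RtoC 0) C1_nz b11)).
  generalize (filter_and _ _ E1 (filter_and _ _ E2 (filter_and _ _ E3 (filter_and _ _ E4
    (filter_and _ _ E5 (filter_and _ _ E6 (filter_and _ _ E7 (filter_and _ _ E8 E9)))))))).
  apply filter_imp.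
  intros s (k1 & k2 & k3 & k4 & k5 & k6 & k7 & k8 & k9) hs.
  assert (hms : Cmod (- s) < 1) by now rewrite Cmod_opp.
  destruct (two_point_interpolation s (- s)%C (e c s) (e d (- s)%C)) as (g & hg & g1 & g2); auto.
  { intros h. rewrite <- h, blaschke_self in k9. now apply k9. }
  { rewrite Cmod_div in k3 by exact k9. apply Rlt_div_l in k3; [lra|now apply Cmod_gt_0]. }
  assert (hX : forall z, Cmod z < 1 -> Cmod (B z * g z) < 1).
  { intros z hz. rewrite Cmod_mult. apply Cmod_mult_lt_1; [|now apply hg].
    unfold B. rewrite Cmod_mult.
    assert (u1 := blaschke_lt_1 l1 z hl1 hz). assert (u2 := blaschke_lt_1 l2 z hl2 hz).
    left. apply Cmod_mult_lt_1; lra. }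
  assert (Bl1 : B l1 = 0) by (unfold B; rewrite blaschke_self; ring).
  assert (Bl2 : B l2 = 0) by (unfold B; rewrite blaschke_self; ring).
  exists (fun z => z * blaschke rho (B z * g z))%C. repeat split.
  - apply cdiff_mult; [apply cdiff_id|].
    apply cdiff_blaschke_comp; [exact hrho1|left; now apply hX|].
    apply cdiff_mult; [|now apply hg].
    unfold B. apply cdiff_mult; apply blaschke_cdiff; apply Cmod_mult_lt_1; lra.
  - assert (u1 := blaschke_lt_1 rho _ hrho1 (hX z H)). rewrite Cmod_mult, Rmult_comm.
    apply Cmod_mult_lt_1; lra.
  - ring.
  - fold l1. rewrite Bl1, Cmult_0_l, blaschke_0_r. unfold l1. field. exact nr.
  - fold l2. rewrite Bl2, Cmult_0_l, blaschke_0_r. unfold l2. field. exact nr.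
  - rewrite g1. replace (B s * e c s)%C with (blaschke rho (c / s)) by (unfold e; field; exact k6).
    rewrite blaschke_involutive; [field; exact k8|exact hrho1|lra].
  - rewrite g2. replace (B (- s) * e d (- s))%C with (blaschke rho (d / - s))
      by (unfold e; field; exact k7).
    rewrite blaschke_involutive; [field; exact k8|exact hrho1|].
    replace (d / - s)%C with (- (d / s))%C by (field; exact k8). rewrite Cmod_opp. lra.
Qed.

(** * Discs through the four poles *)

Definition quad_preimages (f g : C -> C) (a1 a2 b1 b2 p q r s : C) : Prop :=
  (preimage_or_1 f a1 p /\ preimage_or_1 f a1 q /\
   preimage_or_1 f a2 r /\ preimage_or_1 f a2 s) /\
  (preimage_or_1 g b1 p /\ preimage_or_1 g b1 r /\
   preimage_or_1 g b2 q /\ preimage_or_1 g b2 s).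

Definition row_bounds (a a' p q r s : C) : Prop :=
  Cmod a <= Cmod (p * q) /\ Cmod a' <= Cmod (r * s) /\
  polynomial_bound a a' p q r /\ polynomial_bound a a' p q s /\
  polynomial_bound a' a r s p /\ polynomial_bound a' a r s q.

Definition near_configuration (a1 a2 b1 b2 p q r s : C) : Prop :=
  (Cmod p <= 1 /\ Cmod q <= 1 /\ Cmod r <= 1 /\ Cmod s <= 1) /\
  row_bounds a1 a2 p q r s /\ row_bounds b1 b2 p r q s.

(** The points of a row differ because the other coordinate separates them. *)
Lemma preimages_distinct (g : C -> C) (b b' p q : C) :
  b <> b' -> preimage_or_1 g b p -> preimage_or_1 g b' q -> p <> q \/ p = 1.
Proof.
  intros hb [[h1 h2]|h] hq; [left|now right]. intros e. rewrite <- e in hq.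
  destruct hq as [[_ h3]|h3].
  - apply hb. now rewrite <- h2, <- h3.
  - rewrite h3, Cmod_1 in h1. lra.
Qed.

Lemma quad_row_bounds (f : C -> C) (g : C -> C) (a1 a2 b1 b2 p q r s : C) :
  disc_map f -> f 0 = 0 ->
  Cmod a1 < 1 -> Cmod a2 < 1 -> a1 <> 0 -> a2 <> 0 -> b1 <> b2 ->
  quad_preimages f g a1 a2 b1 b2 p q r s -> row_bounds a1 a2 p q r s.
Proof.
  intros hf h0 ha1 ha2 na1 na2 hb ((p1 & p2 & p3 & p4) & (p5 & p6 & p7 & p8)).
  assert (d1 := preimages_distinct g b1 b2 p q hb p5 p7).
  assert (d2 := preimages_distinct g b1 b2 r s hb p6 p8).
  split; [now apply (two_preimages_bound f)|].
  split; [now apply (two_preimages_bound f)|].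
  split; [|split; [|split]]; now apply (two_preimages_polynomial_bound f).
Qed.

Lemma quad_near_configuration (f g : C -> C) (a1 a2 b1 b2 p q r s : C) :
  disc_map f -> disc_map g -> f 0 = 0 -> g 0 = 0 ->
  Cmod a1 < 1 -> Cmod a2 < 1 -> Cmod b1 < 1 -> Cmod b2 < 1 ->
  a1 <> 0 -> a2 <> 0 -> b1 <> 0 -> b2 <> 0 -> a1 <> a2 -> b1 <> b2 ->
  quad_preimages f g a1 a2 b1 b2 p q r s ->
  near_configuration a1 a2 b1 b2 p q r s.
Proof.
  intros hf hg f0 g0 ha1 ha2 hb1 hb2 na1 na2 nb1 nb2 ha hb H.
  assert (H' := H). destruct H' as ((p1 & p2 & p3 & p4) & (p5 & p6 & p7 & p8)).
  split; [repeat split; eapply preimage_or_1_le_1; eassumption|]. split.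
  - now apply (quad_row_bounds f g a1 a2 b1 b2).
  - apply (quad_row_bounds g f b1 b2 a1 a2); auto. split; tauto.
Qed.

(** The lower bounds for the rows multiply to the minimal value, so that equality holds
    in each of them, and likewise for the columns. *)
Lemma near_configuration_extremal (a1 a2 b1 b2 p q r s : C) :
  a1 <> 0 -> a2 <> 0 -> b1 <> 0 -> b2 <> 0 ->
  near_configuration a1 a2 b1 b2 p q r s ->
  Cmod p * Cmod q * (Cmod r * Cmod s) <= Cmod a1 * Cmod a2 ->
  Cmod a1 * Cmod a2 = Cmod b1 * Cmod b2 ->
  extremal_configuration a1 a2 b1 b2 p q r s.
Proof.
  intros na1 na2 nb1 nb2 (hbd & hr & hc) hprod hab.
  assert (rel : forall a a' p q z, polynomial_bound a a' p q z ->
            Cmod (p * q) = Cmod a -> blaschke_relation a a' p q z).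
  { intros a a' p' q' z hpb he hz. unfold polynomial_bound in hpb.
    rewrite he, Rminus_eq_0, Rmult_0_l in hpb.
    apply Ceq_minus, Cmod_eq_0. apply Rle_antisym; [|apply Cmod_ge_0].
    apply Rnot_lt_le. intros hlt.
    assert (h1 : 0 < 1 - Cmod z ^ 2) by (assert (h := Cmod_ge_0 z); nra).
    assert (h2 := Rmult_lt_0_compat _ _ (pow_lt _ 2 hlt) h1). lra. }
  assert (rows : forall a a' p q r s : C, a <> 0 -> a' <> 0 -> row_bounds a a' p q r s ->
            Cmod p * Cmod q * (Cmod r * Cmod s) <= Cmod a * Cmod a' ->
            extremal_rows a a' p q r s).
  { intros a a' p' q' r' s' na na' (h1 & h2 & h3 & h4 & h5 & h6) hle.
    assert (k1 : 0 < Cmod a) by now apply Cmod_gt_0.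
    assert (k2 : 0 < Cmod a') by now apply Cmod_gt_0.
    rewrite <- 2!Cmod_mult in hle.
    assert (e1 : Cmod (p' * q') = Cmod a)
      by (apply Rle_antisym; [apply Rnot_lt_le; intros hlt; nra|exact h1]).
    assert (e2 : Cmod (r' * s') = Cmod a')
      by (apply Rle_antisym; [apply Rnot_lt_le; intros hlt; nra|exact h2]).
    split; [exact e1|]. split; [exact e2|]. repeat split; apply rel; assumption. }
  split; [exact hbd|]. split.
  - apply rows; assumption.
  - apply rows; auto. lra.
Qed.

Lemma rlim_mult {T : Type} (F : (T -> Prop) -> Prop) {FF : Filter F}
    (f g : T -> R) (l m : R) :
  filterlim f F (locally l) -> filterlim g F (locally m) ->
  filterlim (fun x => f x * g x) F (locally (l * m)).
Proof.
  intros hf hg. apply (filterlim_comp_2 (F := F) (G := locally l) (H := locally m) f g Rmult hf hg).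
  apply (filterlim_mult (K := R_AbsRing)).
Qed.

Lemma rlim_minus {T : Type} (F : (T -> Prop) -> Prop) {FF : Filter F}
    (f g : T -> R) (l m : R) :
  filterlim f F (locally l) -> filterlim g F (locally m) ->
  filterlim (fun x => f x - g x) F (locally (l - m)).
Proof.
  intros hf hg.
  apply (filterlim_comp_2 (F := F) (G := locally l) (H := locally (opp m))
           f (fun x => - g x) Rplus hf).
  - apply (filterlim_comp _ _ _ g Ropp F (locally m)); [exact hg|].
    apply (filterlim_opp (V := R_NormedModule)).
  - apply (filterlim_plus (V := R_NormedModule)).
Qed.

Lemma rlim_le {T : Type} (F : (T -> Prop) -> Prop) {FF : ProperFilter F}
    (f g : T -> R) (l m : R) :
  filterlim f F (locally l) -> filterlim g F (locally m) ->
  F (fun x => f x <= g x) -> l <= m.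
Proof.
  intros hf hg h. exact (filterlim_le (F := F) f g (Finite l) (Finite m) h hf hg).
Qed.

Lemma polynomial_bound_limit {T : Type} (F : (T -> Prop) -> Prop) {FF : ProperFilter F}
    (a a' : C) (p q z : T -> C) (p0 q0 z0 : C) :
  clim F p p0 -> clim F q q0 -> clim F z z0 ->
  F (fun t => polynomial_bound a a' (p t) (q t) (z t)) ->
  polynomial_bound a a' p0 q0 z0.
Proof.
  intros hp hq hz H. unfold polynomial_bound in *.
  assert (hN : clim F (fun t => (1 - Cconj (p t) * z t) * (1 - Cconj (q t) * z t))%C
                 ((1 - Cconj p0 * z0) * (1 - Cconj q0 * z0))%C).
  { apply clim_mult; try exact _; (apply clim_minus; [exact _|apply clim_const; exact _|]);
      (apply clim_mult; [exact _|apply clim_conj; [exact _|]|]); assumption. }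
  assert (hpq : clim F (fun t => p t * q t)%C (p0 * q0)%C)
    by (apply clim_mult; [exact _|assumption|assumption]).
  assert (hL : clim F (fun t => blaschke a a' * (p t * q t) *
       ((1 - Cconj (p t) * z t) * (1 - Cconj (q t) * z t)) - a * ((p t - z t) * (q t - z t)))%C
      (blaschke a a' * (p0 * q0) * ((1 - Cconj p0 * z0) * (1 - Cconj q0 * z0))
        - a * ((p0 - z0) * (q0 - z0)))%C).
  { apply clim_minus; [exact _| |].
    - apply clim_mult; [exact _| |exact hN].
      apply clim_mult; [exact _|apply clim_const; exact _|exact hpq].
    - apply clim_mult; [exact _|apply clim_const; exact _|].
      apply clim_mult; [exact _| |]; apply clim_minus; try exact _; assumption. }
  assert (sq : forall (f : T -> C) l, clim F f l ->
             filterlim (fun t => Cmod (f t) ^ 2) F (locally (Cmod l ^ 2))).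
  { intros f l hf. assert (h := clim_Cmod F f l hf). simpl.
    apply rlim_mult; [exact _|exact h|]. apply rlim_mult; [exact _|exact h|apply filterlim_const]. }
  refine (rlim_le F _ _ _ _ _ _ H).
  - apply rlim_mult; [exact _|now apply sq|].
    apply rlim_minus; [exact _|apply filterlim_const|now apply sq].
  - apply rlim_mult; [exact _| |now apply sq].
    apply rlim_minus; [exact _|now apply sq|apply filterlim_const].
Qed.

Lemma row_bounds_limit {T : Type} (F : (T -> Prop) -> Prop) {FF : ProperFilter F}
    (a a' : C) (p q r s : T -> C) (p0 q0 r0 s0 : C) :
  clim F p p0 -> clim F q q0 -> clim F r r0 -> clim F s s0 ->
  F (fun t => row_bounds a a' (p t) (q t) (r t) (s t)) ->
  row_bounds a a' p0 q0 r0 s0.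
Proof.
  intros hp hq hr hs H. unfold row_bounds in *.
  split; [|split; [|split; [|split; [|split]]]].
  - apply (clim_Cmod_le F (fun _ => a) (fun t => p t * q t)%C);
      [apply clim_const; exact _|apply clim_mult; [exact _| |]; assumption|].
    generalize H. apply filter_imp. tauto.
  - apply (clim_Cmod_le F (fun _ => a') (fun t => r t * s t)%C);
      [apply clim_const; exact _|apply clim_mult; [exact _| |]; assumption|].
    generalize H. apply filter_imp. tauto.
  - apply (polynomial_bound_limit F a a' p q r); auto. generalize H. apply filter_imp. tauto.
  - apply (polynomial_bound_limit F a a' p q s); auto. generalize H. apply filter_imp. tauto.
  - apply (polynomial_bound_limit F a' a r s p); auto. generalize H. apply filter_imp. tauto.
  - apply (polynomial_bound_limit F a' a r s q); auto. generalize H. apply filter_imp. tauto.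
Qed.

(** Nearly extremal configurations form a filter on the compact set of quadruples of
    points of the closed disc, and cluster at an extremal one. *)
Lemma extremal_configuration_exists (a1 a2 b1 b2 : C) :
  a1 <> 0 -> a2 <> 0 -> b1 <> 0 -> b2 <> 0 ->
  Cmod a1 * Cmod a2 = Cmod b1 * Cmod b2 ->
  (forall eps, 0 < eps -> exists p q r s,
     near_configuration a1 a2 b1 b2 p q r s /\
     Cmod p * Cmod q * (Cmod r * Cmod s) <= Cmod a1 * Cmod a2 + eps) ->
  exists p q r s, extremal_configuration a1 a2 b1 b2 p q r s.
Proof.
  intros na1 na2 nb1 nb2 hab hex.
  pose (good := fun (eps : R) (t : C * C * (C * C)) =>
    near_configuration a1 a2 b1 b2 (fst (fst t)) (snd (fst t)) (fst (snd t)) (snd (snd t)) /\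
    Cmod (fst (fst t)) * Cmod (snd (fst t)) * (Cmod (fst (snd t)) * Cmod (snd (snd t)))
      <= Cmod a1 * Cmod a2 + eps).
  pose (F := fun P : C * C * (C * C) -> Prop =>
               exists eps, 0 < eps /\ forall t, good eps t -> P t).
  assert (hF : ProperFilter F).
  { constructor.
    - intros P (eps & he & h). destruct (hex eps he) as (p & q & r & s & h1).
      exists ((p, q), (r, s)). apply h. exact h1.
    - constructor.
      + exists 1. split; [lra|auto].
      + intros P Q (e1 & he1 & h1) (e2 & he2 & h2). exists (Rmin e1 e2).
        split; [now apply Rmin_pos|]. intros t [ht1 ht2].
        assert (m1 := Rmin_l e1 e2). assert (m2 := Rmin_r e1 e2).
        split; [apply h1|apply h2]; (split; [exact ht1|lra]).
      + intros P Q hPQ (e & he & h). exists e. auto. }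
  assert (hgood : forall eps, 0 < eps -> F (good eps)).
  { intros eps he. exists eps. auto. }
  assert (h1 := hgood 1 Rlt_0_1).
  destruct (bounded_ccluster F (fun t => fst (fst t)) 1) as (G1 & p & hG1 & i1 & l1).
  { generalize h1. apply filter_imp. intros t [[hb _] _]. tauto. }
  destruct (bounded_ccluster G1 (fun t => snd (fst t)) 1) as (G2 & q & hG2 & i2 & l2).
  { apply i1. generalize h1. apply filter_imp. intros t [[hb _] _]. tauto. }
  destruct (bounded_ccluster G2 (fun t => fst (snd t)) 1) as (G3 & r & hG3 & i3 & l3).
  { apply i2, i1. generalize h1. apply filter_imp. intros t [[hb _] _]. tauto. }
  destruct (bounded_ccluster G3 (fun t => snd (snd t)) 1) as (G & s & hG & i4 & l4).
  { apply i3, i2, i1. generalize h1. apply filter_imp. intros t [[hb _] _]. tauto. }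
  assert (up : forall P, F P -> G P) by auto.
  assert (k1 : clim G (fun t => fst (fst t)) p) by (intros e he; apply i4, i3, i2, l1, he).
  assert (k2 : clim G (fun t => snd (fst t)) q) by (intros e he; apply i4, i3, l2, he).
  assert (k3 : clim G (fun t => fst (snd t)) r) by (intros e he; apply i4, l3, he).
  assert (hone : forall (u : C * C * (C * C) -> C) (l : C), clim G u l ->
             G (fun t => Cmod (u t) <= 1) -> Cmod l <= 1).
  { intros u l hu hle. rewrite <- Cmod_1.
    apply (clim_Cmod_le G u (fun _ => RtoC 1)); [exact hu|apply clim_const; exact _|].
    rewrite Cmod_1. exact hle. }
  exists p, q, r, s. apply near_configuration_extremal; auto.
  - split; [|split].
    + split; [|split; [|split]]; eapply hone; eauto; apply up; generalize h1;
        apply filter_imp; intros t [[hb _] _]; tauto.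
    + apply (row_bounds_limit G a1 a2 _ _ _ _ p q r s k1 k2 k3 l4).
      apply up. generalize h1. apply filter_imp. intros t [(_ & hr & _) _]. exact hr.
    + apply (row_bounds_limit G b1 b2 _ _ _ _ p r q s k1 k3 k2 l4).
      apply up. generalize h1. apply filter_imp. intros t [(_ & _ & hc) _]. exact hc.
  - apply Rnot_lt_le. intros hlt.
    assert (hlim : filterlim (fun t => Cmod (fst (fst t)) * Cmod (snd (fst t)) *
              (Cmod (fst (snd t)) * Cmod (snd (snd t)))) G
              (locally (Cmod p * Cmod q * (Cmod r * Cmod s)))).
    { apply rlim_mult; [exact _| |]; apply rlim_mult; try exact _;
        (apply clim_Cmod; [exact _|assumption]). }
    pose (eps := (Cmod p * Cmod q * (Cmod r * Cmod s) - Cmod a1 * Cmod a2) / 2).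
    assert (he : 0 < eps) by (unfold eps; lra).
    assert (hle : Cmod p * Cmod q * (Cmod r * Cmod s) <= Cmod a1 * Cmod a2 + eps).
    { refine (rlim_le G _ (fun _ => Cmod a1 * Cmod a2 + eps) _ _ hlim _ _).
      - apply filterlim_const.
      - apply up. generalize (hgood eps he). apply filter_imp. intros t [_ ht]. exact ht. }
    unfold eps in *. lra.
Qed.

(** * Analytic discs *)

Lemma is_derive_near {V : NormedModule C_AbsRing} (f : C -> V) (z : C) (l : V) :
  is_derive (K := C_AbsRing) f z l <->
  forall eps, 0 < eps -> near z (fun w =>
    norm (minus (minus (f w) (f z)) (scal (Cminus w z : C_AbsRing) l)) <= eps * Cmod (w - z)).
Proof.
  split.
  - intros [_ h] eps he. apply (h z (fun P hP => hP) (mkposreal eps he)).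
  - intros h. split; [apply is_linear_scal_l|].
    intros x hx eps.
    assert (e : z = x).
    { apply (is_filter_lim_locally_unique (V := AbsRing_NormedModule C_AbsRing)). exact hx. }
    rewrite <- e. exact (h eps (cond_pos eps)).
Qed.

Lemma cdiff_of_linear_error (f : C -> C) (z l : C) :
  (forall eps, 0 < eps ->
     near z (fun w => Cmod (f w - f z - l * (w - z)) <= eps * Cmod (w - z))) ->
  cdiff f z.
Proof.
  intros h.
  exists (fun w => if Ceq_dec w z then l else (f w - f z) / (w - z))%C. split.
  - intros eps he. generalize (h (eps / 2) ltac:(lra)). apply filter_imp. intros w hw.
    destruct (Ceq_dec z z) as [_|hn]; [|now elim hn].
    destruct (Ceq_dec w z) as [_|hne].
    + replace (l - l)%C with (RtoC 0) by ring. rewrite Cmod_0. exact he.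
    + assert (hn := Cminus_eq_contra _ _ hne).
      assert (hp : 0 < Cmod (w - z)) by now apply Cmod_gt_0.
      replace ((f w - f z) / (w - z) - l)%C with ((f w - f z - l * (w - z)) / (w - z))%C
        by (field; exact hn).
      rewrite Cmod_div by exact hn. apply Rlt_div_l; [exact hp|]. nra.
  - intros w. destruct (Ceq_dec w z) as [->|hne]; [ring|].
    field. now apply Cminus_eq_contra.
Qed.

Lemma ex_derive_cdiff (f : C -> C) (z : C) :
  ex_derive (K := C_AbsRing) (V := C_NormedModule) f z <-> cdiff f z.
Proof.
  split.
  - intros [l hl]. apply (cdiff_of_linear_error f z l). intros eps he.
    generalize (proj1 (is_derive_near (V := C_NormedModule) f z l) hl eps he).
    apply filter_imp. intros w hw. rewrite Cmult_comm. exact hw.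
  - intros hf. destruct (cdiff_linear_error f z hf) as [l hl]. exists l.
    apply (is_derive_near (V := C_NormedModule)). intros eps he.
    generalize (hl eps he). apply filter_imp. intros w hw.
    rewrite Cmult_comm in hw. exact hw.
Qed.

Lemma ex_derive_pair (psi : C -> C2) (z : C) :
  ex_derive (K := C_AbsRing) (V := C2) psi z <->
  cdiff (fun w => fst (psi w)) z /\ cdiff (fun w => snd (psi w)) z.
Proof.
  split.
  - intros [l hl].
    assert (h := proj1 (is_derive_near (V := C2) psi z l) hl).
    split; [apply (cdiff_of_linear_error _ z (fst l))|apply (cdiff_of_linear_error _ z (snd l))];
      intros eps he; generalize (h eps he); apply filter_imp; intros w hw;
      (eapply Rle_trans; [|exact hw]); rewrite Cmult_comm.
    + eapply Rle_trans; [|apply sqrt_plus_sqr]. eapply Rle_trans; [|apply Rmax_l].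
      rewrite Rabs_pos_eq by apply norm_ge_0. apply Rle_refl.
    + eapply Rle_trans; [|apply sqrt_plus_sqr]. eapply Rle_trans; [|apply Rmax_r].
      rewrite (Rabs_pos_eq (norm (snd _))) by apply norm_ge_0. apply Rle_refl.
  - intros [h1 h2]. destruct (cdiff_linear_error _ z h1) as [l1 hl1].
    destruct (cdiff_linear_error _ z h2) as [l2 hl2].
    exists ((l1, l2) : C2). apply (is_derive_near (V := C2)). intros eps he.
    assert (he2 : 0 < eps / 2) by lra.
    generalize (filter_and _ _ (hl1 (eps / 2) he2) (hl2 (eps / 2) he2)).
    apply filter_imp. intros w [g1 g2]. rewrite Cmult_comm in g1, g2.
    assert (hs : forall x y : R, 0 <= x -> 0 <= y -> sqrt (x ^ 2 + y ^ 2) <= x + y).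
    { intros x y hx hy. rewrite <- (sqrt_pow2 (x + y)) by lra.
      apply sqrt_le_1_alt.
      assert (hxy := Rmult_le_pos x y hx hy). lra. }
    eapply Rle_trans; [apply hs; apply norm_ge_0|].
    apply Rle_trans with (eps / 2 * Cmod (w - z) + eps / 2 * Cmod (w - z)); [|lra].
    apply Rplus_le_compat; [exact g1|exact g2].
Qed.

Lemma analytic_disc_unit_disc (f : C -> C) :
  analytic_disc (V := C_NormedModule) unit_disc f <-> disc_map f.
Proof.
  split; intros h z hz; destruct (h z hz) as [h1 h2];
    (split; [now apply ex_derive_cdiff|exact h2]).
Qed.

Lemma analytic_disc_bidisc (psi : C -> C2) :
  analytic_disc bidisc psi <->
  disc_map (fun z => fst (psi z)) /\ disc_map (fun z => snd (psi z)).
Proof.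
  split.
  - intros h. split; intros z hz; destruct (h z hz) as [h1 [h2 h3]];
      apply ex_derive_pair in h1; (split; [apply h1|assumption]).
  - intros [h1 h2] z hz. destruct (h1 z hz) as [d1 b1]. destruct (h2 z hz) as [d2 b2].
    split; [now apply ex_derive_pair|]. now split.
Qed.

(** * The Lempert functions of the pole sets *)

Definition list_prod (l : list R) : R := fold_right Rmult 1 l.

Lemma list_prod_app (l m : list R) : list_prod (l ++ m) = list_prod l * list_prod m.
Proof.
  induction l as [|x l IH]; simpl; [ring|]. unfold list_prod in *. simpl. rewrite IH. ring.
Qed.

Lemma list_prod_permutation (l m : list R) : Permutation l m -> list_prod l = list_prod m.
Proof.
  unfold list_prod. induction 1; simpl; [reflexivity|now rewrite IHPermutation|ring|congruence].
Qed.

Lemma list_prod_map_1 {V : Type} (f : V -> R) (l : list V) :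
  (forall c, In c l -> f c = 1) -> list_prod (map f l) = 1.
Proof.
  unfold list_prod. induction l as [|c l IH]; simpl; intros h; [reflexivity|].
  rewrite h by now left. rewrite IH; [ring|]. intros d hd. apply h. now right.
Qed.

(** The points of a disc that meets the poles in [P] only, extended by the conventional
    point 1. *)
Definition pad {V : Type} (P : V -> Prop) (lambda : V -> C) (c : V) : C :=
  if excluded_middle_informative (P c) then lambda c else 1.

Lemma pad_in {V : Type} (P : V -> Prop) (lambda : V -> C) (c : V) :
  P c -> pad P lambda c = lambda c.
Proof. intros h. unfold pad. now destruct (excluded_middle_informative (P c)). Qed.

Lemma pad_out {V : Type} (P : V -> Prop) (lambda : V -> C) (c : V) :
  ~ P c -> pad P lambda c = 1.
Proof. intros h. unfold pad. now destruct (excluded_middle_informative (P c)). Qed.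

Lemma is_pole_product_pad {V : NormedModule C_AbsRing} (P' : V -> Prop)
    (lambda : V -> C) (r : R) (L : list V) :
  is_pole_product P' lambda r -> NoDup L -> (forall c, P' c -> In c L) ->
  r = list_prod (map (fun c => Cmod (pad P' lambda c)) L).
Proof.
  intros (l & hl & hlP & ->) hL hPL.
  pose (notin := fun c => if excluded_middle_informative (P' c) then false else true).
  assert (hnotin : forall c, notin c = true <-> ~ P' c).
  { intros c. unfold notin.
    destruct (excluded_middle_informative (P' c)); split; intros; try easy. }
  assert (hperm : Permutation (l ++ filter notin L) L).
  { apply NoDup_Permutation; [|exact hL|].
    - apply NoDup_app; [exact hl|now apply NoDup_filter|].
      intros c hc hc'. apply filter_In in hc'. destruct hc' as [_ hc'].
      apply hnotin in hc'. apply hc'. now apply hlP.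
    - intros c. rewrite in_app_iff, filter_In, hnotin. split.
      + intros [hc|[hc _]]; [apply hPL; now apply hlP|exact hc].
      + intros hc. destruct (classic (P' c)) as [h|h]; [left; now apply hlP|now right]. }
  rewrite <- (list_prod_permutation _ _ (Permutation_map _ hperm)).
  rewrite map_app, list_prod_app.
  assert (e1 : list_prod (map (fun c => Cmod (pad P' lambda c)) (filter notin L)) = 1).
  { apply list_prod_map_1. intros c hc. apply filter_In in hc.
    rewrite pad_out by (now apply hnotin). apply Cmod_1. }
  rewrite e1, Rmult_1_r. unfold list_prod. f_equal. apply map_ext_in.
  intros c hc. rewrite pad_in; [reflexivity|]. now apply hlP.
Qed.

Lemma is_pole_product_unique {V : NormedModule C_AbsRing} (P : V -> Prop)
    (lambda : V -> C) (r : R) (L : list V) :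
  is_pole_product P lambda r -> NoDup L -> (forall c, In c L <-> P c) ->
  r = list_prod (map (fun c => Cmod (lambda c)) L).
Proof.
  intros (l & hl & hlP & ->) hL hLP. apply list_prod_permutation, Permutation_map.
  apply NoDup_Permutation; auto. intros c. now rewrite hlP, hLP.
Qed.

Lemma lempert_eq {V : NormedModule C_AbsRing} (D P : V -> Prop) (z : V) (m : R) :
  (forall psi lambda r, analytic_disc D psi -> psi (RtoC 0) = z ->
     hits_poles P psi lambda -> is_pole_product P lambda r -> m <= r) ->
  (forall eps, 0 < eps -> exists psi lambda r, analytic_disc D psi /\ psi (RtoC 0) = z /\
     hits_poles P psi lambda /\ is_pole_product P lambda r /\ r <= m + eps) ->
  lempert D P z = Finite m.
Proof.
  intros hlow hup. unfold lempert. apply is_glb_Rbar_unique. split.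
  - intros r (psi & lambda & h1 & h2 & h3 & h4). simpl. now apply (hlow psi lambda).
  - intros b hb.
    assert (hle : forall eps, 0 < eps -> Rbar_le b (Finite (m + eps))).
    { intros eps he. destruct (hup eps he) as (psi & lambda & r & h1 & h2 & h3 & h4 & h5).
      apply Rbar_le_trans with (Finite r); [|exact h5].
      apply hb. now exists psi, lambda. }
    destruct b as [b| |].
    + simpl. apply Rnot_lt_le. intros hlt.
      assert (h := hle ((b - m) / 2) ltac:(lra)). simpl in h. lra.
    + exact (hle 1 Rlt_0_1).
    + exact I.
Qed.

Lemma lempert_approximation {V : NormedModule C_AbsRing} (D P : V -> Prop) (z : V) (m eps : R) :
  lempert D P z = Finite m -> 0 < eps ->
  exists psi lambda r, analytic_disc D psi /\ psi (RtoC 0) = z /\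
    hits_poles P psi lambda /\ is_pole_product P lambda r /\ r <= m + eps.
Proof.
  intros h he. apply NNPP. intros hn.
  assert (hg := Glb_Rbar_correct (fun r : R => exists psi lambda,
      analytic_disc D psi /\ psi (RtoC 0) = z /\
      hits_poles P psi lambda /\ is_pole_product P lambda r)).
  unfold lempert in h. rewrite h in hg. destruct hg as [_ hg].
  assert (hle : Rbar_le (Finite (m + eps)) (Finite m)).
  { apply hg. intros r (psi & lambda & h1 & h2 & h3 & h4). simpl.
    apply Rnot_lt_le. intros hlt. apply hn. exists psi, lambda, r.
    split; [exact h1|]. split; [exact h2|]. split; [exact h3|]. split; [exact h4|lra]. }
  simpl in hle. lra.
Qed.

Lemma disc_map_id : disc_map (fun z => z).
Proof. intros z hz. split; [apply cdiff_id|exact hz]. Qed.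

Lemma lempert_unit_disc_pair (a1 a2 : C) :
  Cmod a1 < 1 -> Cmod a2 < 1 -> a1 <> 0 -> a2 <> 0 -> a1 <> a2 ->
  lempert unit_disc (pair_set a1 a2) (RtoC 0) = Finite (Cmod a1 * Cmod a2).
Proof.
  intros ha1 ha2 na1 na2 ha.
  assert (hL : NoDup (a1 :: a2 :: nil)).
  { constructor; [intros [h|[]]; now apply ha|]. constructor; [auto|constructor]. }
  assert (hLP : forall c, In c (a1 :: a2 :: nil) <-> pair_set a1 a2 c).
  { intros c. unfold pair_set. simpl. intuition. }
  apply (lempert_eq (V := C_NormedModule)).
  - intros psi lambda r hpsi h0 hit hprod. apply analytic_disc_unit_disc in hpsi.
    rewrite (is_pole_product_unique (V := C_NormedModule) _ _ _ _ hprod hL hLP).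
    assert (hb : forall a : C, Cmod a < 1 -> a <> 0 -> pair_set a1 a2 a ->
              Cmod a <= Cmod (lambda a)).
    { intros a h1 h2 h3. destruct (hit a h3) as [h4 h5].
      assert (h6 : preimage_or_1 psi a 1) by now right.
      assert (h7 : preimage_or_1 psi a (lambda a)) by now left.
      assert (h8 := proj1 (two_preimages_bound psi a 1 (lambda a) hpsi h0 h2 h1 h6 h7
                      (or_intror eq_refl))).
      now rewrite Cmult_1_l in h8. }
    unfold list_prod. simpl. rewrite Rmult_1_r.
    apply Rmult_le_compat; try apply Cmod_ge_0; apply hb; auto; [now left|now right].
  - intros eps he. exists (fun z => z), (fun z => z), (Cmod a1 * Cmod a2).
    split; [apply analytic_disc_unit_disc, disc_map_id|]. split; [reflexivity|].
    split; [intros c [->| ->]; now split|]. split; [|lra].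
    exists (a1 :: a2 :: nil). split; [exact hL|]. split; [exact hLP|].
    simpl. ring.
Qed.

Lemma four_poles_NoDup (a1 a2 b1 b2 : C) :
  a1 <> a2 -> b1 <> b2 ->
  NoDup ((a1, b1) :: (a1, b2) :: (a2, b1) :: (a2, b2) :: nil).
Proof.
  intros ha hb. repeat constructor; simpl; intuition congruence.
Qed.

Lemma four_poles_In (a1 a2 b1 b2 : C) (c : C2) :
  In c ((a1, b1) :: (a1, b2) :: (a2, b1) :: (a2, b2) :: nil : list C2) <->
  set_prod (pair_set a1 a2) (pair_set b1 b2) c.
Proof.
  destruct c as [x y]. unfold set_prod, pair_set. simpl. split.
  - intros [h|[h|[h|[h|[]]]]]; injection h as <- <-; tauto.
  - intros [[->| ->] [->| ->]]; tauto.
Qed.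

Lemma quad_preimages_of_poles (a1 a2 b1 b2 : C) (psi : C -> C2)
    (P' : C2 -> Prop) (lambda : C2 -> C) :
  hits_poles P' psi lambda ->
  quad_preimages (fun z => fst (psi z)) (fun z => snd (psi z)) a1 a2 b1 b2
    (pad P' lambda (a1, b1)) (pad P' lambda (a1, b2))
    (pad P' lambda (a2, b1)) (pad P' lambda (a2, b2)).
Proof.
  intros hit.
  assert (h : forall x y : C,
     preimage_or_1 (fun z => fst (psi z)) x (pad P' lambda (x, y)) /\
     preimage_or_1 (fun z => snd (psi z)) y (pad P' lambda (x, y))).
  { intros x y. destruct (classic (P' (x, y))) as [hp|hp].
    - destruct (hit _ hp) as [k1 k2]. rewrite pad_in by exact hp.
      split; left; (split; [exact k1|]); now rewrite k2.
    - rewrite pad_out by exact hp. split; now right. }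
  repeat split; apply h.
Qed.

Lemma four_poles_product (a1 a2 b1 b2 : C) (mu : C2 -> C) :
  list_prod (map (fun c => Cmod (mu c))
    ((a1, b1) :: (a1, b2) :: (a2, b1) :: (a2, b2) :: nil)) =
  Cmod (mu (a1, b1)) * Cmod (mu (a1, b2)) * (Cmod (mu (a2, b1)) * Cmod (mu (a2, b2))).
Proof. unfold list_prod. simpl. ring. Qed.

(** The disc [zeta |-> (zeta, t zeta)] is contracted by [rho] and modified by
    [interpolation_near_boundary], so that the two poles off its diagonal are met at
    [x] and [-x] with [x] near 1. *)
Lemma bidisc_upper_bound (a1 a2 t : C) (eps : R) :
  Cmod a1 < 1 -> Cmod a2 < 1 -> a1 <> 0 -> a2 <> 0 -> Cmod t = 1 -> 0 < eps ->
  exists (psi : C -> C2) (p q r s : C), analytic_disc bidisc psi /\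
    psi (RtoC 0) = (RtoC 0, RtoC 0) /\
    (Cmod p < 1 /\ psi p = (a1, t * a1)%C) /\ (Cmod q < 1 /\ psi q = (a1, t * a2)%C) /\
    (Cmod r < 1 /\ psi r = (a2, t * a1)%C) /\ (Cmod s < 1 /\ psi s = (a2, t * a2)%C) /\
    Cmod p * Cmod q * (Cmod r * Cmod s) <= Cmod a1 * Cmod a2 + eps.
Proof.
  intros ha1 ha2 na1 na2 ht he.
  assert (p1 : 0 < Cmod a1) by now apply Cmod_gt_0.
  assert (p2 : 0 < Cmod a2) by now apply Cmod_gt_0.
  set (m := Cmod a1 * Cmod a2). assert (hm : 0 < m) by (apply Rmult_lt_0_compat; lra).
  (* the choice of k and rho ensures |a1|, |a2| < rho < 1 and m / rho^2 <= m + eps *)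
  pose (k := Rmax (m / (m + eps)) (Rmax (Cmod a1) (Cmod a2))).
  assert (k1 : m / (m + eps) <= k) by apply Rmax_l.
  assert (k2 : Cmod a1 <= k) by (eapply Rle_trans; [apply Rmax_l|apply Rmax_r]).
  assert (k3 : Cmod a2 <= k) by (eapply Rle_trans; [apply Rmax_r|apply Rmax_r]).
  assert (k4 : k < 1).
  { unfold k. apply Rmax_lub_lt; [|now apply Rmax_lub_lt]. apply Rlt_div_l; lra. }
  pose (rho := (1 + k) / 2).
  assert (r1 : 0 < rho) by (unfold rho; lra). assert (r2 : rho < 1) by (unfold rho; lra).
  assert (r3 : Cmod a1 < rho) by (unfold rho; lra).
  assert (r4 : Cmod a2 < rho) by (unfold rho; lra).
  assert (r5 : m <= (m + eps) * rho ^ 2).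
  { assert (hk : k <= rho ^ 2) by (unfold rho; assert (hsq := pow2_ge_0 (1 - k)); nra).
    apply Rle_div_l in k1; [|lra]. nra. }
  assert (hrho : Cmod rho = rho) by (rewrite Cmod_R; apply Rabs_pos_eq; lra).
  assert (nr : RtoC rho <> 0) by (apply Cmod_gt_0; lra).
  assert (N := filter_and _ _ (interpolation_near_boundary a1 a2 a1 a2 rho r1 r2 r3 r4 ha1 ha2)
             (interpolation_near_boundary a1 a2 a2 a1 rho r1 r2 r3 r4 ha2 ha1)).
  destruct (proj1 (nearP _ _) N) as (d & hd & H).
  pose (x := 1 - Rmin (d / 2) (1 / 2)).
  assert (hx0 : 0 < Rmin (d / 2) (1 / 2)) by (apply Rmin_pos; lra).
  assert (hx1 := Rmin_l (d / 2) (1 / 2)). assert (hx2 := Rmin_r (d / 2) (1 / 2)).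
  assert (hx : Cmod x < 1) by (rewrite Cmod_R, Rabs_pos_eq; unfold x; lra).
  destruct (H (RtoC x)) as [F1 F2].
  { rewrite <- RtoC_minus, Cmod_R. unfold x.
    replace (1 - Rmin (d / 2) (1 / 2) - 1) with (- Rmin (d / 2) (1 / 2)) by ring.
    rewrite Rabs_Ropp, Rabs_pos_eq; lra. }
  destruct (F1 hx) as (f & hf & f0 & f1 & f2 & f3 & f4).
  destruct (F2 hx) as (g & hg & g0 & g1 & g2 & g3 & g4).
  assert (l1 : Cmod (a1 / rho) = Cmod a1 / rho) by (rewrite Cmod_div by exact nr; now rewrite hrho).
  assert (l2 : Cmod (a2 / rho) = Cmod a2 / rho) by (rewrite Cmod_div by exact nr; now rewrite hrho).
  exists (fun z => (f z, t * g z)%C), (a1 / rho)%C, (RtoC x), (- RtoC x)%C, (a2 / rho)%C.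
  split; [|split; [|split; [|split; [|split; [|split]]]]].
  - apply analytic_disc_bidisc. simpl. split; [exact hf|].
    intros z hz. destruct (hg z hz) as [h1 h2]. split.
    + apply cdiff_mult; [apply cdiff_const|exact h1].
    + rewrite Cmod_mult, ht. lra.
  - rewrite f0, g0. f_equal. ring.
  - rewrite l1, f1, g1. split; [apply Rlt_div_l; lra|reflexivity].
  - rewrite f3, g3. now split.
  - rewrite Cmod_opp, f4, g4. now split.
  - rewrite l2, f2, g2. split; [apply Rlt_div_l; lra|reflexivity].
  - rewrite l1, l2, Cmod_opp.
    assert (hx0' := Cmod_ge_0 x).
    replace (Cmod a1 / rho * Cmod x * (Cmod x * (Cmod a2 / rho)))
      with (m / rho ^ 2 * Cmod x ^ 2) by (unfold m; field; lra).
    assert (hq : m / rho ^ 2 <= m + eps) by (apply Rle_div_l; [now apply pow_lt|exact r5]).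
    assert (hq0 : 0 < m / rho ^ 2) by (apply Rdiv_lt_0_compat; [exact hm|now apply pow_lt]).
    assert (hxx : Cmod x ^ 2 <= 1) by nra.
    apply Rle_trans with (m / rho ^ 2 * 1); [|lra].
    apply Rmult_le_compat_l; lra.
Qed.

Definition label_poles (a1 a2 b1 b2 : C) (w11 w12 w21 w22 : C) (c : C2) : C :=
  if Ceq_dec (fst c) a1 then (if Ceq_dec (snd c) b1 then w11 else w12)
  else (if Ceq_dec (snd c) b1 then w21 else w22).

Lemma disc_through_poles_configuration (a1 a2 b1 b2 : C) (psi : C -> C2)
    (P' : C2 -> Prop) (lambda : C2 -> C) (r : R) :
  Cmod a1 < 1 -> Cmod a2 < 1 -> Cmod b1 < 1 -> Cmod b2 < 1 ->
  a1 <> 0 -> a2 <> 0 -> b1 <> 0 -> b2 <> 0 -> a1 <> a2 -> b1 <> b2 ->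
  analytic_disc bidisc psi -> psi (RtoC 0) = (RtoC 0, RtoC 0) ->
  (forall c, P' c -> set_prod (pair_set a1 a2) (pair_set b1 b2) c) ->
  hits_poles P' psi lambda -> is_pole_product P' lambda r ->
  near_configuration a1 a2 b1 b2
    (pad P' lambda (a1, b1)) (pad P' lambda (a1, b2))
    (pad P' lambda (a2, b1)) (pad P' lambda (a2, b2)) /\
  r = Cmod (pad P' lambda (a1, b1)) * Cmod (pad P' lambda (a1, b2)) *
      (Cmod (pad P' lambda (a2, b1)) * Cmod (pad P' lambda (a2, b2))).
Proof.
  intros ha1 ha2 hb1 hb2 na1 na2 nb1 nb2 ha hb hpsi h0 hP hit hprod.
  apply analytic_disc_bidisc in hpsi. destruct hpsi as [hf hg]. split.
  - apply (quad_near_configuration (fun z => fst (psi z)) (fun z => snd (psi z))); auto.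
    + now rewrite h0.
    + now rewrite h0.
    + now apply quad_preimages_of_poles.
  - rewrite <- four_poles_product.
    apply (is_pole_product_pad (V := C2)); auto.
    + now apply four_poles_NoDup.
    + intros c hc. now apply four_poles_In, hP.
Qed.

Lemma near_configuration_product (a1 a2 b1 b2 p q r s : C) :
  near_configuration a1 a2 b1 b2 p q r s ->
  Cmod a1 * Cmod a2 <= Cmod p * Cmod q * (Cmod r * Cmod s).
Proof.
  intros (_ & (h1 & h2 & _) & _). rewrite <- (Cmod_mult p q), <- (Cmod_mult r s).
  apply Rmult_le_compat; try apply Cmod_ge_0; assumption.
Qed.

Lemma Cmod_expi (theta : R) : Cmod (expi theta) = 1.
Proof.
  unfold Cmod, expi. simpl. rewrite 2!Rmult_1_r.
  assert (h := sin2_cos2 theta). unfold Rsqr in h. rewrite Rplus_comm, h. apply sqrt_1.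
Qed.

Lemma expi_plus (x y : R) : expi (x + y) = (expi x * expi y)%C.
Proof. unfold expi, Cmult. simpl. rewrite cos_plus, sin_plus. f_equal. ring. Qed.

Lemma expi_surjective (u : C) : Cmod u = 1 -> exists theta, expi theta = u.
Proof.
  intros hu. assert (h := Cmod_sqr u). rewrite hu, pow1 in h. destruct u as [x y]. simpl in h.
  assert (hx : -1 <= x <= 1) by nra.
  assert (hs : sqrt (1 - Rsqr x) = Rabs y).
  { rewrite <- sqrt_Rsqr_abs. f_equal. unfold Rsqr. lra. }
  destruct (Rle_dec 0 y) as [hy|hy].
  - exists (acos x). unfold expi. rewrite cos_acos, sin_acos, hs, Rabs_pos_eq by assumption.
    reflexivity.
  - exists (- acos x). unfold expi. rewrite cos_neg, sin_neg, cos_acos, sin_acos, hs by assumption.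
    rewrite Rabs_left by lra. f_equal. ring.
Qed.

Lemma rotates_onto_of_images (a1 a2 b1 b2 : C) (theta : R) :
  (b1 = expi theta * a1 /\ b2 = expi theta * a2)%C \/
  (b2 = expi theta * a1 /\ b1 = expi theta * a2)%C ->
  rotates_onto theta (pair_set a1 a2) (pair_set b1 b2).
Proof.
  intros h w. unfold pair_set. split.
  - intros [->| ->]; destruct h as [[h1 h2]|[h1 h2]];
      solve [exists a1; auto | exists a2; auto].
  - intros (a & [->| ->] & ->); destruct h as [[h1 h2]|[h1 h2]]; auto.
Qed.

Lemma images_of_rotates_onto (a1 a2 b1 b2 : C) (theta : R) :
  b1 <> b2 ->
  rotates_onto theta (pair_set a1 a2) (pair_set b1 b2) ->
  (b1 = expi theta * a1 /\ b2 = expi theta * a2)%C \/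
  (b2 = expi theta * a1 /\ b1 = expi theta * a2)%C.
Proof.
  intros hb h.
  destruct (proj1 (h b1) (or_introl eq_refl)) as (x & hx & h1).
  destruct (proj1 (h b2) (or_intror eq_refl)) as (y & hy & h2).
  destruct hx as [->| ->], hy as [->| ->]; auto.
  - exfalso. apply hb. now rewrite h1, h2.
  - exfalso. apply hb. now rewrite h1, h2.
Qed.

Lemma rotation_aligned_expi (a1 a2 b1 b2 z w : C) :
  rotation_aligned a1 a2 b1 b2 z w ->
  exists phi theta, a1 = (expi phi * z)%C /\ b1 = (expi (phi + theta) * z)%C /\
    a2 = (expi phi * w)%C /\ b2 = (expi (phi + theta) * w)%C /\
    b1 = (expi theta * a1)%C /\ b2 = (expi theta * a2)%C.
Proof.
  intros (u & v & hu & hv & h1 & h2 & h3 & h4).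
  assert (nu : u <> 0) by (apply Cmod_gt_0; lra).
  destruct (expi_surjective u hu) as [phi hphi].
  destruct (expi_surjective (v / u)%C) as [theta htheta].
  { rewrite Cmod_div, hu, hv by exact nu. field. }
  exists phi, theta.
  assert (e : expi (phi + theta) = v).
  { rewrite expi_plus, hphi, htheta. field. exact nu. }
  rewrite e, hphi, htheta. repeat split; auto.
  - rewrite h2, h1. field. exact nu.
  - rewrite h4, h3. field. exact nu.
Qed.

(** * Rotations and extremal discs *)

Lemma four_points_pole_product (a1 a2 b1 b2 p q r s : C) (psi : C -> C2) :
  a1 <> a2 -> b1 <> b2 ->
  (Cmod p < 1 /\ psi p = (a1, b1)) -> (Cmod q < 1 /\ psi q = (a1, b2)) ->
  (Cmod r < 1 /\ psi r = (a2, b1)) -> (Cmod s < 1 /\ psi s = (a2, b2)) ->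
  hits_poles (set_prod (pair_set a1 a2) (pair_set b1 b2)) psi
    (label_poles a1 a2 b1 b2 p q r s) /\
  is_pole_product (set_prod (pair_set a1 a2) (pair_set b1 b2))
    (label_poles a1 a2 b1 b2 p q r s) (Cmod p * Cmod q * (Cmod r * Cmod s)).
Proof.
  intros ha hb hp hq hr hs.
  assert (L11 : label_poles a1 a2 b1 b2 p q r s (a1, b1) = p).
  { unfold label_poles. simpl. destruct (Ceq_dec a1 a1), (Ceq_dec b1 b1); congruence. }
  assert (L12 : label_poles a1 a2 b1 b2 p q r s (a1, b2) = q).
  { unfold label_poles. simpl. destruct (Ceq_dec a1 a1), (Ceq_dec b2 b1); congruence. }
  assert (L21 : label_poles a1 a2 b1 b2 p q r s (a2, b1) = r).
  { unfold label_poles. simpl. destruct (Ceq_dec a2 a1), (Ceq_dec b1 b1); congruence. }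
  assert (L22 : label_poles a1 a2 b1 b2 p q r s (a2, b2) = s).
  { unfold label_poles. simpl. destruct (Ceq_dec a2 a1), (Ceq_dec b2 b1); congruence. }
  split.
  - intros [x y] [hx hy]. simpl in hx, hy.
    destruct hx as [->| ->], hy as [->| ->].
    + exact (eq_ind_r (fun w => Cmod w < 1 /\ psi w = (a1, b1)) hp L11).
    + exact (eq_ind_r (fun w => Cmod w < 1 /\ psi w = (a1, b2)) hq L12).
    + exact (eq_ind_r (fun w => Cmod w < 1 /\ psi w = (a2, b1)) hr L21).
    + exact (eq_ind_r (fun w => Cmod w < 1 /\ psi w = (a2, b2)) hs L22).
  - exists ((a1, b1) :: (a1, b2) :: (a2, b1) :: (a2, b2) :: nil : list C2).
    split; [now apply four_poles_NoDup|]. split; [apply four_poles_In|].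
    assert (e := four_poles_product a1 a2 b1 b2 (label_poles a1 a2 b1 b2 p q r s)).
    rewrite L11, L12, L21, L22 in e. now symmetry.
Qed.

Lemma lempert_bidisc_rotated (a1 a2 b1 b2 : C) (theta : R) :
  Cmod a1 < 1 -> Cmod a2 < 1 -> Cmod b1 < 1 -> Cmod b2 < 1 ->
  a1 <> 0 -> a2 <> 0 -> b1 <> 0 -> b2 <> 0 -> a1 <> a2 -> b1 <> b2 ->
  rotates_onto theta (pair_set a1 a2) (pair_set b1 b2) ->
  lempert bidisc (set_prod (pair_set a1 a2) (pair_set b1 b2)) (RtoC 0, RtoC 0) =
    Finite (Cmod a1 * Cmod a2) /\
  Cmod a1 * Cmod a2 = Cmod b1 * Cmod b2.
Proof.
  intros ha1 ha2 hb1 hb2 na1 na2 nb1 nb2 ha hb hrot.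
  assert (himg := images_of_rotates_onto a1 a2 b1 b2 theta hb hrot).
  assert (he := Cmod_expi theta). split.
  - apply (lempert_eq (V := C2)).
    + intros psi lambda r hpsi h0 hit hprod.
      destruct (disc_through_poles_configuration a1 a2 b1 b2 psi _ lambda r
        ha1 ha2 hb1 hb2 na1 na2 nb1 nb2 ha hb hpsi h0 (fun c h => h) hit hprod) as [hc ->].
      exact (near_configuration_product _ _ _ _ _ _ _ _ hc).
    + intros eps heps.
      destruct (bidisc_upper_bound a1 a2 (expi theta) eps ha1 ha2 na1 na2 he heps)
        as (psi & p & q & r & s & hpsi & h0 & hp & hq & hr & hs & hle).
      destruct himg as [[e1 e2]|[e1 e2]]; rewrite <- e1, <- e2 in *.
      * destruct (four_points_pole_product a1 a2 b1 b2 p q r s psi ha hb hp hq hr hs)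
          as [hit hprod].
        exists psi, (label_poles a1 a2 b1 b2 p q r s), (Cmod p * Cmod q * (Cmod r * Cmod s)).
        auto.
      * destruct (four_points_pole_product a1 a2 b1 b2 q p s r psi ha hb hq hp hs hr)
          as [hit hprod].
        exists psi, (label_poles a1 a2 b1 b2 q p s r), (Cmod q * Cmod p * (Cmod s * Cmod r)).
        repeat (split; [assumption|]). lra.
  - destruct himg as [[e1 e2]|[e1 e2]]; rewrite e1, e2, 2!Cmod_mult, he; ring.
Qed.

Lemma configuration_rotation (a1 a2 b1 b2 p q r s : C) :
  Cmod a1 < 1 -> Cmod a2 < 1 -> Cmod b1 < 1 -> Cmod b2 < 1 ->
  a1 <> 0 -> a2 <> 0 -> b1 <> 0 -> b2 <> 0 -> a1 <> a2 -> b1 <> b2 ->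
  extremal_configuration a1 a2 b1 b2 p q r s ->
  exists phi theta, rotates_onto theta (pair_set a1 a2) (pair_set b1 b2) /\
    ((Cmod q < 1 /\ a1 = expi phi * q /\ b2 = expi (phi + theta) * q)%C \/
     (Cmod p < 1 /\ a1 = expi phi * p /\ b1 = expi (phi + theta) * p)%C).
Proof.
  intros ha1 ha2 hb1 hb2 na1 na2 nb1 nb2 ha hb H.
  destruct (extremal_configuration_diagonal a1 a2 b1 b2 p q r s)
    as [(hq & hr & hal)|(hp & hs & hal)]; auto;
    apply rotation_aligned_expi in hal;
    destruct hal as (phi & theta & h1 & h2 & h3 & h4 & h5 & h6); exists phi, theta;
    (split; [apply rotates_onto_of_images; tauto|]); tauto.
Qed.

(** Discs through all four poles that nearly attain the infimum provide the nearly
    extremal configurations. *)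
Lemma rotation_of_extremal_value (a1 a2 b1 b2 : C) :
  Cmod a1 < 1 -> Cmod a2 < 1 -> Cmod b1 < 1 -> Cmod b2 < 1 ->
  a1 <> 0 -> a2 <> 0 -> b1 <> 0 -> b2 <> 0 -> a1 <> a2 -> b1 <> b2 ->
  lempert bidisc (set_prod (pair_set a1 a2) (pair_set b1 b2)) (RtoC 0, RtoC 0) =
    Finite (Cmod a1 * Cmod a2) ->
  Cmod a1 * Cmod a2 = Cmod b1 * Cmod b2 ->
  exists theta, rotates_onto theta (pair_set a1 a2) (pair_set b1 b2).
Proof.
  intros ha1 ha2 hb1 hb2 na1 na2 nb1 nb2 ha hb hl hab.
  destruct (extremal_configuration_exists a1 a2 b1 b2 na1 na2 nb1 nb2 hab)
    as (p & q & r & s & hc).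
  - intros eps he.
    destruct (lempert_approximation (V := C2) _ _ _ _ _ hl he)
      as (psi & lambda & r & hpsi & h0 & hit & hprod & hle).
    destruct (disc_through_poles_configuration a1 a2 b1 b2 psi _ lambda r
        ha1 ha2 hb1 hb2 na1 na2 nb1 nb2 ha hb hpsi h0 (fun c h => h) hit hprod) as [hc hr].
    rewrite hr in hle. eexists. eexists. eexists. eexists. split; [exact hc|exact hle].
  - destruct (configuration_rotation a1 a2 b1 b2 p q r s) as (phi & theta & h & _); auto.
    now exists theta.
Qed.

Lemma rotation_disc_of_point (psi : C -> C2) (x y z0 : C) (phi theta : R) :
  analytic_disc bidisc psi -> psi (RtoC 0) = (RtoC 0, RtoC 0) ->
  Cmod z0 < 1 -> x <> 0 -> psi z0 = (x, y) ->
  x = (expi phi * z0)%C -> y = (expi (phi + theta) * z0)%C ->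
  is_rotation_disc phi theta psi.
Proof.
  intros hpsi h0 hz nx hval hx hy z hz1. apply analytic_disc_bidisc in hpsi.
  destruct hpsi as [hf hg].
  assert (nz : z0 <> 0).
  { intros e. apply nx. rewrite hx, e. ring. }
  assert (ef := schwarz_equality _ z0 hf (f_equal fst h0) hz nz).
  assert (eg := schwarz_equality _ z0 hg (f_equal snd h0) hz nz).
  simpl in ef, eg. rewrite hval in ef, eg. simpl in ef, eg.
  specialize (ef ltac:(rewrite hx, Cmod_mult, Cmod_expi; ring) z hz1).
  specialize (eg ltac:(rewrite hy, Cmod_mult, Cmod_expi; ring) z hz1).
  apply injective_projections.
  - refine (eq_trans ef _). rewrite hx. simpl. field. exact nz.
  - refine (eq_trans eg _). rewrite hy. simpl. field. exact nz.
Qed.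

(** The points of an extremal disc, those of poles not met being 1, already form an
    extremal configuration; a point in the open disc belongs to a pole that is met. *)
Lemma extremal_disc_is_rotation (a1 a2 b1 b2 : C) (psi : C -> C2) :
  Cmod a1 < 1 -> Cmod a2 < 1 -> Cmod b1 < 1 -> Cmod b2 < 1 ->
  a1 <> 0 -> a2 <> 0 -> b1 <> 0 -> b2 <> 0 -> a1 <> a2 -> b1 <> b2 ->
  lempert bidisc (set_prod (pair_set a1 a2) (pair_set b1 b2)) (RtoC 0, RtoC 0) =
    Finite (Cmod a1 * Cmod a2) ->
  Cmod a1 * Cmod a2 = Cmod b1 * Cmod b2 ->
  extremal_disc bidisc (set_prod (pair_set a1 a2) (pair_set b1 b2)) (RtoC 0, RtoC 0) psi ->
  exists phi theta, rotates_onto theta (pair_set a1 a2) (pair_set b1 b2) /\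
    is_rotation_disc phi theta psi.
Proof.
  intros ha1 ha2 hb1 hb2 na1 na2 nb1 nb2 ha hb hl hab
    (hpsi & h0 & P' & lambda & r & _ & hP & hit & hprod & hr).
  rewrite hl in hr. injection hr as hr.
  destruct (disc_through_poles_configuration a1 a2 b1 b2 psi P' lambda r
        ha1 ha2 hb1 hb2 na1 na2 nb1 nb2 ha hb hpsi h0 hP hit hprod) as [hc hr'].
  apply near_configuration_extremal in hc; auto; [|lra].
  destruct (configuration_rotation _ _ _ _ _ _ _ _ ha1 ha2 hb1 hb2 na1 na2 nb1 nb2 ha hb hc)
    as (phi & theta & hrot & hcase).
  exists phi, theta. split; [exact hrot|].
  assert (hpt : forall c, Cmod (pad P' lambda c) < 1 -> psi (pad P' lambda c) = c).
  { intros c. unfold pad. destruct (excluded_middle_informative (P' c)) as [h|h].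
    - intros _. now apply hit.
    - rewrite Cmod_1. lra. }
  destruct hcase as [(h1 & h2 & h3)|(h1 & h2 & h3)].
  - exact (rotation_disc_of_point psi a1 b2 _ phi theta hpsi h0 h1 na1 (hpt _ h1) h2 h3).
  - exact (rotation_disc_of_point psi a1 b1 _ phi theta hpsi h0 h1 na1 (hpt _ h1) h2 h3).
Qed.

Lemma rotation_disc_analytic (phi theta : R) (psi : C -> C2) :
  is_rotation_disc phi theta psi -> analytic_disc bidisc psi.
Proof.
  intros h. apply analytic_disc_bidisc.
  assert (key : forall x (f : C -> C),
             (forall z, Cmod z < 1 -> f z = (expi x * z)%C) -> disc_map f).
  { intros x f hf z hz. split.
    - apply (cdiff_ext_loc (fun w => expi x * w)%C).
      + generalize (ccont_near_lt (fun w => w) z 1 (ccont_id z) hz).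
        apply filter_imp. intros w hw. now rewrite hf.
      + apply cdiff_mult; [apply cdiff_const|apply cdiff_id].
    - rewrite hf, Cmod_mult, Cmod_expi by exact hz. lra. }
  split; [apply (key phi)|apply (key (phi + theta))]; intros z hz; now rewrite h.
Qed.

(** The disc meets the two poles [(a, e^(i theta) a)] at [e^(- i phi) a]. *)
Lemma rotation_disc_extremal (a1 a2 b1 b2 : C) (phi theta : R) (psi : C -> C2) :
  Cmod a1 < 1 -> Cmod a2 < 1 -> a1 <> a2 ->
  lempert bidisc (set_prod (pair_set a1 a2) (pair_set b1 b2)) (RtoC 0, RtoC 0) =
    Finite (Cmod a1 * Cmod a2) ->
  rotates_onto theta (pair_set a1 a2) (pair_set b1 b2) -> is_rotation_disc phi theta psi ->
  extremal_disc bidisc (set_prod (pair_set a1 a2) (pair_set b1 b2)) (RtoC 0, RtoC 0) psi.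
Proof.
  intros ha1 ha2 ha hl hrot hpsi.
  split; [now apply (rotation_disc_analytic phi theta)|].
  assert (h01 : unit_disc (RtoC 0)) by (unfold unit_disc; rewrite Cmod_0; lra).
  split; [rewrite (hpsi _ h01); now rewrite 2!Cmult_0_r|].
  pose (c1 := (a1, expi theta * a1)%C : C2). pose (c2 := (a2, expi theta * a2)%C : C2).
  assert (hc : c1 <> c2) by (intros e; apply ha; exact (f_equal fst e)).
  exists (fun c => c = c1 \/ c = c2), (fun c => expi (- phi) * fst c)%C, (Cmod a1 * Cmod a2).
  assert (hinv : (expi phi * expi (- phi))%C = 1).
  { rewrite <- expi_plus, Rplus_opp_r. unfold expi. now rewrite cos_0, sin_0. }
  assert (hpt : forall a, Cmod a < 1 -> unit_disc (expi (- phi) * a)%C /\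
             psi (expi (- phi) * a)%C = (a, expi theta * a)%C).
  { intros a h.
    assert (hu : unit_disc (expi (- phi) * a)%C).
    { unfold unit_disc. rewrite Cmod_mult, Cmod_expi. lra. }
    split; [exact hu|]. rewrite (hpsi _ hu), expi_plus. f_equal.
    - transitivity ((expi phi * expi (- phi)) * a)%C; [ring|]. rewrite hinv. ring.
    - transitivity ((expi phi * expi (- phi)) * (expi theta * a))%C; [ring|]. rewrite hinv. ring. }
  split; [exists c1; now left|]. split; [|split; [|split]].
  - intros c [->| ->]; split; simpl; unfold pair_set; auto; apply hrot.
    + exists a1. split; [now left|reflexivity].
    + exists a2. split; [now right|reflexivity].
  - intros c [->| ->]; now apply hpt.
  - exists (c1 :: c2 :: nil). split; [|split].
    + constructor; [intros [h|[]]; now apply hc|]. constructor; [auto|constructor].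
    + intros c. simpl. intuition.
    + simpl. rewrite 2!Cmod_mult, Cmod_expi. ring.
  - now rewrite hl.
Qed.

Theorem proposition6p2 (a1 a2 b1 b2 : C)
    (ha1 : unit_disc a1) (ha2 : unit_disc a2)
    (hb1 : unit_disc b1) (hb2 : unit_disc b2)
    (ha1_nz : a1 <> RtoC 0) (ha2_nz : a2 <> RtoC 0)
    (hb1_nz : b1 <> RtoC 0) (hb2_nz : b2 <> RtoC 0)
    (ha : a1 <> a2) (hb : b1 <> b2) :
  let A := pair_set a1 a2 in
  let B := pair_set b1 b2 in
  let origin : C2 := (RtoC 0, RtoC 0) in
  ((lempert bidisc (set_prod A B) origin = lempert unit_disc A (RtoC 0) /\
    lempert unit_disc A (RtoC 0) = lempert unit_disc B (RtoC 0))
   <-> exists theta : R, rotates_onto theta A B)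
  /\
  (forall theta : R, rotates_onto theta A B ->
     (Cplus a1 a2 <> RtoC 0 ->
        forall psi : C -> C2,
          extremal_disc bidisc (set_prod A B) origin psi <->
          exists phi : R, is_rotation_disc phi theta psi)
     /\
     (forall psi : C -> C2,
        extremal_disc bidisc (set_prod A B) origin psi <->
        exists phi theta' : R,
          rotates_onto theta' A B /\ is_rotation_disc phi theta' psi)).
Proof.
  intros A B origin.
  assert (lA := lempert_unit_disc_pair a1 a2 ha1 ha2 ha1_nz ha2_nz ha).
  assert (lB := lempert_unit_disc_pair b1 b2 hb1 hb2 hb1_nz hb2_nz hb).
  fold A in lA. fold B in lB.
  assert (hval : forall theta, rotates_onto theta A B ->
     lempert bidisc (set_prod A B) origin = Finite (Cmod a1 * Cmod a2) /\
     Cmod a1 * Cmod a2 = Cmod b1 * Cmod b2)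
    by (intros theta; now apply lempert_bidisc_rotated).
  split; [split|].
  - intros [e1 e2]. rewrite lA in e1. rewrite lA, lB in e2. injection e2 as e2.
    now apply rotation_of_extremal_value.
  - intros [theta hrot]. destruct (hval theta hrot) as [h1 h2].
    rewrite lA, lB, h1, h2. now split.
  - intros theta hrot. destruct (hval theta hrot) as [hl hab].
    assert (hext : forall psi, extremal_disc bidisc (set_prod A B) origin psi <->
        exists phi theta' : R, rotates_onto theta' A B /\ is_rotation_disc phi theta' psi).
    { intros psi. split.
      - now apply extremal_disc_is_rotation.
      - intros (phi & theta' & h1 & h2).
        now apply (rotation_disc_extremal a1 a2 b1 b2 phi theta'). }
    split; [|exact hext].
    intros hsum psi. rewrite hext. split.
    + intros (phi & theta' & h1 & h2). exists phi.
      (* a rotation is determined by the image a1 + a2 -> b1 + b2 of the sum *)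
      assert (hs : forall t, rotates_onto t A B -> (expi t * (a1 + a2))%C = (b1 + b2)%C).
      { intros t ht.
        destruct (images_of_rotates_onto a1 a2 b1 b2 t hb ht) as [[-> ->]|[-> ->]]; ring. }
      assert (he : expi theta = expi theta').
      { replace (expi theta) with (expi theta * (a1 + a2) / (a1 + a2))%C by (field; exact hsum).
        rewrite hs, <- (hs theta' h1) by exact hrot. field. exact hsum. }
      intros z hz. rewrite (h2 z hz), 2!expi_plus. now rewrite he.
    + intros [phi h]. now exists phi, theta.
Qed.
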